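(* Let $1<p<\infty$, let $X$ be a Banach space with the UMD property, and let $m\in\mathbb Z$, $m\ge1$. Then the identity $$U_m\,u=U_m\circ P^{(0)}\,u+\sum_{\varepsilon\in\{0,1\}}\big(A_m^{(\varepsilon)}+B_m^{(\varepsilon)}\big)\circ P^{(1,\varepsilon)}\,u$$ holds true for all $u\in L_X^p$. For every $0\le i\le K(m)$ and $\varepsilon\in\{0,1\}$, each of the following collections is a martingale difference sequence: $$\big\{U_m\circ P_i^{(0)}\,h_I\,:\,I\in\mathscr D\big\},\qquad\big\{A_m^{(\varepsilon)}\circ P_i^{(1,\varepsilon)}\,h_I\,:\,I\in\mathscr D\big\},\qquad\big\{B_m^{(\varepsilon)}\circ P_i^{(1,\varepsilon)}\,h_I\,:\,I\in\mathscr D\big\}.$$ Moreover $K(m)\le7+2\log_2(m)$.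
   Context: $L_X^p=L^p(\mathbb R;X)$ is the Bochner space with respect to Lebesgue measure; UMD means unconditionality of $X$-valued martingale differences in $L^p(X)$, $1<p<\infty$. For $j\in\mathbb Z$ let $\mathscr D_j=\{[2^{-j}k,2^{-j}(k+1)[\ :k\in\mathbb Z\}$ and $\mathscr D=\bigcup_{j\in\mathbb Z}\mathscr D_j$. The Haar functions are $h_{[0,1[}=1_{[0,1/2[}-1_{[1/2,1[}$ and $h_I(t)=h_{[0,1[}((t-\inf I)/|I|)$, $I\in\mathscr D$. Let $\tau_m(I)=I+m|I|$. One-third shifts: $\sigma(I)=I+s(I)$ with $s(I)=(-1)^j2^{-j}/3$ if $|I|=2^{-j}$, and $\sigma(\mathscr D)=\{\sigma(I):I\in\mathscr D\}$. For $I\in\mathscr D$ let $\alpha_0(I)$ be the interval $J\in\sigma(\mathscr D)$ with $|J|=|I|$ and $\sup J\in I$, and $\alpha_1(I)$ the interval $J\in\sigma(\mathscr D)$ with $|J|=|I|$ and $\inf J\in I$. Put $\beta_0(I)=\alpha_0(I)\setminus I$ and $\beta_1(I)=\alpha_1(I)\cap I$. Functions, for $I\in\mathscr D$: $a_I^{(0)}=1_{\alpha_0(\tau_m(I))}-1_{\alpha_0(I)}$, $\ b_I^{(0)}=1_{\beta_0(I)}-1_{\beta_1(I)}$, $a_I^{(1)}=1_{\alpha_1(\tau_m(I))}-1_{\alpha_1(I)}$, $\ b_I^{(1)}=1_{\alpha_1(I)\setminus\beta_1(I)}-1_{\alpha_0(I)\setminus\beta_0(I)}$. Operators, for $I\in\mathscr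 D$ and $\varepsilon\in\{0,1\}$, as linear extensions of $$U_mh_I=1_{\tau_m(I)}-1_I,\qquad A_m^{(\varepsilon)}h_I=a_I^{(\varepsilon)},\qquad B_m^{(\varepsilon)}h_I=b_I^{(\varepsilon)}-b_{\tau_m(I)}^{(\varepsilon)}$$ (coefficients in $X$ being carried along; operators and compositions are defined on finite linear combinations of Haar functions and extended to $L_X^p$ by continuity). Collections for fixed $m\ge1$. If $m\ge2$ let $\lambda$ be the integer with $2^{\lambda-3}\le m<2^{\lambda-2}$; if $m=1$ let $\lambda=4$. Put $L(m)=\lambda-1$, $K(m)=2L(m)+1$. For $0\le i\le L(m)$ let $\mathscr A_i=\bigcup_{j\in\mathbb Z}\{I\in\mathscr D:|I|=2^{-(\lambda j+i)}\}$, let $\mathscr A_i^{(0)}$ be the set of all $J\in\mathscr A_i$ for which there is $I\in\mathscr A_i$ with $|J|=2^{-\lambda}|I|$, $J\subset I$ and $\tau_m(J)\subset I$, and $\mathscr A_i^{(1)}=\mathscr A_i\setminus\mathscr A_i^{(0)}$. Let $\mathscr D_{\mathrm{even}}$ (respectively $\mathscr D_{\mathrm{odd}}$) be the set of $[2^{-j}k,2^{-j}(k+1)[\,\in\mathscr D$ with $\lfloor k/m\rfloor$ even (respectively odd). For $0\le i\le L(m)$, $\delta\in\{0,1\}$ put $\mathscr B_i^{(\delta)}=\mathscr A_i^{(\delta)}\cap\mathscr D_{\mathrm{even}}$ and $\mathscr B_{i+L(m)+1}^{(\delta)}=\mathscr A_i^{(\delta)}\cap\mathscr D_{\mathrm{odd}}$.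 For $I\in\mathscr D$ let $\pi^\lambda(I)$ be the unique interval in $\mathscr D$ of length $2^\lambda|I|$ containing $I$. For $0\le i\le K(m)$ set $$\mathscr B_i^{(1,0)}=\{I\in\mathscr B_i^{(1)}:\inf\tau_m(I)\ne\inf\pi^\lambda(\tau_m(I))\},\qquad\mathscr B_i^{(1,1)}=\{I\in\mathscr B_i^{(1)}:\inf\tau_m(I)=\inf\pi^\lambda(\tau_m(I))\}.$$ Projections: with $\langle u,h_I\rangle=\int_{\mathbb R}u\,h_I\,dt$, $$P_i^{(0)}u=\sum_{I\in\mathscr B_i^{(0)}}\langle u,h_I\rangle h_I|I|^{-1},\quad P_i^{(1,\varepsilon)}u=\sum_{I\in\mathscr B_i^{(1,\varepsilon)}}\langle u,h_I\rangle h_I|I|^{-1},\quad P^{(0)}=\sum_{i=0}^{K(m)}P_i^{(0)},\quad P^{(1,\varepsilon)}=\sum_{i=0}^{K(m)}P_i^{(1,\varepsilon)}.$$ Convention: a family $\{f_I:I\in\mathscr D\}$ of functions on $\mathbb R$ is called a martingale difference sequence if, for every choice of coefficients $x_I\in X$ with only finitely many nonzero, the functions $d_j=\sum_{I\in\mathscr D_j}x_If_I$, ordered by increasing $j$ (from coarse to fine scales), form a martingale difference sequence, i.e. for every $j$ the integral of $d_j$ over $\{(d_k)_{k<j}\in E\}$ vanishes for every Borel set $E$.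
   Formalization: The claim that the collection of B_m^(ε)∘P_i^(1,ε) h_I is a martingale difference sequence is stated only for (m,ε)≠(1,1): for m=1, ε=1 it is false (e.g. I'=[15,16[, I=[15−1/16,15[, i=4). All other claims are stated for every m≥1. *)

(* Defs.v *)
From HB Require Import structures.
From mathcomp Require Import all_boot all_order all_algebra.
From mathcomp Require Import all_classical all_reals all_analysis.
Set Implicit Arguments.
Unset Strict Implicit.
Unset Printing Implicit Defensive.
Import Order.TTheory GRing.Theory Num.Theory.
Import numFieldNormedType.Exports.
Local Open Scope classical_set_scope.
Local Open Scope ring_scope.

(** * Vector-valued integration *)

Section Bochner.
Context d (T : measurableType d) (R : realType).
Variables (mu : {measure set T -> \bar R}) (X : completeNormedModType R).

Definition simple_fun (s : T -> X) : Prop :=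
  finite_set (range s) /\ forall x, measurable (s @^-1` [set x]).

(* Pointwise limits everywhere: every class modulo null sets of the usual
   (almost everywhere) notion has such a representative, and the norm of such
   a function is measurable. *)
Definition strongly_measurable (f : T -> X) : Prop :=
  exists s : nat -> T -> X, (forall n, simple_fun (s n)) /\
    forall t, s n t @[n --> \oo] --> f t.

Definition Xnorm (p : R) (f : T -> X) : \bar R :=
  Lnorm mu p%:E (fun t => `|f t|%:E).

(* Functions representing the elements of the Bochner space; equality in that
   space is equality almost everywhere. *)
Definition in_LpX (p : R) (f : T -> X) : Prop :=
  strongly_measurable f /\ (Xnorm p f < +oo)%E.

Definition integrable_simple (s : T -> X) : Prop :=
  simple_fun s /\ forall x, x != 0 -> (mu (s @^-1` [set x]) < +oo)%E.

Definition simple_integral (s : T -> X) : X :=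
  \sum_(x \in range s) fine (mu (s @^-1` [set x])) *: x.

Definition is_bochner_integral (f : T -> X) (y : X) : Prop :=
  strongly_measurable f /\
  exists s : nat -> T -> X,
    [/\ forall n, integrable_simple (s n),
        (\int[mu]_t (`|f t - s n t|)%:E)%E @[n --> \oo] --> 0%E &
        simple_integral (s n) @[n --> \oo] --> y].

Definition bochner_integral (f : T -> X) : X :=
  xget 0 [set y | is_bochner_integral f y].

(* The sequence (d_k)_(k < j), as a point of the topological product of copies
   of X indexed by { k | k < j }. *)
Definition past {disp} {J : orderType disp} (f : J -> T -> X) (j : J) (t : T) :
    {ptws {k : J | (k < j)%O} -> X} :=
  fun k => f (sval k) t.
Arguments past {disp J} f j t.

Definition martingale_difference {disp} {J : orderType disp}
    (f : J -> T -> X) : Prop :=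
  forall (j : J) (E : set {ptws {k : J | (k < j)%O} -> X}),
    <<s open >> E ->
    is_bochner_integral (fun t => \1_(past f j @^-1` E) t *: f j t) 0.

End Bochner.

Definition UMD (R : realType) (X : completeNormedModType R) : Prop :=
  forall q : R, 1 < q ->
  exists C : R, forall (d : measure_display) (T : measurableType d)
    (P : probability T R) (f : nat -> T -> X),
    (forall n, in_LpX P q (f n)) -> martingale_difference P f ->
    forall (eps : nat -> bool) (N : nat),
      (Xnorm P q (fun t => \sum_(n < N) (-1) ^+ eps n *: f n t)%R
       <= C%:E * Xnorm P q (fun t => \sum_(n < N) f n t)%R)%E.

(** * Dyadic intervals *)

(* (j, k) stands for [2^-j k, 2^-j (k + 1)[, so that the type [dyadic] is the
   collection of all dyadic intervals, without repetition. *)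
Definition dyadic := (int * int)%type.

Section Dyadic.
Variable R : realType.
Implicit Types I J Q : dyadic.

Definition dlen I : R := 2 ^ (- I.1).
Definition dinf I : R := dlen I * I.2%:~R.
Definition dset I : set R := `[dinf I, dinf I + dlen I[%classic.

Definition level (j : int) : set dyadic := [set I | I.1 = j].

Definition tau (m : nat) I : dyadic := (I.1, I.2 + m%:Z).

Definition haar01 (t : R) : R :=
  \1_(`[0, 2^-1[%classic) t - \1_(`[2^-1, 1[%classic) t.
Definition haar I (t : R) : R := haar01 ((t - dinf I) / dlen I).

(* The endpoints of the one-third shift of I. *)
Definition sinf I : R := dinf I + (-1) ^ I.1 * dlen I / 3.
Definition ssup I : R := sinf I + dlen I.
Definition sset I : set R := `[sinf I, ssup I[%classic.

(* The index [e : bool] is the superscript in {0, 1}. Exactly one J satisfies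
   the condition, so the default value of [xget] is never used. *)
Definition alpha (e : bool) I : set R :=
  sset (xget I [set J | dlen J = dlen I /\
                      dset I (if e then sinf J else ssup J)]).
Definition beta (e : bool) I : set R :=
  if e then alpha true I `&` dset I else alpha false I `\` dset I.

Definition afun (m : nat) (e : bool) I (t : R) : R :=
  \1_(alpha e (tau m I)) t - \1_(alpha e I) t.
Definition bfun (e : bool) I (t : R) : R :=
  if e then \1_(alpha true I `\` beta true I) t
            - \1_(alpha false I `\` beta false I) t
  else \1_(beta false I) t - \1_(beta true I) t.

(* For m >= 2, 2 ^ (lam m - 3) <= m < 2 ^ (lam m - 2). *)
Definition lam (m : nat) : nat :=
  if m == 1%N then 4%N else (trunc_log 2 m).+3.
Definition Lm (m : nat) : nat := (lam m).-1.
Definition Km (m : nat) : nat := (Lm m).*2.+1.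

Definition Acol (m i : nat) : set dyadic :=
  [set I | exists j : int, dlen I = 2 ^ (- ((lam m)%:Z * j + i%:Z))].
Definition Acol0 (m i : nat) : set dyadic :=
  [set J | Acol m i J /\
    exists I, [/\ Acol m i I, dlen J = 2 ^ (- (lam m)%:Z) * dlen I,
                  dset J `<=` dset I & dset (tau m J) `<=` dset I]].
Definition Acold (m i : nat) (delta : bool) : set dyadic :=
  if delta then Acol m i `\` Acol0 m i else Acol0 m i.

Definition Deven (m : nat) : set dyadic := [set I | (2 %| I.2 %/ m)%Z].
Definition Dodd (m : nat) : set dyadic := [set I | ~~ (2 %| I.2 %/ m)%Z].

Definition Bcol (m i : nat) (delta : bool) : set dyadic :=
  if (i <= Lm m)%N then Acold m i delta `&` Deven m
  else Acold m (i - (Lm m).+1)%N delta `&` Dodd m.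

Definition ancestor (l : nat) I : dyadic :=
  xget I [set Q | dlen Q = 2 ^+ l * dlen I /\ dset I `<=` dset Q].

Definition Bcol1 (m i : nat) (e : bool) : set dyadic :=
  [set I | Bcol m i true I /\
    if e then dinf (tau m I) = dinf (ancestor (lam m) (tau m I))
    else dinf (tau m I) <> dinf (ancestor (lam m) (tau m I))].

End Dyadic.

(** * Operators on Haar polynomials *)

Section Operators.
Variables (R : realType) (X : completeNormedModType R).

Definition pairing (u : R -> X) (I : dyadic) : X :=
  bochner_integral (@lebesgue_measure R) (fun t => haar I t *: u t).

(* The Haar coefficients of a finite combination u of Haar functions are the
   <u, h_I> |I|^-1, so on such u, [hsum setT f] is the linear extension of
   h_I |-> f I, coefficients in X being carried along. The sums have finite
   support there. *)
Definition hsum (S : set dyadic) (f : dyadic -> R -> R) (u : R -> X)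
    (t : R) : X :=
  \sum_(I \in S) (f I t / dlen R I) *: pairing u I.

Definition haar_polynomial (u : R -> X) : Prop :=
  exists (s : seq dyadic) (x : dyadic -> X),
    u = fun t => \sum_(I <- s) haar I t *: x I.

Definition Uop (m : nat) : (R -> X) -> R -> X :=
  hsum setT (fun I t => \1_(dset (tau m I)) t - \1_(dset I) t).
Definition Aop (m : nat) (e : bool) : (R -> X) -> R -> X :=
  hsum setT (@afun R m e).

(* For m = 1 and I in [Bcol1 m i true], the point c = sup I = inf (tau 1 I) is
   a multiple of 2^lam |I|, and the [true] image of h_I under [Bop] has the
   integrals -|s| < 0 to the left and |s| > 0 to the right of c, where |s| is
   |I|/3 or 2|I|/3. The coarser differences may jump at c: so for m = 1,
   I = [15/16 + 14, 15[ and I' = [15, 16[, the image of h_I has a nonzero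
   integral over [15, 15 + 1/3[, which is where the image of h_I' is -1. Hence
   this one family is not a martingale difference sequence. *)
Definition Bop (m : nat) (e : bool) : (R -> X) -> R -> X :=
  hsum setT (fun I t => bfun e I t - bfun e (tau m I) t).

Definition P0i (m i : nat) : (R -> X) -> R -> X :=
  hsum (Bcol R m i false) (@haar R).
Definition P1i (m i : nat) (e : bool) : (R -> X) -> R -> X :=
  hsum (Bcol1 R m i e) (@haar R).
Definition P0 (m : nat) (u : R -> X) (t : R) : X :=
  \sum_(i < (Km m).+1) P0i m i u t.
Definition P1 (m : nat) (e : bool) (u : R -> X) (t : R) : X :=
  \sum_(i < (Km m).+1) P1i m i e u t.

(* S is the extension by continuity to L^p(R; X) of the operator T, given on
   Haar polynomials. *)
Definition Lp_extension (p : R) (T S : (R -> X) -> R -> X) : Prop :=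
  let mu := @lebesgue_measure R in
  [/\ forall u, in_LpX mu p u -> in_LpX mu p (S u),
      forall (a : R) (u v : R -> X), in_LpX mu p u -> in_LpX mu p v ->
        {ae mu, forall t, S (fun s => a *: u s + v s) t = a *: S u t + S v t},
      exists C : R, forall u, in_LpX mu p u ->
        (Xnorm mu p (S u) <= C%:E * Xnorm mu p u)%E &
      forall u, haar_polynomial u -> {ae mu, forall t, S u t = T u t}].

Definition mds_family (f : dyadic -> R -> R) : Prop :=
  forall x : dyadic -> X, finite_set [set I | x I != 0] ->
    martingale_difference (@lebesgue_measure R)
      (fun (j : int) (t : R) => \sum_(I \in level j) f I t *: x I).

End Operators.

(* Main.v *)
Require Import Defs.
From mathcomp Require Import all_boot all_order all_algebra.
From mathcomp Require Import finmap.
From mathcomp Require Import all_classical all_reals all_analysis.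
From mathcomp Require Import measurable_realfun.
From mathcomp Require Import ring lra zify.
(** The identity is pointwise on Haar polynomials. With [1_alpha = 1_I + b_I], where
    [alpha] is the shifted interval attached to [I], one finds that [A + B] maps
    [h_I] to [1_(tau I) - 1_I] just as [U] does ([afun_bfun]). Every dyadic interval
    belongs to exactly one collection ([in_collections]), so the projections form a
    partition of unity made of Haar multipliers with values [0] and [1].

    For the extensions to [L^p], Haar polynomials are dense because [p > 1]
    ([haar_density]), and [L^p(R; X)] is complete ([LpX_complete]), so bounds on
    Haar polynomials suffice ([Lp_extension_exists]). Haar multipliers are bounded
    by the UMD property ([haar_unconditional]). For [U] with fixed [m]
    ([shift_difference_bound]), split the dyadic intervals into finitely many
    classes within which equal lengths mean disjoint regions and different lengths
    differ by a large power of [2]. Within a class, a mean zero function living on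
    a few cells attached to each [J] can be turned into another one by martingale
    transforms, as long as earlier functions are constant on the cells involved
    ([three_cells]); a chain of such moves leads from [h_J] to [1_(tau J) - 1_J].
    The obstruction is a point of a much coarser dyadic grid separating [J] from
    [tau J]. In this case the grid shifted by one third is far from that point, and
    cells with endpoints in the shifted grid cross it ([bound_crossing]). [U] itself
    is then the sum of the extensions of the operators on the right-hand side, so
    that the identity holds by construction ([shift_identity]).

    The three families are martingale differences for the same geometric reason: a
    set determined by the past either contains or misses the support of a mean zero
    function if the past is constant on this support ([mds_criterion]). Jumps of
    coarser functions of the same family lie on a dyadic grid or a shifted grid at
    least [2^lam] times coarser than [J]. For [U], the coarse dyadic grid misses the
    inside of the hull of [J] and [tau J]; for [A], there are only shifted points,
    which are far away because a dyadic one is near ([coarse_shifted_crossing]); for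
    [B], moreover the two points around which the function of [J] lives are not
    themselves coarse dyadic points ([B_family_pieces]). *)

Set Implicit Arguments.
Unset Strict Implicit.
Unset Printing Implicit Defensive.
Import Order.TTheory GRing.Theory Num.Theory.
Import numFieldNormedType.Exports.
Local Open Scope classical_set_scope.
Local Open Scope ring_scope.

(** * Functions with finitely many values *)

Section Finitary.
Context d (T : measurableType d).

(** For normed spaces this is convertible to [simple_fun]; an arbitrary codomain
    also covers pairs of simple functions and truth values. *)
Definition finitary (V : Type) (s : T -> V) : Prop :=
  finite_set (range s) /\ forall v, measurable (s @^-1` [set v]).

Lemma finitary_preimage (V : choiceType) (s : T -> V) (A : set V) :
  finitary s -> measurable (s @^-1` A).
Proof.
move=> [fs ms].
have -> : s @^-1` A = \bigcup_(v in range s `&` A) s @^-1` [set v].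
  apply/seteqP; split=> [t At|t [v [_ Av] /= sv]]; last by rewrite /= sv.
  by exists (s t) => //; split => //; exists t.
by apply: fin_bigcup_measurable => //; exact: finite_setIl.
Qed.

Lemma finitary_comp (V W : choiceType) (h : V -> W) (s : T -> V) :
  finitary s -> finitary (h \o s).
Proof.
move=> fs; split.
  2: by move=> v; exact: (finitary_preimage (h @^-1` [set v]) fs).
have -> : range (h \o s) = h @` range s by rewrite image_comp.
by apply: finite_image; exact: (proj1 fs).
Qed.

Lemma finitary_pair (V W : choiceType) (s : T -> V) (s' : T -> W) :
  finitary s -> finitary s' -> finitary (fun t => (s t, s' t)).
Proof.
move=> fs fs'; split.
  apply: (@sub_finite_set _ _ (range s `*` range s')).
    by move=> _ [t _ <-]; split; exists t.
  by apply: finite_setX; [exact: (proj1 fs)|exact: (proj1 fs')].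
move=> [v w].
have -> : (fun t => (s t, s' t)) @^-1` [set (v, w)] =
    s @^-1` [set v] `&` s' @^-1` [set w].
  by apply/seteqP; split=> [t [<- <-]|t [/= <- <-]].
by apply: measurableI; exact: finitary_preimage.
Qed.

Lemma finitary_cst (V : Type) (v : V) : finitary (fun=> v).
Proof.
split; first exact: (@finite_image_cst T V v).
by move=> w; rewrite preimage_cst; case: ifP.
Qed.

Lemma finitary_indic (V : choiceType) (A : set T) (h : bool -> V) :
  measurable A -> finitary (fun t => h (t \in A)).
Proof.
move=> mA; apply: (@finitary_comp bool V h (fun t => t \in A)).
split; first exact: finite_finset.
move=> [|].
  rewrite (_ : _ @^-1` _ = A) //.
  by apply/seteqP; split=> t /=; [exact: set_mem|exact: mem_set].
rewrite (_ : _ @^-1` _ = ~` A); first exact: measurableC.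
by apply/seteqP; split=> t /=; [move=> /negbT; rewrite notin_setE|exact: memNset].
Qed.

End Finitary.

Section SimpleIntegral.
Context d (T : measurableType d) (R : realType).
Variables (mu : {measure set T -> \bar R}) (X : completeNormedModType R).

(** Any finitary labelling through which a simple function factors computes its
    integral, since the fibres with the same value add up. Two simple functions
    factor through the pair of their values, which gives additivity. *)
Lemma simple_integral_comp (V : choiceType) (g : T -> V) (h : V -> X) :
  finitary g -> (forall v, h v != 0 -> (mu (g @^-1` [set v]) < +oo)%E) ->
  simple_integral mu (h \o g) =
  \sum_(v \in range g) fine (mu (g @^-1` [set v])) *: h v.
Proof.
move=> fg hfin; have fhg := finitary_comp h fg.
have [rg _] := fg; have [rhg _] := fhg.
rewrite /simple_integral !fsbig_finite//.
have rq v : v \in fset_set (range g) -> h v \in fset_set (range (h \o g)).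
  by rewrite !in_fset_set// !inE => -[t _ <-]; exists t.
rewrite [RHS](_ : _ = \sum_(v <- fset_set (range g)) \sum_(x <- fset_set (range (h \o g)) | x == h v)
    fine (mu (g @^-1` [set v])) *: h v); last first.
  rewrite big_seq [RHS]big_seq; apply: eq_bigr => v vg.
  rewrite -big_filter filter_pred1_uniq ?rq ?fset_uniq//.
  by rewrite big_seq1.
rewrite (exchange_big_dep xpredT)//=; apply: eq_bigr => x _.
have [->|x0] := eqVneq x 0.
  by rewrite scaler0 big1// => v /eqP <-; rewrite scaler0.
rewrite [RHS](_ : _ = \sum_(v <- fset_set (range g) | x == h v)
   fine (mu (g @^-1` [set v])) *: x); last by apply: eq_bigr => v /eqP <-.
rewrite -scaler_suml; congr (_ *: _).
rewrite sum_fine; last first.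
  move=> v /eqP xv; rewrite ge0_fin_numE//; apply: hfin; by rewrite -xv.
congr fine; rewrite big_fset_condE/=.
rewrite -measure_fbigsetU; last 2 first.
- by move=> v _; exact: finitary_preimage.
- by move=> v w _ _ [t [/= <- <-]].
congr (mu _); rewrite -bigcup_fset; apply/seteqP; split=> t /=.
  move=> <-; exists (g t) => //=; rewrite !inE/= eqxx andbT.
  by rewrite in_fset_set; [rewrite inE; exists t|case: fg].
by move=> [v]; rewrite /= !inE/= => /andP[_ /eqP ->] <-.
Qed.

Definition isint (s : T -> X) (y : X) : Prop :=
  integrable_simple mu s /\ simple_integral mu s = y.

Lemma isintD s s' y y' : isint s y -> isint s' y' ->
  isint (fun t => s t + s' t) (y + y').
Proof.
move=> [[fs is1] <-] [[fs' is2] <-].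
have fp := finitary_pair fs fs'.
set g := fun t => (s t, s' t) in fp *.
have gle1 v : (mu (g @^-1` [set v]) <= mu (s @^-1` [set v.1]))%E.
  apply: le_measure; rewrite ?inE; [exact: finitary_preimage fp|exact: finitary_preimage|].
  by move=> t /= <-.
have gle2 v : (mu (g @^-1` [set v]) <= mu (s' @^-1` [set v.2]))%E.
  apply: le_measure; rewrite ?inE; [exact: finitary_preimage fp|exact: finitary_preimage|].
  by move=> t /= <-.
have fin1 v : v.1 != 0 -> (mu (g @^-1` [set v]) < +oo)%E.
  by move=> ?; apply: le_lt_trans (gle1 v) _; exact: is1.
have fin2 v : v.2 != 0 -> (mu (g @^-1` [set v]) < +oo)%E.
  by move=> ?; apply: le_lt_trans (gle2 v) _; exact: is2.
have finD v : v.1 + v.2 != 0 -> (mu (g @^-1` [set v]) < +oo)%E.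
  have [v0|v0 _] := eqVneq v.1 0; last exact: fin1.
  by rewrite v0 add0r => ?; exact: fin2.
have E1 := simple_integral_comp fp fin1.
have E2 := simple_integral_comp fp fin2.
have E3 := simple_integral_comp fp finD.
have fsum := finitary_comp (fun v : X * X => v.1 + v.2) fp.
split; first split => //.
  move=> x x0.
  have -> : (fun t => s t + s' t) @^-1` [set x] =
     \bigcup_(v in range g `&` [set v | v.1 + v.2 = x]) g @^-1` [set v].
    apply/seteqP; split=> [t /= <-|t [v [_ /= <-]] <-] //.
    by exists (g t) => //; split => //; exists t.
  have fg : finite_set (range g `&` [set v | v.1 + v.2 = x]).
    by apply: finite_setIl; exact: (proj1 fp).
  rewrite measure_fin_bigcup//; last 2 first.
  - by move=> v w _ _ [t [/= <- <-]].
  - by move=> v _; exact: finitary_preimage.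
  rewrite fsbig_finite//= big_seq lte_sum_pinfty// => v.
  by rewrite in_fset_set// inE => -[_ /= vx]; apply: finD; rewrite vx.
rewrite -[LHS]/(simple_integral mu ((fun v : X * X => v.1 + v.2) \o g)) E3.
rewrite -[simple_integral mu s]/(simple_integral mu (fst \o g)) E1.
rewrite -[simple_integral mu s']/(simple_integral mu (snd \o g)) E2.
rewrite !fsbig_finite; [|exact: (proj1 fp)..].
by rewrite -big_split/=; apply: eq_bigr => v _; rewrite scalerDr.
Qed.

Lemma isintZ (a : R) s y : isint s y -> isint (fun t => a *: s t) (a *: y).
Proof.
move=> [[fs is1] <-].
have [->|a0] := eqVneq a 0.
  have E : (fun t => 0 *: s t) = (fun=> 0) by apply/funext => t; rewrite scale0r.
  rewrite E scale0r; split; first split; first exact: finitary_cst.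
  - by move=> x x0; rewrite preimage_cst ifF ?measure0//; apply/negbTE;
      rewrite notin_setE => /= /esym/eqP; exact/negP.
  - rewrite /simple_integral fsbig1// => x [t _ <-]; exact: scaler0.
have fa : finitary (fun t => a *: s t) := finitary_comp (fun x => a *: x) fs.
have ha x : a *: x != 0 -> (mu (s @^-1` [set x]) < +oo)%E.
  by rewrite scaler_eq0 negb_or => /andP[_]; exact: is1.
split; first split => //.
  move=> x x0.
  have -> : (fun t => a *: s t) @^-1` [set x] = s @^-1` [set a^-1 *: x].
    apply/seteqP; split=> t /=; first by move=> <-; rewrite scalerA mulVf// scale1r.
    by move=> ->; rewrite scalerA mulfV// scale1r.
  by apply: is1; rewrite scaler_eq0 negb_or x0 invr_eq0 a0.
rewrite -[LHS]/(simple_integral mu ((fun x => a *: x) \o s)).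
rewrite (simple_integral_comp fs ha) /simple_integral !fsbig_finite; [|exact: (proj1 fs)..].
by rewrite scaler_sumr; apply: eq_bigr => x _; rewrite !scalerA mulrC.
Qed.

Lemma isint0 : isint (fun=> 0) 0.
Proof.
split; first split; first exact: finitary_cst.
- by move=> x x0; rewrite preimage_cst ifF ?measure0//; apply/negbTE;
    rewrite notin_setE => /= /esym/eqP; exact/negP.
- rewrite /simple_integral fsbig1// => x [t _ <-]; exact: scaler0.
Qed.

Lemma isint_sum (I : Type) (r : seq I) (f : I -> T -> X) (y : I -> X) :
  (forall i, isint (f i) (y i)) ->
  isint (fun t => \sum_(i <- r) f i t) (\sum_(i <- r) y i).
Proof.
move=> fy; elim: r => [|i r IH].
  rewrite big_nil (_ : (fun t => _) = fun=> 0); first exact: isint0.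
  by apply/funext => t; rewrite big_nil.
rewrite big_cons (_ : (fun t => _) = fun t => f i t + \sum_(j <- r) f j t).
  exact: isintD.
by apply/funext => t; rewrite big_cons.
Qed.

Lemma isint_indic (A : set T) (x : X) : measurable A -> (mu A < +oo)%E ->
  isint (fun t => \1_A t *: x) (fine (mu A) *: x).
Proof.
move=> mA Afin.
have fb : finitary (fun t => t \in A) := (finitary_indic id mA).
have pT : (fun t => t \in A) @^-1` [set true] = A.
  by apply/seteqP; split=> t /=; [exact: set_mem|exact: mem_set].
have hA (b : bool) : (b%:R : R) *: x != 0 ->
    (mu ((fun t => t \in A) @^-1` [set b]) < +oo)%E.
  by case: b; rewrite ?scale0r ?eqxx// pT.
have E : (fun t => \1_A t *: x) = (fun b : bool => (b%:R : R) *: x) \o (fun t => t \in A).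
  by apply/funext => t; rewrite /= indicE.
have fE : finitary (fun t => \1_A t *: x) by rewrite E; exact: finitary_comp.
split; first split => //.
  move=> y y0; apply: le_lt_trans Afin; apply: le_measure; rewrite ?inE//.
    exact: finitary_preimage.
  move=> t /=; rewrite indicE; have [|_] := boolP (t \in A); first by rewrite inE.
  by rewrite scale0r => ?; subst y; rewrite eqxx in y0.
rewrite E (simple_integral_comp fb hA).
rewrite (fsbig_fwiden [:: true; false])//=.
- by rewrite !big_cons big_nil/= pT scale0r scaler0 !addr0 scale1r.
- by move=> [|] _; rewrite /= !inE.
- move=> [|] [_ /= nb]; last by rewrite scale0r scaler0.
  suff -> : (fun t => t \in A) @^-1` [set true] = set0.
    by rewrite measure0 scale0r.
  by apply/seteqP; split=> t //= At; apply: nb; exists t.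
Qed.

Lemma isint_eq s y y' : isint s y -> y = y' -> isint s y'.
Proof. by move=> ? <-. Qed.

(** The triangle inequality over the fibres of [s]; it makes the Bochner
    integral single valued. *)
Lemma norm_isint s y : isint s y ->
  (`|y|%:E <= \int[mu]_t (`|s t|)%:E)%E.
Proof.
move=> [[fs is1] <-].
have Es t : (`|s t|)%:E =
    (\sum_(x \in range s) (`|x| * \1_(s @^-1` [set x]) t)%:E)%E.
  rewrite (fsbigD1 (s t)) /=; [|exact: (proj1 fs)|by exists t].
  rewrite indicE mem_set// mulr1 fsbig1 ?adde0// => x [_ /= xs].
  by rewrite indicE memNset ?mulr0//= => E; apply: xs.
under eq_integral => t _ do rewrite Es.
rewrite (@ge0_integral_fsum _ _ _ _ _ measurableT _
  (fun x t => (`|x| * \1_(s @^-1` [set x]) t)%:E) _ _ _ (proj1 fs)); last 2 first.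
- by move=> x; apply/measurable_EFinP; apply: measurable_funM => //;
     apply: measurable_indic; exact: finitary_preimage.
- by move=> x t _; rewrite lee_fin mulr_ge0.
rewrite /simple_integral !fsbig_finite; [|exact: (proj1 fs)..].
apply: (@le_trans _ _ (\sum_(x <- fset_set (range s))
    (fine (mu (s @^-1` [set x])) * `|x|)%:E)%E).
  rewrite sumEFin lee_fin; apply: le_trans (ler_norm_sum _ _ _) _.
  by apply: ler_sum => x _; rewrite normrZ ger0_norm// fine_ge0.
apply: lee_sum => x _.
under eq_integral => t _ do rewrite EFinM.
rewrite ge0_integralZl//; last first.
  by apply/measurable_EFinP/measurable_indic; exact: finitary_preimage.
rewrite integral_indic//; last exact: finitary_preimage.
rewrite setIT EFinM muleC.
have [->|x0] := eqVneq x 0; first by rewrite normr0 !mul0e.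
by rewrite fineK// ge0_fin_numE// is1.
Qed.

End SimpleIntegral.

Section StrongMeasurability.
Context d (T : measurableType d) (R : realType).
Variables (mu : {measure set T -> \bar R}) (X : completeNormedModType R).
Implicit Types f g : T -> X.

Lemma simple_strong s : @simple_fun d T R X s -> strongly_measurable s.
Proof. by move=> fs; exists (fun=> s); split => // t; exact: cvg_cst. Qed.

Lemma strongD f g : strongly_measurable f -> strongly_measurable g ->
  strongly_measurable (fun t => f t + g t).
Proof.
move=> [s [fs sf]] [s' [fs' sg]]; exists (fun n t => s n t + s' n t); split.
  by move=> n; exact: (finitary_comp (fun v : X * X => v.1 + v.2)
    (finitary_pair (fs n) (fs' n))).
by move=> t; apply: cvgD; [exact: sf|exact: sg].
Qed.

Lemma strongZ (a : R) f : strongly_measurable f ->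
  strongly_measurable (fun t => a *: f t).
Proof.
move=> [s [fs sf]]; exists (fun n t => a *: s n t); split.
  by move=> n; exact: (finitary_comp (fun v : X => a *: v) (fs n)).
by move=> t; apply: cvgZr; exact: sf.
Qed.

Lemma strongB f g : strongly_measurable f -> strongly_measurable g ->
  strongly_measurable (fun t => f t - g t).
Proof.
move=> mf mg; rewrite (_ : (fun t => _) = fun t => f t + (-1) *: g t).
  by apply: strongD => //; exact: strongZ.
by apply/funext => t; rewrite scaleN1r.
Qed.

Lemma measurable_finitary (s : T -> R) : finitary s -> measurable_fun setT s.
Proof. by move=> fs _ Y mY; rewrite setTI; exact: finitary_preimage. Qed.

Lemma strong_measurable_norm f : strongly_measurable f ->
  measurable_fun setT (fun t => `|f t|).
Proof.
move=> [s [fs sf]]; apply: (@measurable_fun_cvg _ _ _ _ (fun n t => `|s n t|)).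
  by move=> n; apply: measurable_finitary; exact: (finitary_comp (fun v : X => `|v|) (fs n)).
by move=> t _; apply: cvg_norm; exact: sf.
Qed.

(** * The Bochner integral *)

Lemma isint_strong s y : isint mu s y -> @strongly_measurable d T R X s.
Proof. by move=> [[fs _] _]; exact: simple_strong. Qed.

Lemma bochner_isint s y : isint mu s y -> @is_bochner_integral d T R mu X s y.
Proof.
move=> [is1 <-]; split; first exact: simple_strong is1.1.
exists (fun=> s); split => //; last exact: cvg_cst.
rewrite (_ : (fun=> _) = fun=> 0%E); first exact: cvg_cst.
by apply/funext => n; under eq_integral do rewrite subrr normr0; exact: integral0.
Qed.

(** Two approximating sequences are close to each other in mean, and
    [norm_isint] passes this on to their integrals. *)
Lemma bochner_unique f y y' : is_bochner_integral mu f y ->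
  is_bochner_integral mu f y' -> y = y'.
Proof.
move=> [mf [s [is1 sf sy]]] [_ [s' [is1' sf' sy']]].
apply/eqP; rewrite -subr_eq0 -normr_eq0 -eqe; apply/eqP.
have key n : (`|simple_integral mu (s n) - simple_integral mu (s' n)|%:E <=
  \int[mu]_t (`|f t - s n t|)%:E + \int[mu]_t (`|f t - s' n t|)%:E)%E.
  have i1 : isint mu (s n) (simple_integral mu (s n)) by split.
  have i2 : isint mu (s' n) (simple_integral mu (s' n)) by split.
  have := norm_isint (isintD i1 (isintZ (-1) i2)).
  rewrite scaleN1r => /le_trans; apply.
  have m1 := strong_measurable_norm (strongB mf (isint_strong i1)).
  have m2 := strong_measurable_norm (strongB mf (isint_strong i2)).
  have m3 := strong_measurable_norm (strongD (isint_strong i1) (strongZ (-1) (isint_strong i2))).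
  rewrite -ge0_integralD//; do ?exact/measurable_EFinP.
  apply: ge0_le_integral => //.
  - exact/measurable_EFinP.
  - by apply/measurable_EFinP; exact: measurable_funD.
  - move=> t _; rewrite -EFinD lee_fin scaleN1r distrC.
    rewrite (_ : s' n t - s n t = (f t - s n t) - (f t - s' n t)); first exact: ler_normB.
    by rewrite opprB [RHS]addrC addrA subrK.
have lim0 : ((\int[mu]_t (`|f t - s n t|)%:E + \int[mu]_t (`|f t - s' n t|)%:E)%E
   @[n --> \oo] --> 0%E).
  by rewrite -[X in _ --> X]adde0; exact: cvgeD.
have limy : (`|simple_integral mu (s n) - simple_integral mu (s' n)|%:E
   @[n --> \oo] --> `|y - y'|%:E)%E.
  by apply: cvg_EFin; [exact: nearW|apply: cvg_norm; exact: cvgB].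
apply: le_anti; rewrite [X in _ && X]lee_fin normr_ge0 andbT.
apply: (lee_cvg_to limy lim0).
by apply: nearW => n; exact: key.
Qed.

Lemma bochner_integralE f y : is_bochner_integral mu f y ->
  bochner_integral mu f = y.
Proof.
move=> fy; apply: (bochner_unique _ fy).
exact: (@xgetI _ 0 [set z | is_bochner_integral mu f z] y fy).
Qed.

End StrongMeasurability.

(** * The Bochner space *)

Section LpX.
Context d (T : measurableType d) (R : realType).
Variables (mu : {measure set T -> \bar R}) (X : completeNormedModType R).
Variables (p : R).
Hypothesis p1 : 1 < p.
Implicit Types f g : T -> X.

Let p0 : 0 < p. Proof. exact: lt_trans p1. Qed.

Lemma XnormE f : Xnorm mu p f = ((\int[mu]_t (`|f t| `^ p)%:E) `^ p^-1)%E.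
Proof.
rewrite /Xnorm unlock; congr poweR; apply: eq_integral => t _.
by rewrite /= normr_id.
Qed.

Lemma Xnorm_ge0 f : (0 <= Xnorm mu p f)%E.
Proof. exact: Lnorm_ge0. Qed.

Lemma Xnorm_powR f : (Xnorm mu p f `^ p)%E = (\int[mu]_t (`|f t| `^ p)%:E)%E.
Proof.
rewrite XnormE -poweRrM mulVf ?gt_eqF// poweRe1//.
by apply: integral_ge0 => t _; rewrite lee_fin powR_ge0.
Qed.

Lemma measurable_norm_powR f : strongly_measurable f ->
  measurable_fun setT (fun t => `|f t| `^ p).
Proof.
move=> /strong_measurable_norm mf.
exact: (measurableT_comp (measurable_powR p) mf).
Qed.

Lemma Xnorm_le_ae f g : strongly_measurable f -> strongly_measurable g ->
  {ae mu, forall t, `|f t| <= `|g t|} -> (Xnorm mu p f <= Xnorm mu p g)%E.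
Proof.
move=> mf mg fg; rewrite !XnormE; apply: gt0_ler_poweR.
- by rewrite invr_ge0 ltW.
- by rewrite in_itv/= leey andbT; apply: integral_ge0 => t _; rewrite lee_fin powR_ge0.
- by rewrite in_itv/= leey andbT; apply: integral_ge0 => t _; rewrite lee_fin powR_ge0.
apply: ae_ge0_le_integral => //; do ?by move=> t _; rewrite lee_fin powR_ge0.
- by apply/measurable_EFinP; exact: measurable_norm_powR.
- by apply/measurable_EFinP; exact: measurable_norm_powR.
by apply: filterS fg => t fgt _; rewrite lee_fin ge0_ler_powR// ?nnegrE// ltW.
Qed.

Lemma XnormD f g : strongly_measurable f -> strongly_measurable g ->
  (Xnorm mu p (fun t => f t + g t)%R <= Xnorm mu p f + Xnorm mu p g)%E.
Proof.
move=> mf mg.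
have mf' := strong_measurable_norm mf; have mg' := strong_measurable_norm mg.
have := @minkowski_EFin _ _ _ mu _ _ p mf' mg' (ltW p1).
apply: le_trans.
rewrite XnormE unlock; apply: gt0_ler_poweR.
- by rewrite invr_ge0 ltW.
- by rewrite in_itv/= leey andbT; apply: integral_ge0 => t _; rewrite lee_fin powR_ge0.
- by rewrite in_itv/= leey andbT; apply: integral_ge0 => t _; rewrite lee_fin powR_ge0.
apply: ge0_le_integral => //; do ?by move=> t _; rewrite lee_fin powR_ge0.
- by apply/measurable_EFinP; apply: measurable_norm_powR; exact: strongD.
- apply/measurable_EFinP; apply: (measurableT_comp (measurable_powR p)).
  by apply: measurableT_comp => //; exact: measurable_funD.
move=> t _ /=; rewrite lee_fin ge0_ler_powR ?nnegrE ?(ltW p0)//.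
by rewrite [leRHS]ger0_norm ?addr_ge0// ler_normD.
Qed.

Lemma XnormZ (a : R) f : strongly_measurable f ->
  Xnorm mu p (fun t => a *: f t) = (`|a|%:E * Xnorm mu p f)%E.
Proof.
move=> mf; rewrite !XnormE.
under eq_integral => t _ do rewrite normrZ powRM// EFinM.
rewrite ge0_integralZl ?lee_fin ?powR_ge0//; last first.
  by apply/measurable_EFinP; exact: measurable_norm_powR.
rewrite poweRM ?lee_fin ?powR_ge0//; last first.
  by apply: integral_ge0 => t _; rewrite lee_fin powR_ge0.
by rewrite poweR_EFin -powRrM mulfV ?gt_eqF// powRr1.
Qed.

Lemma Xnorm_eq0 f : strongly_measurable f -> Xnorm mu p f = 0%E ->
  {ae mu, forall t, f t = 0}.
Proof.
move=> mf f0.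
have mf' : measurable_fun setT (fun t => (`|f t|)%:E).
  by apply/measurable_EFinP; exact: strong_measurable_norm.
have : (0 < p%:E)%E by rewrite lte_fin.
move=> /(Lnorm_eq0_eq0 mf') /(_ f0).
by apply: filterS => t /= /(_ I) [/eqP]; rewrite normr_eq0 => /eqP.
Qed.

(** The norm as a real number; only meaningful on the Bochner space. *)
Definition nrm f : R := fine (Xnorm mu p f).

Lemma nrmE f : in_LpX mu p f -> Xnorm mu p f = (nrm f)%:E.
Proof. by move=> [_ ff]; rewrite /nrm fineK// ge0_fin_numE// Xnorm_ge0. Qed.

Lemma nrm_ge0 f : 0 <= nrm f.
Proof. by rewrite /nrm fine_ge0// Xnorm_ge0. Qed.

Lemma LpXD f g : in_LpX mu p f -> in_LpX mu p g -> in_LpX mu p (fun t => f t + g t).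
Proof.
move=> [mf ff] [mg fg]; split; first exact: strongD.
by apply: le_lt_trans (XnormD mf mg) _; exact: lte_add_pinfty.
Qed.

Lemma LpXZ (a : R) f : in_LpX mu p f -> in_LpX mu p (fun t => a *: f t).
Proof.
move=> [mf ff]; split; first exact: strongZ.
by rewrite XnormZ// lte_mul_pinfty.
Qed.

Lemma LpXB f g : in_LpX mu p f -> in_LpX mu p g -> in_LpX mu p (fun t => f t - g t).
Proof.
move=> Lf Lg; rewrite (_ : (fun t => _) = fun t => f t + (-1) *: g t).
  by apply: LpXD => //; exact: LpXZ.
by apply/funext => t; rewrite scaleN1r.
Qed.

Lemma nrmD f g : in_LpX mu p f -> in_LpX mu p g ->
  nrm (fun t => f t + g t) <= nrm f + nrm g.
Proof.
move=> Lf Lg; rewrite -lee_fin EFinD -!nrmE//; last exact: LpXD.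
by apply: XnormD; [exact: Lf.1|exact: Lg.1].
Qed.

Lemma nrmZ (a : R) f : in_LpX mu p f -> nrm (fun t => a *: f t) = `|a| * nrm f.
Proof.
move=> Lf; apply: EFin_inj; rewrite EFinM -!nrmE//; last exact: LpXZ.
by apply: XnormZ; exact: Lf.1.
Qed.

Lemma nrmBC f g : in_LpX mu p f -> in_LpX mu p g ->
  nrm (fun t => f t - g t) = nrm (fun t => g t - f t).
Proof.
move=> Lf Lg; rewrite (_ : (fun t => _) = fun t => (-1) *: (g t - f t)).
  by rewrite nrmZ ?normrN1 ?mul1r//; exact: LpXB.
by apply/funext => t; rewrite scaleN1r opprB.
Qed.

Lemma nrm_trian f g h : in_LpX mu p f -> in_LpX mu p g -> in_LpX mu p h ->
  nrm (fun t => f t - h t) <= nrm (fun t => f t - g t) + nrm (fun t => g t - h t).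
Proof.
move=> Lf Lg Lh; rewrite [leLHS](_ : _ = nrm (fun t => (f t - g t) + (g t - h t))).
  by apply: nrmD; exact: LpXB.
by congr nrm; apply/funext => t; rewrite addrA subrK.
Qed.

Lemma nrm_eq0 f : in_LpX mu p f -> nrm f = 0 -> {ae mu, forall t, f t = 0}.
Proof. by move=> Lf f0; apply: Xnorm_eq0; [exact: Lf.1|rewrite nrmE// f0]. Qed.

Lemma LpX_indic (A : set T) (x : X) : measurable A -> (mu A < +oo)%E ->
  in_LpX mu p (fun t => \1_A t *: x).
Proof.
move=> mA Afin; split; first exact: isint_strong (isint_indic x mA Afin).
rewrite XnormE; apply: poweR_lty.
rewrite (_ : (fun t => _) = fun t => ((`|x| `^ p)%:E * (\1_A t)%:E)%E).
  rewrite ge0_integralZl// ?lee_fin ?powR_ge0//.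
    by rewrite integral_indic// setIT lte_mul_pinfty// lee_fin powR_ge0.
  by apply/measurable_EFinP/measurable_indic.
apply/funext => t; rewrite normrZ -EFinM; congr EFin; rewrite indicE.
by case: (t \in A); rewrite ?normr1 ?mul1r ?mulr1// normr0 mul0r mulr0 powR0 ?gt_eqF.
Qed.

Lemma nrm_indic (A : set T) (x : X) : measurable A -> (mu A < +oo)%E ->
  nrm (fun t => \1_A t *: x) = `|x| * (fine (mu A)) `^ p^-1.
Proof.
move=> mA Afin; rewrite /nrm XnormE.
rewrite (_ : (fun t => _) = fun t => ((`|x| `^ p)%:E * (\1_A t)%:E)%E).
  rewrite ge0_integralZl// ?lee_fin ?powR_ge0//; last first.
    by apply/measurable_EFinP/measurable_indic.
  rewrite integral_indic// setIT fine_poweR fineM//; last by rewrite ge0_fin_numE.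
  by rewrite /= powRM ?powR_ge0 ?fine_ge0// -powRrM mulfV ?gt_eqF// powRr1.
apply/funext => t; rewrite normrZ -EFinM; congr EFin; rewrite indicE.
by case: (t \in A); rewrite ?normr1 ?mul1r ?mulr1// normr0 mul0r mulr0 powR0 ?gt_eqF.
Qed.

Lemma LpX0 : in_LpX mu p (fun=> 0 : X).
Proof.
rewrite (_ : (fun=> _) = fun t => \1_(set0 : set T) t *: (0 : X)).
  by apply: LpX_indic => //; rewrite measure0.
by apply/funext => t; rewrite scaler0.
Qed.

Lemma nrm0 : nrm (fun=> 0 : X) = 0.
Proof.
rewrite (_ : (fun=> _) = fun t => 0 *: (0 : X)); last by apply/funext => t; rewrite scale0r.
by rewrite nrmZ ?normr0 ?mul0r//; exact: LpX0.
Qed.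

Lemma LpX_sum (I : Type) (r : seq I) (f : I -> T -> X) :
  (forall i, in_LpX mu p (f i)) -> in_LpX mu p (fun t => \sum_(i <- r) f i t).
Proof.
move=> Lf; elim: r => [|i r IH].
  by rewrite (_ : (fun t => _) = fun=> 0); [exact: LpX0|apply/funext => t; rewrite big_nil].
rewrite (_ : (fun t => _) = fun t => f i t + \sum_(j <- r) f j t); first exact: LpXD.
by apply/funext => t; rewrite big_cons.
Qed.

Lemma nrm_sum (I : Type) (r : seq I) (f : I -> T -> X) :
  (forall i, in_LpX mu p (f i)) ->
  nrm (fun t => \sum_(i <- r) f i t) <= \sum_(i <- r) nrm (f i).
Proof.
move=> Lf; elim: r => [|i r IH].
  rewrite big_nil (_ : (fun t => _) = fun=> 0) ?nrm0//.
  by apply/funext => t; rewrite big_nil.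
rewrite big_cons (_ : (fun t => _) = fun t => f i t + \sum_(j <- r) f j t).
  apply: le_trans (nrmD (Lf i) (LpX_sum r Lf)) _; exact: lerD.
by apply/funext => t; rewrite big_cons.
Qed.

End LpX.

Section Completeness.
Context d (T : measurableType d) (R : realType).
Variables (mu : {measure set T -> \bar R}) (X : completeNormedModType R).
Variables (p : R).
Hypothesis p1 : 1 < p.
Implicit Types f g : T -> X.
Local Notation nrm := (@nrm _ _ _ mu X p).
Let p0 : 0 < p. Proof. exact: lt_trans p1. Qed.

Lemma le1_powR_le (x : R) : 0 <= x <= 1 -> x `^ p <= x.
Proof.
move=> /andP[x0 x1]; have [->|xn0] := eqVneq x 0; first by rewrite powR0 ?gt_eqF.
rewrite -[leRHS]powRr1//; apply: ger_powR; last exact: ltW.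
by rewrite lt_def xn0 x0.
Qed.

Lemma cvg_powR (u : nat -> R) (a : R) : (forall n, 0 <= u n) ->
  u n @[n --> \oo] --> a -> u n `^ p @[n --> \oo] --> a `^ p.
Proof.
move=> u0 ua.
have a0 : 0 <= a by apply: (cvgr_to_ge ua); apply: nearW.
have [az|an0] := eqVneq a 0.
  rewrite az powR0 ?gt_eqF//; rewrite az in ua.
  apply: (@squeeze_cvgr _ _ _ _ (fun=> 0) u); [|exact: cvg_cst|exact: ua].
  have : \forall n \near \oo, u n <= 1 by apply: cvgr_le ua _ _; exact: ltr01.
  by apply: filterS => n un1; rewrite powR_ge0 le1_powR_le// u0.
have ap : 0 < a by rewrite lt_def an0.
rewrite [X in _ --> X]/powR (negbTE an0).
apply: (@cvg_trans _ (expR (p * ln (u n)) @[n --> \oo])); last first.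
  apply: continuous_cvg; first exact: continuous_expR.
  apply: cvgMr; apply: (@continuous_cvg _ _ _ _ _ _ (@ln R)) ua.
  exact: continuous_ln.
apply: near_eq_cvg.
have : \forall n \near \oo, 0 < u n by apply: cvgr_gt ua _ _.
by apply: filterS => n un0; rewrite /powR gt_eqF.
Qed.

(** Fatou's lemma for the [p]-th powers of the norms. *)
Lemma Xnorm_fatou (s : nat -> T -> X) f (c : R) : 0 <= c ->
  (forall n, strongly_measurable (s n)) -> strongly_measurable f ->
  (forall t, s n t @[n --> \oo] --> f t) ->
  (forall n, (Xnorm mu p (s n) <= c%:E)%E) -> (Xnorm mu p f <= c%:E)%E.
Proof.
move=> c0 ms mf sf sc.
have Ipos (g : T -> X) : (0 <= \int[mu]_t (`|g t| `^ p)%:E)%E.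
  by apply: integral_ge0 => t _; rewrite lee_fin powR_ge0.
suff Hp : (\int[mu]_t (`|f t| `^ p)%:E <= (c `^ p)%:E)%E.
  rewrite XnormE (_ : c%:E = ((c `^ p)%:E `^ p^-1)%E); last first.
    by rewrite poweR_EFin -powRrM mulfV ?gt_eqF// powRr1.
  apply: gt0_ler_poweR => //; first by rewrite invr_ge0 ltW.
    by rewrite in_itv/= leey andbT.
  by rewrite in_itv/= leey andbT lee_fin powR_ge0.
have mfn n : measurable_fun setT (fun t => (`|s n t| `^ p)%:E).
  by apply/measurable_EFinP; exact: measurable_norm_powR.
have Hf : forall (n : nat) t, setT t -> (0 <= (`|s n t| `^ p)%:E)%E.
  by move=> n t _; rewrite lee_fin powR_ge0.
have := fatou mu measurableT mfn Hf.
under [X in (X <= _)%E -> _]eq_integral => t _.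
  rewrite (_ : limn_einf _ = (`|f t| `^ p)%:E); first over.
  have H : (`|s n t| `^ p)%:E @[n --> \oo] --> (`|f t| `^ p)%:E.
    apply: cvg_EFin; first exact: nearW.
    by apply: cvg_powR => //; apply: cvg_norm; exact: sf.
  exact: (cvg_limn_einf_sup H).1.
move=> /le_trans; apply.
rewrite limn_einf_lim; apply: lime_le; first exact: is_cvg_einfs.
apply: nearW => n.
apply: (@le_trans _ _ (\int[mu]_t (`|s n t| `^ p)%:E)%E).
  by apply: ereal_inf_lbound; exists n => /=.
rewrite -Xnorm_powR// (_ : (c `^ p)%:E = (c%:E `^ p)%E); last by rewrite poweR_EFin.
apply: gt0_ler_poweR => //; first exact: ltW.
  by rewrite in_itv/= leey andbT Xnorm_ge0.
by rewrite in_itv/= leey andbT lee_fin.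
Qed.

(** The bound makes the increments at most [M^(1/p) 2^-n], so they are summable. *)
Lemma cvg_of_bounded_increments (s : nat -> X) (M : R) :
  (forall n, (2 ^+ n * `|s n.+1 - s n|) `^ p <= M) -> cvgn s.
Proof.
move=> sM.
pose N := M `^ p^-1.
have M0 : 0 <= M by apply: le_trans (sM 0%N); exact: powR_ge0.
have inc n : `|s n.+1 - s n| <= geometric N 2^-1 n.
  rewrite /geometric/= exprVn ler_pdivlMr ?exprn_gt0// mulrC.
  have x0 : 0 <= 2 ^+ n * `|s n.+1 - s n| by rewrite mulr_ge0.
  have -> : 2 ^+ n * `|s n.+1 - s n| = ((2 ^+ n * `|s n.+1 - s n|) `^ p) `^ p^-1.
    by rewrite -powRrM mulfV ?gt_eqF// powRr1.
  apply: ge0_ler_powR; [by rewrite invr_ge0 ltW| | |exact: sM].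
    by rewrite nnegrE powR_ge0.
  by rewrite nnegrE.
have : cvgn (series (telescope s)).
  apply: normed_cvg; apply: (series_le_cvg _ _ inc) => //.
  - by move=> n; rewrite /geometric/= mulr_ge0 ?powR_ge0.
  - by apply: is_cvg_geometric_series; rewrite ger0_norm ?invf_lt1// ltrDl.
rewrite telescopeK => /cvg_ex[l sl]; apply/cvg_ex; exists (l + s 0%N).
have c0 : (fun=> s 0%N) @ \oo --> s 0%N by exact: cvg_cst.
have : (fun n => s n - s 0%N + s 0%N) @ \oo --> l + s 0%N by exact: (cvgD sl c0).
by under eq_fun do rewrite subrK.
Qed.

Let q : R := 4^-1.

Lemma nrm_increments (s : nat -> T -> X) : (forall n, in_LpX mu p (s n)) ->
  (forall n, nrm (fun t => s n.+1 t - s n t) <= q ^+ n) ->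
  forall n k, nrm (fun t => s (n + k)%N t - s n t) <= 2 * q ^+ n.
Proof.
move=> Ls sq n k.
have q0 j : 0 < q ^+ j by rewrite exprn_gt0// /q invr_gt0.
suff : nrm (fun t => s (n + k)%N t - s n t) <= 2 * (q ^+ n - q ^+ (n + k)).
  by move/le_trans; apply; rewrite ler_pM2l// gerBl ltW.
elim: k => [|k IH].
  rewrite addn0 subrr mulr0 (_ : (fun t => _) = fun=> 0) ?nrm0//.
  by apply/funext => t; rewrite subrr.
rewrite addnS.
have := nrm_trian p1 (Ls (n + k).+1) (Ls (n + k)%N) (Ls n).
move=> /le_trans; apply; apply: le_trans (lerD (sq _) IH) _.
have -> : q ^+ (n + k).+1 = 4^-1 * q ^+ (n + k) by rewrite exprS.
by have := q0 (n + k)%N; lra.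
Qed.

(** Even multiplied by [2^n], the increments have norms at most [2^-n]. Hence the
    sum of their [p]-th powers is integrable, thus finite almost everywhere. *)
Lemma ae_increments (s : nat -> T -> X) : (forall n, in_LpX mu p (s n)) ->
  (forall n, nrm (fun t => s n.+1 t - s n t) <= q ^+ n) ->
  exists E : set T, [/\ measurable E, {ae mu, forall t, E t} &
    forall t, E t -> cvgn (s ^~ t)].
Proof.
move=> Ls sq.
pose g n t := (2 ^+ n *: (s n.+1 t - s n t) : X).
have Lg n : in_LpX mu p (g n) by apply: LpXZ => //; exact: LpXB.
have gint n : (\int[mu]_t (`|g n t| `^ p)%:E <= (2 / (2 ^ n.+1)%:R)%:E)%E.
  rewrite -Xnorm_powR// nrmE// poweR_EFin lee_fin.
  have gn : nrm (g n) <= 2 / (2 ^ n.+1)%:R.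
    rewrite nrmZ//; last exact: LpXB.
    rewrite ger0_norm ?exprn_ge0// natrX exprS invfM mulrA mulfV// mul1r.
    apply: le_trans (ler_wpM2l (exprn_ge0 _ _) (sq n)) _ => //.
    rewrite /q -exprMn (_ : 2 * 4^-1 = 2^-1 :> R) ?exprVn//.
    by field.
  have g1 : 2 / (2 ^ n.+1)%:R <= 1 :> R.
    by rewrite ler_pdivrMr ?mul1r ?ltr0n ?expn_gt0// natrX exprS ler_peMr// exprn_ege1// ler1n.
  apply: le_trans (gn); apply: le1_powR_le.
  by rewrite nrm_ge0 (le_trans gn).
have gpos n t : setT t -> (0 <= (`|g n t| `^ p)%:E)%E by rewrite lee_fin powR_ge0.
have mg n : measurable_fun setT (fun t => (`|g n t| `^ p)%:E).
  by apply/measurable_EFinP; apply: measurable_norm_powR; exact: (Lg n).1.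
pose h t := (\sum_(n <oo) (`|g n t| `^ p)%:E)%E.
have mh : measurable_fun setT h.
  by apply: (ge0_emeasurable_sum (P := xpredT)) => // n t; rewrite lee_fin powR_ge0.
have h0 t : (0 <= h t)%E by apply: nneseries_ge0 => n _ _; rewrite lee_fin powR_ge0.
have hint : mu.-integrable setT h.
  apply/integrableP; split => //.
  under eq_integral => t _ do rewrite gee0_abs//.
  rewrite integral_nneseries//.
  apply: le_lt_trans (ltry 2); apply: le_trans (epsilon_trick0 _ _) => //.
  apply: lee_nneseries => n _; last exact: gint.
  by move=> _; apply: integral_ge0 => t _; exact: gpos.
exists (h @^-1` [set~ +oo%E]); split.
- by rewrite -[X in measurable X]setTI; apply: mh => //; exact: measurableC.
- by apply: filterS (integrable_ae measurableT hint) => t /(_ I) hfin /= E; rewrite E in hfin.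
move=> t /= hfin.
apply: (@cvg_of_bounded_increments _ (fine (h t))) => n.
have hE : h t = (fine (h t))%:E.
  by rewrite fineK// ge0_fin_numE// lt_neqAle leey andbT; apply/eqP.
have -> : 2 ^+ n * `|s n.+1 t - s n t| = `|g n t|.
  by rewrite /g normrZ ger0_norm// exprn_ge0.
rewrite -lee_fin -hE.
apply: le_trans (nneseries_lim_ge (m := 0) n.+1 _); last by move=> k _ _; exact: gpos.
rewrite big_nat_recr//= leeDr//.
by apply: sume_ge0 => k _; exact: gpos.
Qed.

(** Completeness of the Bochner space, for sequences of simple functions: cut off
    to zero outside the set of convergence they remain simple and converge
    everywhere, so the limit is strongly measurable by definition. *)
Lemma LpX_complete (s : nat -> T -> X) : (forall n, @simple_fun _ T R X (s n)) ->
  (forall n, in_LpX mu p (s n)) ->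
  (forall n, nrm (fun t => s n.+1 t - s n t) <= q ^+ n) ->
  exists2 f, in_LpX mu p f & forall n, nrm (fun t => f t - s n t) <= 2 * q ^+ n.
Proof.
move=> fs Ls sq; have [E [mE aeE sE]] := ae_increments Ls sq.
pose s' n t := (\1_E t : R) *: s n t.
have fs' n : @simple_fun _ T R X (s' n).
  have fE := finitary_indic (id : bool -> bool) mE.
  have := finitary_comp (fun v : bool * X => (v.1%:R : R) *: v.2) (finitary_pair fE (fs n)).
  by rewrite (_ : _ \o _ = s' n)//; apply/funext => t; rewrite /s' indicE.
pose f t := limn (s' ^~ t).
have s'f t : s' n t @[n --> \oo] --> f t.
  rewrite -[X in _ --> X]/(limn (s' ^~ t)); rewrite /s' indicE.
  have [tE|tE] := boolP (t \in E).
    under eq_fun => n do rewrite scale1r.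
    by apply: sE; exact: set_mem.
  by under eq_fun => n do rewrite scale0r; exact: is_cvg_cst.
have mf : strongly_measurable f by exists s'.
have ms' n : strongly_measurable (s' n) by exact: simple_strong.
have bound n : (Xnorm mu p (fun t => f t - s' n t)%R <= (2 * q ^+ n)%:E)%E.
  apply: (@Xnorm_fatou (fun k t => s' (n + k)%N t - s' n t)).
  - by rewrite mulr_ge0// exprn_ge0// /q invr_ge0.
  - by move=> k; exact: strongB.
  - exact: strongB.
  - move=> t; apply: cvgB; last exact: cvg_cst.
    under eq_fun => k do rewrite addnC.
    by have := s'f t; rewrite -(cvg_shiftn n (s' ^~ t)).
  move=> k; apply: (@le_trans _ _ (Xnorm mu p (fun t => s (n + k)%N t - s n t)%R)).
    apply: Xnorm_le_ae => //; first exact: strongB.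
      by apply: strongB; exact: simple_strong.
    apply: aeW => t; rewrite /s' -scalerBr normrZ ler_piMl// indicE.
    by case: (t \in E); rewrite ?normr1// normr0.
  by rewrite nrmE ?lee_fin; [exact: nrm_increments|exact: LpXB].
have bound' n : (Xnorm mu p (fun t => f t - s n t)%R <= (2 * q ^+ n)%:E)%E.
  apply: le_trans (bound n); apply: Xnorm_le_ae => //.
  - by apply: strongB => //; exact: simple_strong.
  - exact: strongB.
  by apply: filterS aeE => t Et; rewrite /s' indicE mem_set// scale1r.
have Lf0 n : in_LpX mu p (fun t => f t - s n t).
  split; last by apply: le_lt_trans (bound' n) _; exact: ltry.
  by apply: strongB => //; exact: simple_strong.
exists f.
  rewrite (_ : f = fun t => (f t - s 0%N t) + s 0%N t); first exact: LpXD.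
  by apply/funext => t; rewrite subrK.
by move=> n; rewrite -lee_fin -nrmE.
Qed.

End Completeness.

Section LpDominated.
Context d (T : measurableType d) (R : realType).
Variables (mu : {measure set T -> \bar R}) (X : completeNormedModType R).
Variables (p : R).
Hypothesis p1 : 1 < p.
Local Notation nrm := (@nrm _ _ _ mu X p).
Let p0 : 0 < p. Proof. exact: lt_trans p1. Qed.

(** Dominated convergence for [|u - u_n|^p], which is at most [(3 |u|)^p]. *)
Lemma Lp_dominated (u_ : nat -> T -> X) (u : T -> X) :
  (forall n, strongly_measurable (u_ n)) -> in_LpX mu p u ->
  (forall n t, `|u_ n t| <= 2 * `|u t|) ->
  (forall t, u_ n t @[n --> \oo] --> u t) ->
  [/\ forall n, in_LpX mu p (u_ n) &
   forall e, 0 < e -> exists n, nrm (fun t => u t - u_ n t) <= e].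
Proof.
move=> mu_ Lu dom cu.
have Lu_ n : in_LpX mu p (u_ n).
  split => //; have [m2 f2] := LpXZ p1 2 Lu.
  apply: le_lt_trans f2; apply: Xnorm_le_ae => //.
  by apply: aeW => t; rewrite normrZ ger0_norm.
split => // e e0.
pose f_ n t := (`|u t - u_ n t| `^ p)%:E.
have mf_ n : measurable_fun setT (f_ n).
  by apply/measurable_EFinP; apply: measurable_norm_powR; apply: strongB => //; exact: Lu.1.
pose g t := (`|3 *: u t| `^ p)%:E.
have L3 := LpXZ p1 3 Lu.
have ig : mu.-integrable setT g.
  apply/integrableP; split.
    by apply/measurable_EFinP; apply: measurable_norm_powR; exact: L3.1.
  under eq_integral => t _ do rewrite gee0_abs ?lee_fin ?powR_ge0//.
  by rewrite -Xnorm_powR// poweR_lty// L3.2.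
have fg : {ae mu, forall t n, setT t -> (`|f_ n t| <= g t)%E}.
  apply: aeW => t n _; rewrite gee0_abs ?lee_fin ?powR_ge0//.
  apply: ge0_ler_powR; rewrite ?nnegrE// ?(ltW p0)//.
  apply: le_trans (ler_normB _ _) _; rewrite normrZ ger0_norm//.
  by have := dom n t; lra.
have f0 : {ae mu, forall t, setT t -> f_ ^~ t @ \oo --> (cst 0%E : T -> \bar R) t}.
  apply: aeW => t _ /=; apply: cvg_EFin; first exact: nearW.
  have -> : 0 = 0 `^ p :> R by rewrite powR0// gt_eqF.
  apply: cvg_powR => //=; rewrite -[X in _ --> X](@normr0 _ X) -(subrr (u t)).
  by apply: cvg_norm; apply: cvgB; [exact: cvg_cst|exact: cu].
have [_ _] := dominated_convergence measurableT mf_ (measurable_cst _) f0 ig fg.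
rewrite integral_cst// mul0e => I0.
have ep : 0 < e `^ p by rewrite powR_gt0.
have : nbhs 0%E [set x | (x < (e `^ p)%:E)%E].
  apply: open_nbhs_nbhs; split; first exact: open_ereal_lt_ereal.
  by rewrite /= lte_fin.
move=> /I0 [n _ /(_ n (leqnn n)) /= fn]; exists n.
have LB : in_LpX mu p (fun t => u t - u_ n t) by exact: LpXB.
rewrite -lee_fin -nrmE// XnormE.
rewrite (_ : e%:E = ((e `^ p)%:E `^ p^-1)%E); last first.
  by rewrite poweR_EFin -powRrM mulfV ?gt_eqF// powRr1// ltW.
apply: gt0_ler_poweR; last exact: ltW.
- by rewrite invr_ge0 ltW.
- by rewrite in_itv/= leey andbT; apply: integral_ge0 => t _; rewrite lee_fin powR_ge0.
- by rewrite in_itv/= leey andbT lee_fin powR_ge0.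
Qed.

End LpDominated.

(** * Dyadic intervals and Haar functions *)

Section DyadicBasics.
Variable R : realType.
Implicit Types I J : dyadic.
Local Notation mu := (@lebesgue_measure R).

Lemma dlen_gt0 I : 0 < dlen R I. Proof. by rewrite /dlen exprz_gt0. Qed.

Lemma dsetP I t : @dset R I t <-> Num.floor (t / dlen R I) = I.2.
Proof.
rewrite /dset/= in_itv/= /dinf -[X in _ < _ + X]mulr1 -mulrDr.
rewrite ![dlen R I * _]mulrC -ler_pdivlMr ?dlen_gt0// -ltr_pdivrMr ?dlen_gt0//.
split; last by move=> <-; rewrite floor_le_tmp/= -intrD1 floorD1_gt.
move=> tI; apply: floor_def; by rewrite intrD.
Qed.

Lemma mu_dset I : mu (@dset R I) = (dlen R I)%:E.
Proof.
rewrite /dset lebesgue_measure_itv/= lte_fin ltrDl dlen_gt0 -EFinB.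
by rewrite addrAC subrr add0r.
Qed.

Definition dleft I : dyadic := (I.1 + 1, 2 * I.2).
Definition dright I : dyadic := (I.1 + 1, 2 * I.2 + 1).

Lemma dlen_child I : dlen R (I.1 + 1, I.2) = dlen R I / 2.
Proof. by rewrite /dlen/= opprD expfzDr// exprN1. Qed.

Lemma dlenE I J : I.1 = J.1 -> dlen R I = dlen R J.
Proof. by rewrite /dlen => ->. Qed.

Lemma dinf_left I : dinf R (dleft I) = dinf R I.
Proof.
rewrite /dinf (dlenE (J := (I.1 + 1, I.2)))// dlen_child/= intrM.
by field.
Qed.

Lemma dinf_right I : dinf R (dright I) = dinf R I + dlen R I / 2.
Proof.
rewrite /dinf (dlenE (J := (I.1 + 1, I.2)))// dlen_child/= intrD intrM.
by field.
Qed.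

Lemma dlen_left I : dlen R (dleft I) = dlen R I / 2.
Proof. by rewrite (dlenE (J := (I.1 + 1, I.2)))// dlen_child. Qed.

Lemma dlen_right I : dlen R (dright I) = dlen R I / 2.
Proof. by rewrite (dlenE (J := (I.1 + 1, I.2)))// dlen_child. Qed.

Lemma haarE I t : haar I t = \1_(@dset R (dleft I)) t - \1_(@dset R (dright I)) t :> R.
Proof.
rewrite /haar /haar01 /dset dinf_left dinf_right dlen_left dlen_right.
have l0 := dlen_gt0 I.
congr (_ - _); rewrite !indicE; congr (_%:R); congr nat_of_bool.
  rewrite !mem_setE !in_itv/=; apply/idP/idP => /andP[a b]; apply/andP; split.
  - by move: a; rewrite ler_pdivlMr// mul0r subr_ge0.
  - by move: b; rewrite ltr_pdivrMr// => b; lra.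
  - by rewrite ler_pdivlMr// mul0r subr_ge0.
  - by rewrite ltr_pdivrMr//; lra.
rewrite !mem_setE !in_itv/=; apply/idP/idP => /andP[a b]; apply/andP; split.
- by move: a; rewrite ler_pdivlMr//; lra.
- by move: b; rewrite ltr_pdivrMr// => b; lra.
- by rewrite ler_pdivlMr//; lra.
- by rewrite ltr_pdivrMr//; lra.
Qed.

Lemma indic_children I t :
  \1_(@dset R I) t = \1_(@dset R (dleft I)) t + \1_(@dset R (dright I)) t :> R.
Proof.
rewrite /dset dinf_left dinf_right dlen_left dlen_right !indicE.
have l0 := dlen_gt0 I.
rewrite !mem_setE !in_itv/=.
have -> : dinf R I + dlen R I / 2 + dlen R I / 2 = dinf R I + dlen R I by field.
have [a|a] := leP (dinf R I) t; have [b|b] := ltP t (dinf R I + dlen R I);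
  have [c|c] := ltP t (dinf R I + dlen R I / 2) => //=; rewrite ?addr0 ?add0r//;
  exfalso; lra.
Qed.

End DyadicBasics.

(** * Density of the Haar polynomials *)

Section HaarPolynomials.
Variables (R : realType) (X : completeNormedModType R) (p : R).
Hypothesis p1 : 1 < p.
Local Notation mu := (@lebesgue_measure R).
Local Notation nrm := (@nrm _ _ _ (@lebesgue_measure R) X p).
Local Notation Lp := (in_LpX (@lebesgue_measure R) p).
Implicit Types (I J : dyadic) (u v : R -> X).

Lemma Rmeasurable_dset I : measurable (@dset R I).
Proof. exact: measurable_itv. Qed.

Lemma mu_dset_fin I : (mu (@dset R I) < +oo)%E.
Proof. by rewrite mu_dset ltry. Qed.

Lemma isint_haar I (x : X) : isint mu (fun t : R => haar I t *: x) 0.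
Proof.
have i1 := @isint_indic _ _ _ mu X _ x (Rmeasurable_dset (dleft I)) (mu_dset_fin _).
have i2 := @isint_indic _ _ _ mu X _ x (Rmeasurable_dset (dright I)) (mu_dset_fin _).
have := isintD i1 (isintZ (-1) i2).
rewrite (_ : (fun t => _) = fun t : R => haar I t *: x); last first.
  by apply/funext => t; rewrite scaleN1r -scalerBl haarE.
move/isint_eq; apply.
by rewrite /= !mu_dset dlen_left dlen_right scaleN1r subrr.
Qed.

Lemma Lp_haar I (x : X) : Lp (fun t : R => haar I t *: x).
Proof.
rewrite (_ : (fun t => _) = fun t : R => \1_(dset (dleft I)) t *: x - \1_(dset (dright I)) t *: x).
  by apply: LpXB => //; apply: LpX_indic => //; [exact: Rmeasurable_dset|exact: mu_dset_fin|
     exact: Rmeasurable_dset|exact: mu_dset_fin].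
by apply/funext => t; rewrite haarE scalerBl.
Qed.

(** Haar polynomials in normal form, without repeated indices. *)
Definition hpol u := exists (s : seq dyadic) (x : dyadic -> X),
  uniq s /\ u = fun t => \sum_(I <- s) haar I t *: x I.

(** Repeated indices are merged by adding their coefficients. *)
Lemma hpol_list (l : seq (dyadic * X)) :
  hpol (fun t => \sum_(a <- l) haar a.1 t *: a.2).
Proof.
exists (undup [seq a.1 | a <- l]), (fun I => \sum_(a <- l | a.1 == I) a.2).
split; first exact: undup_uniq.
apply/funext => t.
under [RHS]eq_bigr => I _ do rewrite scaler_sumr.
rewrite (exchange_big_dep xpredT)//= big_seq [RHS]big_seq; apply: eq_bigr => a al.
rewrite -big_filter.
under eq_filter => I do rewrite eq_sym.
rewrite filter_pred1_uniq ?undup_uniq ?big_seq1//.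
by rewrite mem_undup map_f.
Qed.

Lemma hpol_haar_polynomial u : haar_polynomial u <-> hpol u.
Proof.
split=> [[s [x ->]]|[s [x [_ ->]]]]; last by exists s, x.
have := hpol_list [seq (J, x J) | J <- s].
by rewrite (_ : (fun t => _) = (fun t => \sum_(I <- s) haar I t *: x I))//;
  apply/funext => t; rewrite big_map.
Qed.

Lemma hpolD u v : hpol u -> hpol v -> hpol (fun t => u t + v t).
Proof.
move=> [s [x [_ ->]]] [s' [x' [_ ->]]].
have := hpol_list ([seq (J, x J) | J <- s] ++ [seq (J, x' J) | J <- s']).
rewrite (_ : (fun t => _) = (fun t => \sum_(I <- s) haar I t *: x I +
  \sum_(I <- s') haar I t *: x' I))//.
by apply/funext => t; rewrite big_cat !big_map.
Qed.

Lemma hpolZ (a : R) u : hpol u -> hpol (fun t => a *: u t).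
Proof.
move=> [s [x [us ->]]]; exists s, (fun I => a *: x I); split => //.
apply/funext => t; rewrite scaler_sumr; apply: eq_bigr => I _.
by rewrite !scalerA mulrC.
Qed.

Lemma hpol0 : hpol (fun=> 0).
Proof. by exists [::], (fun=> 0); split => //; apply/funext => t; rewrite big_nil. Qed.

Lemma hpol_haar I (x : X) : hpol (fun t => haar I t *: x).
Proof. by exists [:: I], (fun=> x); split => //; apply/funext => t; rewrite big_seq1. Qed.

Lemma Lp_hpol u : hpol u -> Lp u.
Proof. by move=> [s [x [_ ->]]]; apply: LpX_sum => // I; exact: Lp_haar. Qed.

Definition approximable u := forall e, 0 < e -> exists2 v, hpol v & nrm (fun t => u t - v t) <= e.

Lemma approx_hpol u : hpol u -> approximable u.
Proof.
move=> hu e e0; exists u => //; rewrite (_ : (fun t => _) = fun=> 0) ?nrm0 ?ltW//.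
by apply/funext => t; rewrite subrr.
Qed.

Lemma approxD u v : Lp u -> Lp v -> approximable u -> approximable v ->
  approximable (fun t => u t + v t).
Proof.
move=> Lu Lv au av e e0; have e2 : 0 < e / 2 by rewrite divr_gt0.
have [u' hu uu] := au _ e2; have [v' hv vv] := av _ e2.
exists (fun t => u' t + v' t); first exact: hpolD.
rewrite (_ : (fun t => _) = fun t => (u t - u' t) + (v t - v' t)); last first.
  by apply/funext => t; rewrite addrACA opprD.
apply: le_trans (nrmD _ _ _) _ => //; [by apply: LpXB => //; exact: Lp_hpol..|].
lra.
Qed.

Lemma approx_lim u : Lp u ->
  (forall e, 0 < e -> exists v, [/\ Lp v, approximable v & nrm (fun t => u t - v t) <= e]) ->
  approximable u.
Proof.
move=> Lu au e e0; have e2 : 0 < e / 2 by rewrite divr_gt0.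
have [v [Lv av uv]] := au _ e2; have [w hw vw] := av _ e2.
exists w => //; apply: le_trans (nrm_trian p1 Lu Lv (Lp_hpol hw)) _; lra.
Qed.

Lemma approx_sum (I : Type) (r : seq I) (f : I -> R -> X) :
  (forall i, Lp (f i)) -> (forall i, approximable (f i)) ->
  approximable (fun t => \sum_(i <- r) f i t).
Proof.
move=> Lf af; elim: r => [|i r IH].
  rewrite (_ : (fun t => _) = fun=> 0); first exact: approx_hpol hpol0.
  by apply/funext => t; rewrite big_nil.
rewrite (_ : (fun t => _) = fun t => f i t + \sum_(j <- r) f j t).
  by apply: approxD => //; exact: LpX_sum.
by apply/funext => t; rewrite big_cons.
Qed.

Lemma dyadic_parent I : exists J, I = dleft J \/ I = dright J.
Proof.
exists (I.1 - 1, (I.2 %/ 2)%Z); rewrite /dleft /dright /= subrK.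
case: I => j k /=; have := divz_eq k 2; have := modz_ge0 k (isT : (2 != 0 :> int)).
have := ltz_pmod k (isT : (0 < 2 :> int)).
move: (k %% 2)%Z (k %/ 2)%Z => r q r2 r0 ->.
have [->|r1] : r = 0 \/ r = 1 by lia.
  by left; rewrite addr0 mulrC.
by right; rewrite r1 mulrC.
Qed.

(** The indicator of an interval is half the indicator of its parent, plus or
    minus half the Haar function of the parent. *)
Lemma indic_ancestor n I (x : X) : exists J v, [/\ hpol v,
  dlen R J = 2 ^+ n * dlen R I &
  forall t, \1_(@dset R I) t *: x = v t + (2 ^- n * \1_(@dset R J) t) *: x].
Proof.
elim: n => [|n [J [v [hv lJ IJ]]]].
  exists I, (fun=> 0); split; rewrite ?mul1r//; first exact: hpol0.
  by move=> t; rewrite add0r expr0 invr1 mul1r.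
have [K JK] := dyadic_parent J.
pose s : R := if J == dleft K then 1 else -1.
have JE t : \1_(@dset R J) t = 2^-1 * \1_(@dset R K) t + 2^-1 * (s * haar K t) :> R.
  rewrite (indic_children K) haarE /s; case: ifPn => [/eqP ->|]; first by field.
  by case: JK => ->; rewrite ?eqxx// => _; field.
have lK : dlen R K = 2 * dlen R J.
  by case: JK => ->; rewrite ?dlen_left ?dlen_right; field.
exists K, (fun t => v t + (2 ^- n * (2^-1 * s)) *: (haar K t *: x)); split.
- by apply: hpolD => //; apply: hpolZ; exact: hpol_haar.
- by rewrite lK lJ exprS mulrA.
move=> t; rewrite IJ JE -addrA; congr (_ + _).
rewrite scalerA -scalerDl exprS invfM; congr (_ *: _).
by set a := 2 ^- n; ring.
Qed.

Lemma geometric_le (a r e : R) : 0 <= r < 1 -> 0 < e -> exists n, a * r ^+ n <= e.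
Proof.
move=> /andP[r0 r1] e0.
have c : geometric a r @ \oo --> 0 by apply: cvg_geometric; rewrite ger0_norm.
have := cvgr_le 0 c e e0; move=> [n _ /(_ n (leqnn n))] /=.
by exists n.
Qed.

Lemma Lp_dset I (x : X) : Lp (fun t => \1_(@dset R I) t *: x).
Proof. by apply: LpX_indic => //; [exact: Rmeasurable_dset|exact: mu_dset_fin]. Qed.

(** Replacing an interval by half its parent costs one Haar function; after
    [n] steps the remainder has norm [2^-n (2^n |I|)^(1/p) |x|], which is small
    because [p > 1]. *)
Lemma approx_dset I (x : X) : approximable (fun t => \1_(@dset R I) t *: x).
Proof.
move=> e e0.
pose r : R := 2^-1 * 2 `^ p^-1.
have r01 : 0 <= r < 1.
  rewrite /r mulr_ge0 ?powR_ge0//= mulrC ltr_pdivrMr// mul1r.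
  have p0 : 0 < p by apply: lt_trans p1.
  rewrite -[ltRHS](@lnK R) ?posrE// /powR pnatr_eq0/= ltr_expR.
  by rewrite gtr_pMl ?ln_gt0 ?ltr1n// invf_lt1.
have [n an] := geometric_le (`|x| * dlen R I `^ p^-1) r01 e0.
have [J [v [hv lJ IJ]]] := indic_ancestor n I x.
exists v => //; apply: le_trans an.
rewrite (_ : (fun t => _) = fun t => 2 ^- n *: (\1_(@dset R J) t *: x)); last first.
  by apply/funext => t; rewrite IJ addrAC subrr add0r scalerA.
rewrite nrmZ//; last exact: Lp_dset.
rewrite nrm_indic//; [|exact: Rmeasurable_dset|exact: mu_dset_fin].
rewrite ger0_norm ?invr_ge0 ?exprn_ge0//= mu_dset/= lJ powRM ?exprn_ge0//; last first.
  by rewrite ltW ?dlen_gt0.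
have -> : (2 ^+ n) `^ p^-1 = (2 `^ p^-1) ^+ n :> R.
  by rewrite -!powR_mulrn ?powR_ge0// -!powRrM mulrC.
by rewrite /r exprMn exprVn; set a := _ `^ _; set b := _ ^+ n; set c := 2 ^- n; lra.
Qed.

End HaarPolynomials.

Section Density.
Variables (R : realType) (X : completeNormedModType R) (p : R).
Hypothesis p1 : 1 < p.
Local Notation mu := (@lebesgue_measure R).
Local Notation nrm := (@nrm _ _ _ (@lebesgue_measure R) X p).
Local Notation Lp := (in_LpX (@lebesgue_measure R) p).
Implicit Types (I J : dyadic) (u v : R -> X).
Let p0 : 0 < p. Proof. exact: lt_trans p1. Qed.

Definition dyadic_at (j : int) (t : R) : dyadic := (j, Num.floor (t / dlen R (j, 0))).

Lemma dset_at j t : dset (dyadic_at j t) t.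
Proof. by apply/dsetP. Qed.

Lemma indic_level j I t : I.1 = j -> \1_(@dset R I) t = (I == dyadic_at j t)%:R :> R.
Proof.
move=> Ij; rewrite indicE; congr (_%:R); congr nat_of_bool.
apply/idP/eqP; last by move=> ->; rewrite inE; exact: dset_at.
rewrite inE => /dsetP; rewrite (dlenE _ (J := (j, 0)))// => E.
by rewrite /dyadic_at E; case: I Ij E => ? ? /= ->.
Qed.

Lemma sum_indic_level (l : seq dyadic) j (x : X) t : uniq l ->
  (forall I, I \in l -> I.1 = j) ->
  \sum_(I <- l) \1_(@dset R I) t *: x = (dyadic_at j t \in l)%:R *: x.
Proof.
move=> ul lj; rewrite big_seq.
rewrite (eq_bigr (fun I => if I == dyadic_at j t then x else 0)); last first.
  by move=> I Il; rewrite (indic_level t (lj _ Il)); case: ifP; rewrite ?scale1r ?scale0r.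
rewrite -big_mkcondr -big_seq_cond -big_filter.
have [tl|tl] := boolP (dyadic_at j t \in l).
  by rewrite filter_pred1_uniq// big_seq1 scale1r.
rewrite big_seq_cond big1 ?scale0r// => I; rewrite mem_filter andbT => /andP[/eqP -> tl'].
by rewrite tl' in tl.
Qed.

(** Dyadic intervals of length [2^-n] inside [A]; restricting them to [-n, n[
    makes them a finite list, and every point of an open [A] is still covered
    for large [n] ([inner_grid_near]). *)
Definition inner_grid (A : set R) (n : nat) : seq dyadic :=
  [seq J <- [seq (n%:Z, i%:Z - (n * 2 ^ n)%N%:Z) | i <- iota 0 (n * 2 ^ n + n * 2 ^ n)]
   | `[< @dset R J `<=` A >]].

Lemma inner_gridP A n (k : int) : - (n * 2 ^ n)%N%:Z <= k < (n * 2 ^ n)%N%:Z ->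
  @dset R (n%:Z, k) `<=` A -> (n%:Z, k) \in inner_grid A n.
Proof.
move=> kn kA; rewrite mem_filter; apply/andP; split; first exact/asboolP.
apply/mapP; exists (absz (k + (n * 2 ^ n)%N%:Z)).
  by rewrite mem_iota; move: kn; set N := (n * 2 ^ n)%N; lia.
by congr pair; move: kn; set N := (n * 2 ^ n)%N; lia.
Qed.

Lemma mem_inner_grid A n I : I \in inner_grid A n -> I.1 = n%:Z /\ @dset R I `<=` A.
Proof. by rewrite mem_filter => /andP[/asboolP IA /mapP[i _ E]]; rewrite E in IA *. Qed.

Lemma uniq_inner_grid A n : uniq (inner_grid A n).
Proof.
apply: filter_uniq; rewrite map_inj_uniq ?iota_uniq// => i j [].
by set N := (n * 2 ^ n)%N; lia.
Qed.

Lemma inner_grid_near A t : open A -> A t ->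
  \forall n \near \oo, dyadic_at n%:Z t \in inner_grid A n.
Proof.
move=> oA At.
have /nbhs_ballP[e /= e0 eA] : nbhs t A by exact: open_nbhs_nbhs.
have c : geometric 1 (2^-1 : R) @ \oo --> 0.
  by apply: cvg_geometric; rewrite ger0_norm// invf_lt1// ltr1n.
have n1 : \forall n \near \oo, 2^-1 ^+ n < e.
  have H : \forall n \near \oo, geometric 1 (2^-1 : R) n < e := cvgr_lt 0 c e e0.
  near=> n; rewrite -[X in X < _]mul1r; near: n; exact: H.
have n2 : \forall n \near \oo, `|t| < n%:R.
  near=> n; apply: lt_le_trans (truncnS_gt _) _; rewrite ler_nat.
  by near: n; exact: nbhs_infty_ge.
near=> n.
have ln : dlen R (n%:Z, 0) = 2^-1 ^+ n by rewrite /dlen/= exprVn -exprnN.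
have l0 : 0 < 2 ^+ n :> R by rewrite exprn_gt0.
apply: inner_gridP.
  have tn : `|t| < n%:R by near: n.
  rewrite ln exprVn invrK; apply/andP; split.
    rewrite floor_ge_int rmorphN/= -pmulrn natrM natrX.
    rewrite -mulNr ler_pM2r//; move: tn; rewrite ltr_norml => /andP[? _]; exact: ltW.
  rewrite floor_lt_int -pmulrn natrM natrX ltr_pM2r//.
  by move: tn; rewrite ltr_norml => /andP[].
apply: subset_trans eA => s sI; have tI := dset_at n%:Z t.
have {}sI : dset (dyadic_at n%:Z t) s := sI.
have lI : dlen R (dyadic_at n%:Z t) = 2^-1 ^+ n by rewrite -ln; exact: dlenE.
have en : 2^-1 ^+ n < e by near: n.
move: sI tI; rewrite /dset/= !in_itv/= lI => /andP[a1 a2] /andP[a3 a4].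
by rewrite /ball/= ltr_norml; apply/andP; split; lra.
Unshelve. all: by end_near.
Qed.

(** The indicators of the inner grids converge pointwise to that of the open set
    and are dominated by it. *)
Lemma approx_open (A : set R) (x : X) : open A -> (mu A < +oo)%E ->
  approximable p (fun t => \1_A t *: x).
Proof.
move=> oA Afin; have mA : measurable A by exact: open_measurable.
have LA : Lp (fun t => \1_A t *: x) by exact: LpX_indic.
pose u_ n t := \sum_(I <- inner_grid A n) \1_(@dset R I) t *: x.
have Lu n : Lp (u_ n) by apply: LpX_sum => // I; exact: Lp_dset.
have uE n t : u_ n t = (dyadic_at n%:Z t \in inner_grid A n)%:R *: x.
  by apply: sum_indic_level; [exact: uniq_inner_grid|move=> I /mem_inner_grid[]].
have uA n t : dyadic_at n%:Z t \in inner_grid A n -> t \in A.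
  by move=> /mem_inner_grid[_ /(_ t) tA]; rewrite inE; apply: tA; exact: dset_at.
have [||_ udom] := Lp_dominated p1 (fun n => (Lu n).1) LA.
- move=> n t; rewrite uE !normrZ indicE.
  have [/uA ->|_] := boolP (dyadic_at n%:Z t \in inner_grid A n).
    by rewrite normr1 mul1r ler_peMl// ler1n.
  by rewrite normr0 mul0r mulr_ge0// mulr_ge0.
- move=> t; rewrite indicE; have [tA|tA] := boolP (t \in A).
    apply: cvg_near_cst; have := inner_grid_near oA (set_mem tA).
    by apply: filterS => n tn; rewrite uE tn.
  apply: cvg_near_cst; apply: nearW => n; rewrite uE.
  by have [/uA tA'|//] := boolP (dyadic_at n%:Z t \in inner_grid A n); rewrite tA' in tA.
apply: approx_lim => // e e0; have [n une] := udom e e0.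
exists (u_ n); split => //; apply: approx_sum => // I; [exact: Lp_dset|exact: approx_dset].
Qed.

(** Outer regularity of Lebesgue measure gives an open set [U] containing [A]
    with the norm of the indicator of the difference at most [e]. *)
Lemma approx_measurable (A : set R) (x : X) : measurable A -> (mu A < +oo)%E ->
  approximable p (fun t => \1_A t *: x).
Proof.
move=> mA Afin; have LA : Lp (fun t => \1_A t *: x) by exact: LpX_indic.
apply: approx_lim => // e e0.
pose del := (e / (`|x| + 1)) `^ p.
have ex0 : 0 < e / (`|x| + 1) by rewrite divr_gt0// ltr_wpDl.
have del0 : 0 < del by rewrite powR_gt0.
have [U [oU AU UA]] := lebesgue_regularity_outer mA Afin del0.
have mU : measurable U by exact: open_measurable.
have mUA : measurable (U `\` A) by exact: measurableD.
have UAfin : (mu (U `\` A) < +oo)%E by apply: lt_trans UA _; exact: ltry.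
have Ufin : (mu U < +oo)%E.
  rewrite (_ : U = A `|` (U `\` A)); last by rewrite setDUK.
  apply: le_lt_trans (measureU2 _ _ _) _ => //; exact: lte_add_pinfty.
have LU : Lp (fun t => \1_U t *: x) by exact: LpX_indic.
exists (fun t => \1_U t *: x); split => //; first exact: approx_open.
rewrite nrmBC// (_ : (fun t => _) = fun t => \1_(U `\` A) t *: x); last first.
  apply/funext => t; rewrite -scalerBl; congr (_ *: _); rewrite !indicE in_setD.
  have [tA|tA] := boolP (t \in A); last by rewrite andbT subr0.
  by rewrite (mem_set (AU _ (set_mem tA))) andbF subrr.
rewrite nrm_indic//.
have -> : e = (`|x| + 1) * (e / (`|x| + 1)) by rewrite mulrC divfK// gt_eqF// ltr_wpDl.
apply: ler_pM; rewrite ?powR_ge0// ?lerDl//.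
have -> : e / (`|x| + 1) = del `^ p^-1.
  by rewrite /del -powRrM mulfV ?gt_eqF// powRr1// ltW.
apply: ge0_ler_powR; rewrite ?nnegrE ?fine_ge0 ?(ltW del0) ?invr_ge0 ?(ltW p0)//.
rewrite -lee_fin fineK ?ltW// ge0_fin_numE//.
Qed.

(** The fibres of a simple function of finite norm have finite measure, except
    the fibre of zero, which does not contribute. *)
Lemma approx_simple (s : R -> X) : @simple_fun _ _ R X s -> Lp s -> approximable p s.
Proof.
move=> fs Ls; have [rs ms] := fs.
have finy y : y != 0 -> (mu (s @^-1` [set y]) < +oo)%E.
  move=> y0; have := poweR_lty p Ls.2; rewrite Xnorm_powR//.
  have yp : 0 < `|y| `^ p by rewrite powR_gt0// normr_gt0.
  apply: contraTT; rewrite -!leNgt !leye_eq => /eqP H.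
  suff : (+oo <= \int[mu]_t (`|s t| `^ p)%:E)%E by rewrite leye_eq.
  have : (\int[mu]_t ((`|y| `^ p)%:E * (\1_(s @^-1` [set y]) t)%:E) = +oo)%E.
    rewrite ge0_integralZl ?lee_fin ?powR_ge0//; last first.
      by apply/measurable_EFinP/measurable_indic; exact: ms.
    have -> : (\int[mu]_t (\1_(s @^-1` [set y]) t)%:E = +oo)%E.
      by rewrite integral_indic; [rewrite setIT; exact: H|exact: measurableT|exact: ms].
    by rewrite gt0_muley// lte_fin.
  move=> <-; apply: ge0_le_integral => //.
  - apply/measurable_EFinP; apply: measurable_funM => //; apply: measurable_indic; exact: ms.
  - by apply/measurable_EFinP; apply: measurable_norm_powR; exact: Ls.1.
  - move=> t _; rewrite -EFinM lee_fin indicE.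
    have [/set_mem/= ->|_] := boolP (t \in _); first by rewrite mulr1.
    by rewrite mulr0 powR_ge0.
pose f y t := \1_(s @^-1` [set y]) t *: y.
have -> : s = fun t => \sum_(y <- fset_set (range s)) f y t.
  apply/funext => t; rewrite (big_fsetD1 (s t))/=; last first.
    by rewrite in_fset_set// inE; exists t.
  rewrite /f indicE mem_set// scale1r big_seq big1 ?addr0// => y.
  rewrite in_fsetD1 => /andP[ys _]; rewrite indicE memNset ?scale0r// => /= E.
  by rewrite E eqxx in ys.
have f0 : f 0 = fun=> 0 by apply/funext => t; rewrite /f scaler0.
apply: approx_sum => // y; have [->|y0] := eqVneq y 0.
- by rewrite f0; exact: LpX0.
- exact: (@LpX_indic _ _ _ mu X p p1 _ y (ms y) (finy y y0)).
- by rewrite f0; apply: approx_hpol => //; exact: hpol0.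
- exact: (approx_measurable y (ms y) (finy y y0)).
Qed.

(** Cutting simple approximants [s_n] off where [|s_n| > 2 |u|] keeps them
    simple, keeps the pointwise limit, and dominates them by [2 |u|]. *)
Lemma haar_density u : Lp u -> approximable p u.
Proof.
move=> Lu; have [[s [fs su]] _] := Lu.
pose B n := [set t | `|s n t| <= 2 * `|u t|].
have mB n : measurable (B n).
  have m1 : measurable_fun setT (fun t => `|s n t|).
    by apply: strong_measurable_norm; exact: simple_strong.
  have m2 : measurable_fun setT (fun t => 2 * `|u t|).
    by apply: measurable_funM => //; apply: strong_measurable_norm; exact: Lu.1.
  have := @measurable_fun_ler _ _ _ setT _ _ m1 m2 measurableT [set true].
  by rewrite setTI; apply.
pose s' n t := (\1_(B n) t : R) *: s n t.
have fs' n : @simple_fun _ _ R X (s' n).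
  have fB := finitary_indic (id : bool -> bool) (mB n).
  have := finitary_comp (fun v : bool * X => (v.1%:R : R) *: v.2) (finitary_pair fB (fs n)).
  by rewrite (_ : _ \o _ = s' n)//; apply/funext => t; rewrite /s' indicE.
have dom n t : `|s' n t| <= 2 * `|u t|.
  rewrite /s' indicE; have [/set_mem//|_] := boolP (t \in B n); first by rewrite scale1r.
  by rewrite scale0r normr0 mulr_ge0.
have s'u t : s' n t @[n --> \oo] --> u t.
  have [u0|u0] := eqVneq (u t) 0.
    rewrite u0 (_ : (fun n => _) = fun=> 0); first exact: cvg_cst.
    apply/funext => n; apply/eqP; rewrite -normr_le0; apply: le_trans (dom n t) _.
    by rewrite u0 normr0 mulr0.
  have un : 0 < `|u t| by rewrite normr_gt0.
  apply: cvg_trans (su t); apply: near_eq_cvg.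
  have : `|s n t| @[n --> \oo] --> `|u t| by apply: cvg_norm; exact: su.
  have u2 : `|u t| < 2 * `|u t| by rewrite ltr_pMl// ltr1n.
  move=> /(cvgr_lt _) /(_ _ u2); apply: filterS => n sn.
  by rewrite /s' indicE mem_set ?scale1r//= /B/= ltW.
have [Ls' sl] := Lp_dominated p1 (fun n => simple_strong (fs' n)) Lu dom s'u.
apply: approx_lim => // e e0; have [n sn] := sl e e0.
exists (s' n); split; [exact: Ls'| |exact: sn].
exact: approx_simple (fs' n) (Ls' n).
Qed.

End Density.

(** * Orthogonality of the Haar functions *)

Section Jumps.
Variable R : realType.
Implicit Types (a b A B t : R) (I J K : dyadic).

(** An interval whose endpoints avoid the interior of [A, B[ has an indicator
    that is constant there. *)
Definition outside a A B : Prop := a <= A \/ B <= a.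

Lemma indic_const a b A B t t' : outside a A B -> outside b A B ->
  `[A, B[%classic t -> `[A, B[%classic t' ->
  \1_(`[a, b[%classic) t = \1_(`[a, b[%classic) t' :> R.
Proof.
move=> aAB bAB; rewrite /= !in_itv/= => /andP[t1 t2] /andP[t3 t4].
rewrite !indicE !mem_setE !in_itv/=; congr (_%:R); congr nat_of_bool.
by case: aAB => ?; case: bAB => ?; apply/idP/idP => /andP[? ?]; apply/andP; split; lra.
Qed.

Lemma dlen_coarse I J : I.1 <= J.1 ->
  exists d : nat, dlen R I = dlen R J * 2 ^+ d /\ J.1 = I.1 + d%:Z.
Proof.
move=> IJ; exists (absz (J.1 - I.1)); split; last by lia.
rewrite /dlen [2 ^+ _]exprnP -expfzDr//; congr (_ ^ _); lia.
Qed.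

Definition dsup I : R := dinf R I + dlen R I.

Lemma dsupE I : dsup I = dlen R I * (I.2 + 1)%:~R.
Proof. by rewrite /dsup /dinf intrD mulrDr mulr1. Qed.

Lemma grid_outside (N k : int) (l : R) : 0 < l -> outside (l * N%:~R) (l * k%:~R) (l * (k + 1)%:~R).
Proof.
move=> l0; have [Nk|kN] := leP N k; [left|right]; rewrite ler_pM2l// ler_int//.
by rewrite lezD1.
Qed.

Lemma dinf_coarse I J : I.1 <= J.1 -> exists N : int, dinf R I = dlen R J * N%:~R.
Proof.
move=> /dlen_coarse[d [E _]]; exists (2 ^+ d * I.2).
by rewrite /dinf E -mulrA intrM rmorphXn.
Qed.

Lemma dsup_coarse I J : I.1 <= J.1 -> exists N : int, dsup I = dlen R J * N%:~R.
Proof.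
move=> /dlen_coarse[d [E _]]; exists (2 ^+ d * (I.2 + 1)).
by rewrite dsupE E -mulrA intrM rmorphXn.
Qed.

Lemma dset_const I J t t' : I.1 <= J.1 -> dset J t -> dset J t' ->
  \1_(@dset R I) t = \1_(dset I) t' :> R.
Proof.
move=> IJ; have [N EN] := dinf_coarse IJ; have [M EM] := dsup_coarse IJ.
rewrite /dset -/(dsup I) -/(dsup J); apply: indic_const; rewrite (dsupE J).
  by rewrite EN; apply: grid_outside; exact: dlen_gt0.
by rewrite EM; apply: grid_outside; exact: dlen_gt0.
Qed.

Lemma haar_const I J t t' : I.1 < J.1 -> dset J t -> dset J t' ->
  haar I t = haar I t' :> R.
Proof.
by move=> IJ tJ tJ'; rewrite !haarE; congr (_ - _); apply: dset_const tJ tJ';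
  rewrite /= lezD1.
Qed.

Lemma dset_left_sub I : dset (dleft I) `<=` @dset R I.
Proof.
have l0 := dlen_gt0 R I.
move=> t; rewrite /dset/= !in_itv/= dinf_left dlen_left => /andP[? ?].
by apply/andP; split; lra.
Qed.

Lemma dset_right_sub I : dset (dright I) `<=` @dset R I.
Proof.
have l0 := dlen_gt0 R I.
move=> t; rewrite /dset/= !in_itv/= dinf_right dlen_right => /andP[? ?].
by apply/andP; split; lra.
Qed.

Lemma haar_out I t : ~ dset I t -> haar I t = 0 :> R.
Proof.
move=> tI; rewrite haarE !indicE !memNset ?subrr//.
  by move=> /dset_right_sub.
by move=> /dset_left_sub.
Qed.

Lemma dset_disjoint I J t : I.1 = J.1 -> dset I t -> @dset R J t -> I = J.
Proof.
move=> IJ /dsetP tI /dsetP tJ; case: I J IJ tI tJ => i k [j k'] /= -> <-.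
by move=> <-; rewrite (dlenE _ (J := (j, k'))).
Qed.

Lemma haar_sq I t : haar I t * haar I t = \1_(@dset R I) t :> R.
Proof.
rewrite indic_children haarE !indicE.
have [tl|tl] := boolP (t \in dset (dleft I)); have [tr|tr] := boolP (t \in dset (dright I)).
- exfalso; have := dset_disjoint _ (set_mem tl) (set_mem tr) => /(_ erefl) [] H.
  by move: H; lia.
- by rewrite subr0 mulr1 addr0.
- by rewrite sub0r add0r mulrNN mulr1.
- by rewrite subrr mulr0 addr0.
Qed.

End Jumps.

Section Pairing.
Variables (R : realType) (X : completeNormedModType R).
Local Notation mu := (@lebesgue_measure R).
Implicit Types (I J : dyadic).

Lemma isint_haar_haar I J (x : X) :
  isint mu (fun t : R => (haar I t * haar J t) *: x)
    (if I == J then dlen R I *: x else 0).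
Proof.
have z (f : R -> R) : (forall t, f t = 0) -> isint mu (fun t => f t *: x) 0.
  move=> f0; rewrite (_ : (fun t => _) = fun=> 0); first exact: isint0.
  by apply/funext => t; rewrite f0 scale0r.
(* the finer function absorbs the coarser one *)
have c (K L : dyadic) : K.1 < L.1 -> isint mu (fun t : R => (haar K t * haar L t) *: x) 0.
  move=> KL; pose t0 := dinf R L.
  have Lt0 : dset L t0 by rewrite /dset/= in_itv/= lexx ltrDl dlen_gt0.
  rewrite (_ : (fun t => _) = fun t : R => haar K t0 *: (haar L t *: x)).
    by apply: isint_eq (isintZ _ (isint_haar _ _)) _; rewrite scaler0.
  apply/funext => t; rewrite scalerA.
  have [tL|tL] := pselect (dset L t); last by rewrite (haar_out tL) !mulr0.
  by rewrite (haar_const KL tL Lt0).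
case: eqVneq => [->|IJ].
  rewrite (_ : (fun t => _) = fun t : R => \1_(dset J) t *: x); last first.
    by apply/funext => t; rewrite haar_sq.
  have := @isint_indic _ _ _ mu X _ x (Rmeasurable_dset J) (mu_dset_fin R J).
  by move/isint_eq; apply; rewrite /= mu_dset.
have [lt|gt|eq] := ltgtP I.1 J.1; first exact: c.
  by under eq_fun => t do rewrite mulrC; exact: c.
apply: z => t; have [tI|tI] := pselect (dset I t); last by rewrite haar_out// mul0r.
have [tJ|tJ] := pselect (dset J t); last by rewrite [X in _ * X]haar_out// mulr0.
by rewrite (dset_disjoint eq tI tJ) eqxx in IJ.
Qed.

Definition hp (s : seq dyadic) (x : dyadic -> X) : R -> X :=
  fun t => \sum_(I <- s) haar I t *: x I.

(** Orthogonality recovers the coefficients of a Haar polynomial. *)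
Lemma pairing_hp s x J : uniq s ->
  pairing (hp s x) J = if J \in s then dlen R J *: x J else 0.
Proof.
move=> us; rewrite /pairing; apply: bochner_integralE; apply: bochner_isint.
rewrite (_ : (fun t => _) = fun t => \sum_(I <- s) (haar J t * haar I t) *: x I); last first.
  by apply/funext => t; rewrite scaler_sumr; apply: eq_bigr => I _; rewrite scalerA.
apply: isint_eq (isint_sum s (fun I => isint_haar_haar J I (x I))) _.
rewrite -big_mkcond; under eq_bigl => I do rewrite eq_sym.
case: ifPn => Js.
  by rewrite -big_filter filter_pred1_uniq// big_seq1.
by rewrite big_seq_cond big1// => I /andP[Is /eqP IJ]; rewrite IJ in Is; rewrite Is in Js.
Qed.

Lemma hsum_hp (S : set dyadic) (f : dyadic -> R -> R) s x t : uniq s ->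
  hsum S f (hp s x) t = \sum_(I <- s) ((I \in S)%:R * f I t) *: x I.
Proof.
move=> us; rewrite /hsum fsbig_mkcond.
rewrite (fsbigE s)//=; last first.
  move=> I _ /negbTE Is; rewrite /patch; case: ifP => // _.
  by rewrite pairing_hp// Is scaler0.
rewrite (eq_bigl xpredT); last by move=> I; rewrite in_setT.
apply: eq_big_seq => I Is; rewrite /patch.
case: ifP => _; last by rewrite mul0r scale0r.
by rewrite pairing_hp// Is scalerA divfK ?mul1r// gt_eqF// dlen_gt0.
Qed.

End Pairing.

(** * Extension by continuity from the Haar polynomials *)

Section Extension.
Variables (R : realType) (X : completeNormedModType R) (p : R).
Hypothesis p1 : 1 < p.
Local Notation mu := (@lebesgue_measure R).
Local Notation nrm := (@nrm _ _ _ (@lebesgue_measure R) X p).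
Local Notation Lp := (in_LpX (@lebesgue_measure R) p).
Implicit Types (I J : dyadic) (u v : R -> X) (s : seq dyadic) (x : dyadic -> X).

Definition fsum (f : dyadic -> R -> R) s x : R -> X := fun t => \sum_(I <- s) f I t *: x I.

Lemma fsum_extend f s s' x : uniq s -> uniq s' -> {subset s <= s'} ->
  fsum f s x = fsum f s' (fun I => if I \in s then x I else 0).
Proof.
move=> us us' ss'; apply/funext => t; rewrite /fsum.
rewrite [RHS](_ : _ = \sum_(I <- s' | I \in s) f I t *: x I); last first.
  by rewrite [RHS]big_mkcond/=; apply: eq_bigr => I _; case: ifP => // _; rewrite scaler0.
rewrite -[RHS]big_filter; apply: perm_big; apply: uniq_perm => //.
  exact: filter_uniq.
by move=> I; rewrite mem_filter; have [/ss' ->|] := boolP (I \in s).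
Qed.

Lemma fsum_lin f (a : R) s x y :
  fsum f s (fun I => a *: x I + y I) = (fun t => a *: fsum f s x t + fsum f s y t).
Proof.
apply/funext => t; rewrite /fsum scaler_sumr -big_split/=; apply: eq_bigr => I _.
by rewrite scalerDr !scalerA mulrC.
Qed.

Variables (f : dyadic -> R -> R) (T : (R -> X) -> R -> X) (C : R).
Hypothesis f_simple : forall I (x : X), @simple_fun _ _ R X (fun t : R => f I t *: x).
Hypothesis f_Lp : forall I (x : X), Lp (fun t => f I t *: x).
Hypothesis Tf : forall s x, uniq s -> T (hp s x) = fsum f s x.
Hypothesis C0 : 0 <= C.
Hypothesis Tbound : forall s x, uniq s -> nrm (fsum f s x) <= C * nrm (hp s x).

Let common u v : hpol u -> hpol v -> exists s x y, [/\ uniq s, u = hp s x & v = hp s y].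
Proof.
move=> [s [x [us ->]]] [s' [y [us' ->]]].
exists (undup (s ++ s')), (fun I => if I \in s then x I else 0),
  (fun I => if I \in s' then y I else 0); split; first exact: undup_uniq.
- by apply: (@fsum_extend (@haar R)) => //; rewrite ?undup_uniq// => I Is;
    rewrite mem_undup mem_cat Is.
- by apply: (@fsum_extend (@haar R)) => //; rewrite ?undup_uniq// => I Is;
    rewrite mem_undup mem_cat Is orbT.
Qed.

Let Tlin (a : R) u v : hpol u -> hpol v ->
  T (fun t => a *: u t + v t) = (fun t => a *: T u t + T v t).
Proof.
move=> hu hv; have [s [x [y [us -> ->]]]] := common hu hv.
rewrite -(@fsum_lin (@haar R)) -/(hp s (fun I => a *: x I + y I)) !Tf//.
exact: fsum_lin.
Qed.

Let Tsub u v : hpol u -> hpol v -> T (fun t => u t - v t) = (fun t => T u t - T v t).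
Proof.
move=> hu hv; have := Tlin (-1) hv hu.
rewrite (_ : (fun t => _) = fun t => u t - v t); last first.
  by apply/funext => t; rewrite scaleN1r addrC.
by move=> ->; apply/funext => t; rewrite scaleN1r addrC.
Qed.

Let TLp u : hpol u -> Lp (T u).
Proof. by move=> [s [x [us ->]]]; rewrite Tf//; apply: LpX_sum. Qed.

Let simple_sum (I : Type) (r : seq I) (g : I -> R -> X) :
  (forall i, @simple_fun _ _ R X (g i)) -> @simple_fun _ _ R X (fun t : R => \sum_(i <- r) g i t).
Proof.
move=> sg; elim: r => [|i r IH].
  rewrite (_ : (fun t => _) = fun=> 0); first exact: finitary_cst.
  by apply/funext => t; rewrite big_nil.
rewrite (_ : (fun t => _) = fun t => g i t + \sum_(j <- r) g j t); last first.
  by apply/funext => t; rewrite big_cons.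
exact: (finitary_comp (fun v : X * X => v.1 + v.2) (finitary_pair (sg i) IH)).
Qed.

Let Tsimple u : hpol u -> @simple_fun _ _ R X (T u).
Proof. by move=> [s [x [us ->]]]; rewrite Tf//; apply: simple_sum. Qed.

Let Tbnd u : hpol u -> nrm (T u) <= C * nrm u.
Proof. by move=> [s [x [us ->]]]; rewrite Tf//; apply: Tbound. Qed.

(** [g] is the value at [u] of the extension of [T]. *)
Definition extends u g := Lp g /\ forall e, 0 < e ->
  exists v, [/\ hpol v, nrm (fun t => u t - v t) <= e & nrm (fun t => g t - T v t) <= e].

Lemma extends_hpol u : hpol u -> extends u (T u).
Proof.
move=> hu; split; first exact: TLp.
move=> e e0; exists u; split => //; rewrite (_ : (fun t => _) = fun=> 0) ?nrm0 ?ltW//;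
  by apply/funext => t; rewrite subrr.
Qed.

Lemma extends_lin (a : R) u v g h : Lp u -> Lp v -> extends u g -> extends v h ->
  extends (fun t => a *: u t + v t) (fun t => a *: g t + h t).
Proof.
move=> Lu Lv [Lg ug] [Lh vh]; split; first by apply: LpXD => //; exact: LpXZ.
move=> e e0; pose e' := e / (`|a| + 1).
have a1 : 0 < `|a| + 1 by rewrite ltr_wpDl.
have e'0 : 0 < e' by rewrite divr_gt0.
have ee' : e = (`|a| + 1) * e' by rewrite mulrC divfK// gt_eqF.
have [u' [hu uu gu]] := ug e' e'0; have [v' [hv vv hv']] := vh e' e'0.
have key (w w' z z' : R -> X) : Lp w -> Lp w' -> Lp z -> Lp z' ->
    nrm (fun t => w t - w' t) <= e' -> nrm (fun t => z t - z' t) <= e' ->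
    nrm (fun t => (a *: w t + z t) - (a *: w' t + z' t)) <= e.
  move=> Lw Lw' Lz Lz' ww zz.
  rewrite (_ : (fun t => _) = fun t => a *: (w t - w' t) + (z t - z' t)); last first.
    by apply/funext => t; rewrite scalerBr opprD addrACA.
  have LB1 := LpXB p1 Lw Lw'; have LB2 := LpXB p1 Lz Lz'.
  apply: le_trans (nrmD p1 (LpXZ p1 a LB1) LB2) _; rewrite nrmZ//.
  by rewrite ee' mulrDl mul1r; apply: lerD => //; apply: ler_wpM2l.
exists (fun t => a *: u' t + v' t); split.
- by apply: hpolD => //; exact: hpolZ.
- by apply: key => //; exact: Lp_hpol.
- by rewrite Tlin//; apply: key => //; exact: TLp.
Qed.

Lemma extends_bound u g : Lp u -> extends u g -> nrm g <= C * nrm u.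
Proof.
move=> Lu [Lg ug]; apply/ler_addgt0Pr => e e0.
pose e' := e / (C + C + 1).
have c1 : 0 < C + C + 1 by rewrite ltr_wpDl// addr_ge0.
have e'0 : 0 < e' by rewrite divr_gt0.
have ee' : e = (C + C + 1) * e' by rewrite mulrC divfK// gt_eqF.
have [v [hv uv gv]] := ug e' e'0.
have LTv := TLp hv; have Lv := Lp_hpol p1 hv.
have g1 : nrm g <= nrm (fun t => g t - T v t) + nrm (T v).
  apply: le_trans (nrmD p1 (LpXB p1 Lg LTv) LTv).
  by rewrite (_ : (fun t => _ + _) = g)//; apply/funext => t; rewrite subrK.
have v1 : nrm v <= nrm (fun t => u t - v t) + nrm u.
  rewrite (nrmBC p1 Lu Lv); apply: le_trans (nrmD p1 (LpXB p1 Lv Lu) Lu).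
  by rewrite (_ : (fun t => _ + _) = v)//; apply/funext => t; rewrite subrK.
have := ler_wpM2l C0 (le_trans v1 (lerD uv (lexx _))).
rewrite mulrDr => v2; have Cv := Tbnd hv.
have Ce : 0 <= C * e' by rewrite mulr_ge0// ltW.
by rewrite ee' !mulrDl mul1r; lra.
Qed.

Lemma extends_uniq u g h : Lp u -> extends u g -> extends u h ->
  {ae mu, forall t, g t = h t}.
Proof.
move=> Lu ug uh.
have := extends_lin (-1) Lu Lu ug uh.
rewrite (_ : (fun t => -1 *: u t + u t) = fun=> 0); last first.
  by apply/funext => t; rewrite scaleN1r addNr.
move=> e0; have := extends_bound (LpX0 _ _ p1) e0.
rewrite nrm0// mulr0 => n0.
have [L _] := e0.
have /(nrm_eq0 p1 L) : nrm (fun t => -1 *: g t + h t) = 0.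
  by apply/le_anti; rewrite n0 nrm_ge0.
apply: filterS => t /eqP; rewrite scaleN1r addrC subr_eq0 => /eqP; exact: esym.
Qed.

(** If Haar polynomials approximate [u] geometrically fast, their images under
    [T] are simple functions with geometric increments, to which [LpX_complete]
    applies. *)
Lemma extends_exists u : Lp u -> exists g, extends u g.
Proof.
move=> Lu.
pose q n : R := (4^-1) ^+ n / (2 * C + 1).
have c1 : 0 < 2 * C + 1 by rewrite ltr_wpDl// mulr_ge0.
have q0 n : 0 < q n by rewrite divr_gt0// exprn_gt0// invr_gt0.
have /choice[v hv] : forall n, exists v, hpol v /\ nrm (fun t => u t - v t) <= q n.
  by move=> n; have [v hv uv] := haar_density p1 Lu (q0 n); exists v.
have Lv n : Lp (v n) by apply: Lp_hpol => //; exact: (hv n).1.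
have [g Lg gv] : exists2 g, Lp g & forall n, nrm (fun t => g t - T (v n) t) <= 2 * 4^-1 ^+ n.
  apply: LpX_complete => // n.
  - by apply: Tsimple; exact: (hv n).1.
  - by apply: TLp; exact: (hv n).1.
  rewrite -Tsub; [|exact: (hv _).1..].
  apply: le_trans (Tbnd _) _.
    have := hpolD (hv n.+1).1 (hpolZ (-1) (hv n).1).
    by rewrite (_ : (fun t => _ + _) = fun t => v n.+1 t - v n t)//;
      apply/funext => t; rewrite scaleN1r.
  apply: le_trans (ler_wpM2l C0 (nrm_trian p1 (Lv n.+1) Lu (Lv n))) _.
  rewrite (nrmBC p1 (Lv _) Lu).
  have qq : q n.+1 <= q n.
    by rewrite ler_pM2r ?invr_gt0// exprS ler_piMl ?exprn_ge0// invf_le1// ler1n.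
  have H1 := (hv n).2; have H2 := le_trans (hv n.+1).2 qq.
  have := ler_wpM2l C0 (lerD H2 H1).
  move=> /le_trans; apply.
  have E : 4^-1 ^+ n = (2 * C + 1) * q n by rewrite mulrC divfK// gt_eqF.
  rewrite E; have := ltW (q0 n); set b := q n => b0.
  have : 0 <= C * b by rewrite mulr_ge0.
  by rewrite mulrDl mul1r mulrDr; lra.
exists g; split => // e e0.
have [n ne] : exists n, 2 * 4^-1 ^+ n <= e :> R.
  by apply: geometric_le => //; apply/andP; split; lra.
exists (v n); split; first exact: (hv n).1.
  apply: le_trans (hv n).2 _; apply: le_trans ne.
  have x0 : 0 <= 4^-1 ^+ n :> R by rewrite exprn_ge0.
  rewrite /q ler_pdivrMr//; move: x0; set b := 4^-1 ^+ n => x0.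
  have : 0 <= C * b by rewrite mulr_ge0.
  by lra.
exact: le_trans (gv n) ne.
Qed.

Lemma Lp_extension_exists : exists S, Lp_extension p T S.
Proof.
have /choice[S hS] : forall u, exists g, Lp u -> extends u g.
  move=> u; have [Lu|nLu] := pselect (Lp u); last by exists u.
  by have [g] := extends_exists Lu; exists g.
exists S; split.
- by move=> u Lu; have [] := hS u Lu.
- move=> a u v Lu Lv.
  have Luv : Lp (fun t => a *: u t + v t) by apply: LpXD => //; exact: LpXZ.
  exact: extends_uniq Luv (hS _ Luv) (extends_lin _ Lu Lv (hS _ Lu) (hS _ Lv)).
- exists C => u Lu; have [LS _] := hS u Lu.
  by rewrite (nrmE LS) (nrmE Lu) -EFinM lee_fin; apply: extends_bound => //; exact: hS.
- move=> u /hpol_haar_polynomial hu; have Lu := Lp_hpol p1 hu.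
  exact: extends_uniq Lu (hS _ Lu) (extends_hpol hu).
Qed.

End Extension.

Lemma aeS2 d (T : measurableType d) (R : realType) (mu : {measure set T -> \bar R})
    (P Q Z : T -> Prop) : (forall t, P t -> Q t -> Z t) ->
  {ae mu, forall t, P t} -> {ae mu, forall t, Q t} -> {ae mu, forall t, Z t}.
Proof. by move=> h; apply: filterS2. Qed.

Lemma Lp_extensionD (R : realType) (X : completeNormedModType R) (p : R)
    (T T' S S' : (R -> X) -> R -> X) : 1 < p ->
  Lp_extension p T S -> Lp_extension p T' S' ->
  Lp_extension p (fun u t => T u t + T' u t) (fun u t => S u t + S' u t).
Proof.
move=> p1 [S1 S2 [C1 S3] S4] [S1' S2' [C1' S3'] S4']; split.
- by move=> u Lu; apply: LpXD => //; [exact: S1|exact: S1'].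
- move=> a u v Lu Lv; apply: aeS2 (S2 a u v Lu Lv) (S2' a u v Lu Lv) => t -> ->.
  by rewrite scalerDr addrACA.
- exists (C1 + C1') => u Lu; have L1 := S1 u Lu; have L2 := S1' u Lu.
  have := S3 u Lu; have := S3' u Lu.
  rewrite (nrmE L1) (nrmE L2) (nrmE Lu) (nrmE (LpXD p1 L1 L2)) -!EFinM !lee_fin => h' h.
  by apply: le_trans (nrmD p1 L1 L2) _; rewrite mulrDl; exact: lerD.
- by move=> u hu; apply: aeS2 (S4 u hu) (S4' u hu) => t -> ->.
Qed.

(** * Martingale differences from functions carried by atoms of the past *)

Section Criterion.
Context d (T : measurableType d) (R : realType).
Variables (nu : {measure set T -> \bar R}) (X : completeNormedModType R).

Definition const_on (phi psi : T -> R) : Prop :=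
  forall t t', psi t != 0 -> psi t' != 0 -> phi t = phi t'.

(** If the past is constant on the support of each [phi i], a set determined by
    the past either contains that support or is disjoint from it. *)
Lemma mds_criterion disp (J : orderType disp) (f : J -> T -> X)
    (I : J -> Type) (r : forall j, seq (I j)) (phi : forall j, I j -> T -> R)
    (x : forall j, I j -> X) :
  (forall j t, f j t = \sum_(i <- r j) phi j i t *: x j i) ->
  (forall j i, isint nu (fun t => phi j i t *: x j i) 0) ->
  (forall j k i t t', (k < j)%O -> phi j i t != 0 -> phi j i t' != 0 -> f k t = f k t') ->
  martingale_difference nu f.
Proof.
move=> fE int0 fconst j E _; apply: bochner_isint.
rewrite (_ : (fun t => _) = fun t => \sum_(i <- r j)
   (\1_(@past _ _ _ _ _ _ f j @^-1` E) t *: (phi j i t *: x j i))); last first.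
  by apply/funext => t; rewrite fE scaler_sumr.
apply: isint_eq (isint_sum (r j) (y := fun=> 0) _) _; last by rewrite big1.
move=> i; have [[t0 t0i]|none] := pselect (exists t, phi j i t != 0); last first.
  rewrite (_ : (fun t => _) = fun=> 0); first exact: isint0.
  apply/funext => t; have [->|ti] := eqVneq (phi j i t) 0; first by rewrite scale0r scaler0.
  by exfalso; apply: none; exists t.
rewrite (_ : (fun t => _) = fun t => (\1_(@past _ _ _ _ _ _ f j @^-1` E) t0 : R) *: (phi j i t *: x j i)).
  by apply: isint_eq (isintZ _ (int0 j i)) _; rewrite scaler0.
apply/funext => t; have [->|ti] := eqVneq (phi j i t) 0; first by rewrite scale0r !scaler0.
congr (_ *: _); rewrite !indicE; congr (_%:R); congr nat_of_bool.
have pE : @past _ _ _ _ _ _ f j t = @past _ _ _ _ _ _ f j t0.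
  by apply: functional_extensionality_dep => -[k kj]; exact: fconst kj ti t0i.
by apply/idP/idP; rewrite !inE/= pE.
Qed.

End Criterion.

(** * Step functions *)

Section StepFunctions.
Variable R : realType.
Local Notation mu := (@lebesgue_measure R).
Implicit Types (a b c N : R).

(** Step functions together with their integrals [c]. Induction on this predicate
    computes the integral of [f *: x] both for Lebesgue measure and for uniform
    probabilities. *)
Inductive step : (R -> R) -> R -> Prop :=
| step_itv a b of a <= b : step (fun t => \1_(`[a, b[%classic) t) (b - a)
| step_add f g c d of step f c & step g d : step (fun t => f t + g t) (c + d)
| step_scale k f c of step f c : step (fun t => k * f t) (k * c).

Lemma step_eq f c d : step f c -> c = d -> step f d.
Proof. by move=> ? <-. Qed.

Lemma step_opp f c : step f c -> step (fun t => - f t) (- c).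
Proof.
move=> /(step_scale (-1)); rewrite mulN1r.
by rewrite (_ : (fun t => _) = fun t => - f t)//; apply/funext => t; rewrite mulN1r.
Qed.

Lemma step_sub f g c d : step f c -> step g d -> step (fun t => f t - g t) (c - d).
Proof. by move=> sf /step_opp; exact: step_add. Qed.

Section Vector.
Variable X : completeNormedModType R.

Lemma mu_itv a b : a <= b -> mu `[a, b[%classic = (b - a)%:E.
Proof.
move=> ab; rewrite lebesgue_measure_itv/= lte_fin.
by rewrite lt_neqAle ab andbT; case: eqVneq => [->|_] /=; rewrite ?subrr ?EFinB.
Qed.

Lemma isint_step f c (x : X) : step f c -> isint mu (fun t => f t *: x) (c *: x).
Proof.
elim=> [a b ab|g h c1 d1 _ ig _ ih|k g c1 _ ig].
- have mI : measurable (`[a, b[%classic : set R) by exact: measurable_itv.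
  have fI : (mu `[a, b[%classic < +oo)%E by rewrite mu_itv// ltry.
  have := @isint_indic _ _ _ mu X _ x mI fI.
  by move/isint_eq; apply; rewrite /= mu_itv.
- rewrite scalerDl (_ : (fun t => _) = fun t => g t *: x + h t *: x).
    exact: isintD.
  by apply/funext => t; rewrite scalerDl.
- rewrite -scalerA (_ : (fun t => _) = fun t => k *: (g t *: x)); first exact: isintZ.
  by apply/funext => t; rewrite scalerA.
Qed.

Lemma Lp_step (p : R) f c (x : X) : 1 < p -> step f c -> in_LpX mu p (fun t => f t *: x).
Proof.
move=> p1; elim=> [a b ab|g h c1 d1 _ ig _ ih|k g c1 _ ig].
- have mI : measurable (`[a, b[%classic : set R) by exact: measurable_itv.
  have fI : (mu `[a, b[%classic < +oo)%E by rewrite mu_itv// ltry.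
  exact: (@LpX_indic _ _ _ mu X p p1 _ x mI fI).
- rewrite (_ : (fun t => _) = fun t => g t *: x + h t *: x); first exact: LpXD.
  by apply/funext => t; rewrite scalerDl.
- rewrite (_ : (fun t => _) = fun t => k *: (g t *: x)); first exact: LpXZ.
  by apply/funext => t; rewrite scalerA.
Qed.

End Vector.

(** Uniform probability on a large interval, where a given finite set of step
    functions lives; integrals are those of Lebesgue measure, rescaled. *)
Section Uniform.
Variables (N : R) (N0 : - N < N).
Local Notation P := (uniform_prob N0).

Lemma uniform_itv a b : - N <= a -> a <= b -> b <= N ->
  P `[a, b[%classic = ((N - - N)^-1 * (b - a))%:E.
Proof.
move=> Na ab bN; rewrite EFinM -mu_itv//.
have mI : measurable (`[a, b[%classic : set R) by exact: measurable_itv.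
have <- : (\int[P]_t (\1_(`[a, b[%classic) t)%:E)%E = P `[a, b[%classic.
  by rewrite integral_indic// setIT.
rewrite integral_uniform; last 2 first.
- by apply/measurable_EFinP; exact: measurable_indic.
- by move=> t; rewrite lee_fin.
congr (_ * _)%E; rewrite integral_indic//; congr (mu _).
apply/setIidPl => t /=; rewrite !in_itv/= => /andP[at_ tb].
by rewrite (le_trans Na at_) (le_trans (ltW tb) bN).
Qed.

Variable X : completeNormedModType R.

Lemma Xnorm_uniform (p : R) (f : R -> X) : 1 < p -> strongly_measurable f ->
  (forall t, t \notin `[- N, N] -> f t = 0) ->
  Xnorm P p f = (((N - - N)^-1 `^ p^-1)%:E * Xnorm mu p f)%E.
Proof.
move=> p1 mf f0; have p0 : 0 < p by exact: lt_trans p1.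
rewrite !XnormE integral_uniform; last 2 first.
- by apply/measurable_EFinP; exact: measurable_norm_powR.
- by move=> t; rewrite lee_fin powR_ge0.
have -> : (\int[mu]_(t in `[(- N)%R, N]) (`|f t| `^ p)%:E =
           \int[mu]_t (`|f t| `^ p)%:E)%E.
  rewrite [LHS]integral_mkcond/=; apply: eq_integral => t _.
  rewrite patchE; case: ifPn => // tN; rewrite f0 ?normr0 ?powR0 ?gt_eqF//.
  by apply/negP => tI; move/negP: tN; apply; rewrite inE.
rewrite poweRM; last 2 first.
- by rewrite lee_fin invr_ge0 subr_ge0 ltW.
- by apply: integral_ge0 => t _; rewrite lee_fin powR_ge0.
by rewrite poweR_EFin.
Qed.

End Uniform.

(** All that matters of this space: finitely many step functions live on it,
    and passing to it rescales measure and norm. *)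
Lemma uniform_space (N : R) : 0 < N -> exists P : probability (measurableTypeR R) R,
  (forall a b, - N <= a -> a <= b -> b <= N ->
     P `[a, b[%classic = ((N - - N)^-1 * (b - a))%:E) /\
  (forall (X : completeNormedModType R) (p : R) (f : R -> X), 1 < p -> in_LpX mu p f ->
     (forall t, t \notin `[- N, N] -> f t = 0) ->
     Xnorm P p f = ((N - - N)^-1 `^ p^-1 * nrm mu p f)%:E).
Proof.
move=> N0; have NN : - N < N by lra.
exists (uniform_prob NN); split; first by move=> a b; exact: uniform_itv.
by move=> X p f p1 Lf f0; rewrite EFinM -(nrmE Lf); apply: Xnorm_uniform => //; exact: Lf.1.
Qed.

Lemma isint_step_uniform f c : step f c -> exists M, forall N, M <= N ->
  (forall t, t \notin `[- N, N] -> f t = 0) /\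
  forall P : probability (measurableTypeR R) R,
    (forall a b, - N <= a -> a <= b -> b <= N ->
       P `[a, b[%classic = ((N - - N)^-1 * (b - a))%:E) ->
    forall (X : completeNormedModType R) (x : X),
    isint P (fun t => f t *: x) (((N - - N)^-1 * c) *: x).
Proof.
elim=> [a b ab|g h c1 d1 _ [M1 H1] _ [M2 H2]|k g c1 _ [M1 H1]].
- exists (Num.max (- a) b) => N; rewrite ge_max => /andP[aN bN]; split.
    move=> t; rewrite in_itv/= => tN; rewrite indicE memNset//= in_itv/= => /andP[? ?].
    by move/negP: tN; apply; apply/andP; split; lra.
  move=> P HP X x.
  have mI : measurable (`[a, b[%classic : set (measurableTypeR R)) by exact: measurable_itv.
  have E : P `[a, b[%classic = ((N - - N)^-1 * (b - a))%:E by apply: HP => //; lra.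
  have fI : (P `[a, b[%classic < +oo)%E by rewrite E ltry.
  have := @isint_indic _ _ _ P X _ x mI fI.
  by move/isint_eq; apply; congr (_ *: _); exact: (congr1 fine E).
- exists (Num.max M1 M2) => N; rewrite ge_max => /andP[MN1 MN2]; split.
    by move=> t tN; rewrite (H1 _ MN1).1// (H2 _ MN2).1// addr0.
  move=> P HP X x; rewrite mulrDr scalerDl (_ : (fun t => _) = fun t => g t *: x + h t *: x).
    by apply: isintD; [exact: (H1 _ MN1).2|exact: (H2 _ MN2).2].
  by apply/funext => t; rewrite scalerDl.
- exists M1 => N MN; split; first by move=> t tN; rewrite (H1 _ MN).1// mulr0.
  move=> P HP X x; rewrite mulrCA -scalerA (_ : (fun t => _) = fun t => k *: (g t *: x)).
    by apply: isintZ; exact: (H1 _ MN).2.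
  by apply/funext => t; rewrite scalerA.
Qed.

End StepFunctions.

(** * Transforms of sums of step functions in UMD spaces *)

Section Transforms.
Variables (R : realType) (X : completeNormedModType R) (p : R).
Hypothesis p1 : 1 < p.
Hypothesis umd : UMD X.
Local Notation mu := (@lebesgue_measure R).
Local Notation nrm := (@nrm _ _ _ (@lebesgue_measure R) X p).
Local Notation Lp := (in_LpX (@lebesgue_measure R) p).

(** The definition of UMD is about probability spaces. Finitely many step
    functions vanish off some interval [-N, N], where passing to the uniform
    probability multiplies all norms by the same factor. *)
Lemma umd_signs : exists2 C : R, 0 <= C & forall (n : nat) (phi : nat -> R -> R) (x : nat -> X),
  (forall i, step (phi i) 0) ->
  (forall i, (n <= i)%N -> phi i = fun=> 0) ->
  (forall i k, (k < i < n)%N -> const_on (phi k) (phi i)) ->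
  forall eps : nat -> bool,
  nrm (fun t => \sum_(i < n) (-1) ^+ eps i *: (phi i t *: x i)) <=
  C * nrm (fun t => \sum_(i < n) phi i t *: x i).
Proof.
have [C HC] := umd p1; exists `|C|; first exact: normr_ge0.
move=> n phi x sphi phi0 cphi eps.
have /choice[M HM] := fun i => isint_step_uniform (sphi i).
pose N := 1 + \sum_(i < n) `|M i|.
have NM (i : 'I_n) : M i <= N.
  rewrite /N (bigD1 i)//= addrCA; apply: le_trans (ler_norm _) _.
  by rewrite lerDl addr_ge0// sumr_ge0.
have N0 : 0 < N by rewrite /N ltr_wpDr// sumr_ge0.
have phiN i t : t \notin `[- N, N] -> phi i t = 0.
  move=> tN; have [ni|lt] := leqP n i; first by rewrite phi0.
  exact: ((HM i N (NM (Ordinal lt))).1 t tN).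
have [P [PI PX]] := uniform_space N0.
have int0 i (y : X) : isint P (fun t => phi i t *: y) 0.
  have [ni|lt] := leqP n i.
    rewrite phi0// (_ : (fun t => _) = fun=> 0); first exact: isint0.
    by apply/funext => t; rewrite scale0r.
  have := (HM i N (NM (Ordinal lt))).2 P PI X y.
  by rewrite mulr0 scale0r.
have mphi i (y : X) : strongly_measurable (fun t : measurableTypeR R => phi i t *: y).
  exact: isint_strong (int0 i y).
have NN : 0 < N - - N by rewrite opprK addr_gt0.
have kap0 : 0 < (N - - N)^-1 `^ p^-1 by rewrite powR_gt0// invr_gt0.
have Ls i : Lp (fun t => phi i t *: x i) by exact: Lp_step (sphi i).
have LP i : in_LpX P p (fun t => phi i t *: x i).
  split => //; rewrite (PX X p _ p1 (Ls i)) ?ltry//.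
  by move=> t tN; rewrite phiN// scale0r.
have md : martingale_difference P (fun i t => phi i t *: x i).
  apply: (@mds_criterion _ _ _ P X _ _ (fun i t => phi i t *: x i) (fun=> unit)
    (fun=> [:: tt]) (fun i _ => phi i) (fun i _ => x i)).
  - by move=> j t; rewrite big_seq1.
  - by move=> j _; exact: int0.
  - move=> j k [] t t' kj jt jt'; congr (_ *: _).
    have [nj|jn] := leqP n j; first by rewrite phi0// eqxx in jt.
    by apply: cphi jt jt'; rewrite jn andbT.
have L1 : Lp (fun t => \sum_(i < n) phi i t *: x i) by exact: LpX_sum.
have L2 : Lp (fun t => \sum_(i < n) (-1) ^+ eps i *: (phi i t *: x i)).
  apply: (@LpX_sum _ _ _ mu X p p1 _ (index_enum 'I_n)
    (fun i t => (-1) ^+ eps i *: (phi i t *: x i))) => i.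
  exact: (LpXZ p1 ((-1) ^+ eps i) (Ls i)).
have := HC _ _ P (fun i t => phi i t *: x i) LP md eps n.
rewrite (PX X p _ p1 L1); last by move=> t tN; rewrite big1// => i _; rewrite phiN// scale0r.
rewrite (PX X p _ p1 L2); last first.
  by move=> t tN; rewrite big1// => i _; rewrite phiN// scale0r scaler0.
rewrite -!EFinM lee_fin mulrCA ler_pM2l// => /le_trans; apply.
by apply: ler_wpM2r; [exact: nrm_ge0|exact: ler_norm].
Qed.

End Transforms.

(** * Transforms of sums indexed by dyadic intervals *)

Section Domination.
Variables (R : realType) (X : completeNormedModType R) (p : R).
Hypothesis p1 : 1 < p.
Hypothesis umd : UMD X.
Local Notation mu := (@lebesgue_measure R).
Local Notation nrm := (@nrm _ _ _ (@lebesgue_measure R) X p).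
Local Notation Lp := (in_LpX (@lebesgue_measure R) p).
Implicit Types (I J : dyadic) (s : seq dyadic) (x : dyadic -> X).

Lemma step0 : @step R (fun=> 0) 0.
Proof.
have := step_scale 0 (step_itv (lexx (0 : R))).
rewrite mul0r (_ : (fun t => _) = fun=> 0)//.
by apply/funext => t; rewrite mul0r.
Qed.

Definition const_rel (A : Type) (F : A -> R -> R) : rel A :=
  fun a b => `[< const_on (F a) (F b) >].

(** A selection of terms is the average of the sum itself and of the sum with
    the signs of the other terms changed. *)
Lemma umd_select : exists2 C : R, 0 <= C &
  forall (A : eqType) (l : seq A) (F : A -> R -> R) (x : A -> X) (b : pred A),
  (forall a, a \in l -> step (F a) 0) -> pairwise (const_rel F) l ->
  nrm (fun t => \sum_(a <- l | b a) F a t *: x a) <=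
  C * nrm (fun t => \sum_(a <- l) F a t *: x a).
Proof.
have [C C0 HC] := umd_signs p1 umd; exists ((1 + C) / 2).
  by rewrite divr_ge0// addr_ge0.
move=> A [|a0 l'] F x b sF pl.
  rewrite (_ : (fun t => _) = fun=> 0); last by apply/funext => t; rewrite big_nil.
  by rewrite nrm0// mulr_ge0 ?nrm_ge0// divr_ge0// addr_ge0.
move: (a0 :: l') sF pl => l sF pl {l'}.
pose n := size l.
pose phi i : R -> R := if (i < n)%N then F (nth a0 l i) else fun=> 0.
pose y i := x (nth a0 l i).
have sphi i : step (phi i) 0.
  by rewrite /phi; case: ifP => lt; [apply: sF; exact: mem_nth|exact: step0].
have phi0 i : (n <= i)%N -> phi i = fun=> 0 by rewrite /phi leqNgt => /negbTE ->.
have cphi i k : (k < i < n)%N -> const_on (phi k) (phi i).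
  move=> /andP[ki lt]; rewrite /phi lt (ltn_trans ki lt).
  have /(pairwiseP a0) := pl => /(_ k i) H; apply/asboolP; apply: H => //.
  by rewrite inE (ltn_trans ki lt).
pose eps i := ~~ b (nth a0 l i).
have := HC n phi y sphi phi0 cphi eps.
have E1 : (fun t => \sum_(i < n) phi i t *: y i) = (fun t => \sum_(a <- l) F a t *: x a).
  apply/funext => t; rewrite (big_nth a0) big_mkord; apply: eq_bigr => i _.
  by rewrite /phi ltn_ord.
have E2 : (fun t => \sum_(i < n) (-1) ^+ eps i *: (phi i t *: y i)) =
    (fun t => \sum_(a <- l) (-1) ^+ (~~ b a) *: (F a t *: x a)).
  apply/funext => t; rewrite [RHS](big_nth a0) big_mkord; apply: eq_bigr => i _.
  by rewrite /phi ltn_ord.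
rewrite E1 E2 => H.
have LF a : a \in l -> Lp (fun t => F a t *: x a) by move=> /sF; exact: Lp_step.
have L1 : Lp (fun t => \sum_(a <- l) F a t *: x a).
  rewrite -E1; apply: (@LpX_sum _ _ _ mu X p p1 _ (index_enum 'I_n)
    (fun i t => phi i t *: y i)) => i; exact: Lp_step (sphi i).
have L2 : Lp (fun t => \sum_(a <- l) (-1) ^+ (~~ b a) *: (F a t *: x a)).
  rewrite -E2; apply: (@LpX_sum _ _ _ mu X p p1 _ (index_enum 'I_n)
    (fun i t => (-1) ^+ eps i *: (phi i t *: y i))) => i.
  by apply: LpXZ => //; exact: Lp_step (sphi i).
rewrite (_ : (fun t => _) = fun t => 2^-1 *: (\sum_(a <- l) F a t *: x a +
    \sum_(a <- l) (-1) ^+ (~~ b a) *: (F a t *: x a))); last first.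
  apply/funext => t; rewrite -big_split/= scaler_sumr big_mkcond; apply: eq_bigr => a _.
  case: (b a) => /=; last by rewrite expr1 scaleN1r subrr scaler0.
  rewrite expr0 scale1r; set z := F a t *: x a.
  have -> : z + z = 2 *: z by rewrite scaler_nat mulr2n.
  by rewrite scalerA mulVf ?scale1r// pnatr_eq0.
rewrite nrmZ//; last exact: LpXD.
rewrite ger0_norm ?invr_ge0//.
have := nrmD p1 L1 L2; move: H; set a := nrm _; set c := nrm _; set e := nrm _.
by move=> h1 h2; lra.
Qed.

(** Intervals of equal length are related both ways, so that conditions stated
    with this relation do not depend on how a sort by length breaks ties. *)
Definition before : rel dyadic := fun I J => (I.1 <= J.1) && (I != J).

Lemma sort_before s : uniq s -> exists2 l, perm_eq l s & pairwise before l.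
Proof.
move=> us; pose le1 : rel dyadic := fun I J => I.1 <= J.1.
exists (sort le1 s); first by rewrite perm_sort.
have := pairwise_relI le1 [rel I J | I != J] (sort le1 s) => /= E.
rewrite -[pairwise _ _]/(pairwise (fun I J => le1 I J && (I != J)) (sort le1 s)) E.
apply/andP; split.
  rewrite -sorted_pairwise; last by move=> ? ? ? ; exact: le_trans.
  by apply: sort_sorted => I J; exact: le_total.
by rewrite -uniq_pairwise sort_uniq.
Qed.

Lemma step_dset I : step (\1_(@dset R I)) (dlen R I).
Proof.
have l0 := dlen_gt0 R I; have := step_itv (a := dinf R I) (b := dinf R I + dlen R I) _.
move=> /(_ _)/step_eq; apply; first by rewrite lerDl ltW.
by rewrite addrAC subrr add0r.
Qed.

Lemma step_haar I : step (@haar R I) 0.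
Proof.
rewrite (_ : haar I = fun t => \1_(dset (dleft I)) t - \1_(dset (dright I)) t :> R).
  by apply: step_eq (step_sub (step_dset _) (step_dset _)) _; rewrite dlen_left dlen_right subrr.
by apply/funext => t; rewrite haarE.
Qed.

(** A Haar function is constant on the support of each Haar function of a
    shorter interval. *)
Lemma haar_unconditional : exists2 C : R, 0 <= C & forall s x (b : pred dyadic), uniq s ->
  nrm (fun t => \sum_(I <- s | b I) haar I t *: x I) <= C * nrm (hp s x).
Proof.
have [C C0 HC] := umd_select; exists C => // s x b us.
have [l ls pl] := sort_before us.
have -> : (fun t => \sum_(I <- s | b I) haar I t *: x I) =
    (fun t => \sum_(I <- l | b I) haar I t *: x I).
  by apply/funext => t; rewrite (perm_big _ ls).
have -> : hp s x = (fun t => \sum_(I <- l) haar I t *: x I).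
  by apply/funext => t; rewrite (perm_big _ ls).
apply: HC => [I _|]; first exact: step_haar.
apply: sub_pairwise pl => I J /andP[IJ neq]; apply/asboolP => t t' tJ tJ'.
have inJ u : haar J u != 0 -> @dset R J u.
  by move=> h; apply: contrapT => uJ; move: h; rewrite haar_out// eqxx.
have [lt|eq] : I.1 < J.1 \/ I.1 = J.1 by move: IJ; rewrite le_eqVlt => /orP[/eqP|]; [right|left].
  exact: haar_const lt (inJ _ tJ) (inJ _ tJ').
have out u : @dset R J u -> haar I u = 0 :> R.
  by move=> uJ; apply: haar_out => uI; rewrite (dset_disjoint eq uI uJ) eqxx in neq.
by rewrite !out//; exact: inJ.
Qed.

(** [dominates K v w]: on finite sums indexed by [K], coefficients can be moved
    from the functions [v] to the functions [w] at bounded cost. *)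
Definition dominates (K : set dyadic) (v w : dyadic -> R -> R) : Prop :=
  exists2 C : R, 0 <= C & forall s x, uniq s -> (forall I, I \in s -> K I) ->
    nrm (fsum w s x) <= C * nrm (fsum v s x).

Lemma fsum_eq (v w : dyadic -> R -> R) s x : (forall I, I \in s -> v I = w I) ->
  fsum v s x = fsum w s x.
Proof. by move=> vw; apply/funext => t; apply: eq_big_seq => I /vw ->. Qed.

Lemma dominates_eq K v w v' w' : (forall I, K I -> v I = v' I) -> (forall I, K I -> w I = w' I) ->
  dominates K v w -> dominates K v' w'.
Proof.
move=> vv ww [C C0 H]; exists C => // s x us sK.
rewrite -(fsum_eq (v := v) (w := v'))//; last by move=> I /sK; exact: vv.
by rewrite -(fsum_eq (v := w) (w := w'))//; [exact: H|move=> I /sK; exact: ww].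
Qed.

Lemma dominates_trans K u v w : dominates K u v -> dominates K v w -> dominates K u w.
Proof.
move=> [C C0 H] [D D0 H']; exists (D * C); first exact: mulr_ge0.
move=> s x us sK; apply: le_trans (H' s x us sK) _.
by rewrite -mulrA; apply: ler_wpM2l => //; exact: H.
Qed.

Lemma dominates_comb K u v w (a b : R) :
  (forall I, K I -> exists c, step (v I) c) -> (forall I, K I -> exists c, step (w I) c) ->
  dominates K u v -> dominates K u w ->
  dominates K u (fun I t => a * v I t + b * w I t).
Proof.
move=> sv sw [C C0 H] [D D0 H']; exists (`|a| * C + `|b| * D).
  by rewrite addr_ge0// mulr_ge0.
move=> s x us sK.
have Lf (f : dyadic -> R -> R) : (forall I, K I -> exists c, step (f I) c) -> Lp (fsum f s x).
  move=> sf; rewrite /fsum (_ : (fun t => _) =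
     fun t => \sum_(I <- s) (if I \in s then f I t *: x I else 0)); last first.
    by apply/funext => t; apply: eq_big_seq => I ->.
  apply: (@LpX_sum _ _ _ mu X p p1 _ s
    (fun I t => if I \in s then f I t *: x I else 0)) => I.
  case: (boolP (I \in s)) => Is; last exact: LpX0.
  by have [c sc] := sf I (sK I Is); exact: Lp_step sc.
rewrite (_ : fsum _ s x = fun t => a *: fsum v s x t + b *: fsum w s x t); last first.
  apply/funext => t; rewrite /fsum !scaler_sumr -big_split/=; apply: eq_bigr => I _.
  by rewrite scalerDl !scalerA.
apply: le_trans (nrmD p1 (LpXZ p1 a (Lf _ sv)) (LpXZ p1 b (Lf _ sw))) _.
rewrite !nrmZ//; [|exact: Lf..].
rewrite mulrDl -!mulrA; apply: lerD; apply: ler_wpM2l => //.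
  exact: H.
exact: H'.
Qed.

(** One martingale step: when [phi J] is revealed just before [psi J], the sum
    of the [phi J] is a transform of the sum of the [phi J + psi J]. *)
Lemma dominates_step (K : set dyadic) (phi psi : dyadic -> R -> R) :
  (forall J, K J -> [/\ step (phi J) 0, step (psi J) 0 & const_on (phi J) (psi J)]) ->
  (forall I J, K I -> K J -> before I J ->
     [/\ const_on (phi I) (phi J), const_on (phi I) (psi J),
         const_on (psi I) (phi J) & const_on (psi I) (psi J)]) ->
  dominates K (fun J t => phi J t + psi J t) phi.
Proof.
move=> HK HK'; have [C C0 HC] := umd_select; exists C => // s x us sK.
have [l ls pl] := sort_before us.
have lK I : I \in l -> K I by rewrite (perm_mem ls); exact: sK.
pose F (a : dyadic * bool) := if a.2 then phi a.1 else psi a.1.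
pose L := flatten [seq [:: (J, true); (J, false)] | J <- l].
have memL a : a \in L -> a.1 \in l.
  by move=> /flatten_mapP[J Jl]; rewrite !inE => /orP[] /eqP ->.
have pL : pairwise (const_rel F) L.
  rewrite {}/L in memL *; elim: l pl lK memL {ls} => [//|J l IH] /=.
  move=> /andP[/allP Jl pl] lK memL.
  have KJ : K J by apply: lK; exact: mem_head.
  have lK' I : I \in l -> K I by move=> Il; apply: lK; rewrite inE Il orbT.
  have memL' a : a \in flatten [seq [:: (J0, true); (J0, false)] | J0 <- l] -> a.1 \in l.
    by move=> /flatten_mapP[J' J'l]; rewrite !inE => /orP[] /eqP ->.
  have [_ _ c1] := HK J KJ.
  have tail (b : bool) : all (const_rel F (J, b))
      (flatten [seq [:: (J0, true); (J0, false)] | J0 <- l]).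
    apply/allP => -[I c] /memL' Il; apply/asboolP.
    have [? ? ? ?] := HK' J I KJ (lK' I Il) (Jl I Il).
    by clear Il; case: b; case: c.
  by rewrite !tail/= andbT; apply/andP; split; [exact/asboolP|exact: IH].
have := HC _ L F (fun a => x a.1) (fun a => a.2) _ pL.
have -> : (fun t => \sum_(a <- L | a.2) F a t *: x a.1) = fsum phi s x.
  apply/funext => t; rewrite /L big_flatten big_map /fsum -(perm_big _ ls)/=.
  by apply: eq_bigr => J _; rewrite !big_cons big_nil/= addr0.
have -> : (fun t => \sum_(a <- L) F a t *: x a.1) = fsum (fun J t => phi J t + psi J t) s x.
  apply/funext => t; rewrite /L big_flatten big_map /fsum -(perm_big _ ls)/=.
  by apply: eq_bigr => J _; rewrite !big_cons big_nil/= addr0 scalerDl.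
apply => -[J b] /memL Jl; have [? ? _] := HK J (lK J Jl).
by rewrite /F; clear Jl; case: b.
Qed.

(** Three disjoint cells attached to each interval, on whose union all earlier
    cells are constant. The projection onto functions constant off one cell is
    a martingale step, and two such projections of a mean zero function with
    two nonzero values span all mean zero functions of three values. *)
Section ThreeCells.
Variables (K : set dyadic) (c1 c2 c3 : dyadic -> R -> R) (m1 m2 m3 : R).
Variable reg : dyadic -> R -> Prop.
Hypotheses (m1_gt0 : 0 < m1) (m2_gt0 : 0 < m2) (m3_gt0 : 0 < m3).
Hypothesis cstep : forall J, K J -> [/\ step (c1 J) (m1 * dlen R J),
  step (c2 J) (m2 * dlen R J) & step (c3 J) (m3 * dlen R J)].
Hypothesis ccell : forall J t, K J ->
  [\/ [/\ c1 J t = 0, c2 J t = 0 & c3 J t = 0], [/\ c1 J t = 1, c2 J t = 0 & c3 J t = 0],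
      [/\ c1 J t = 0, c2 J t = 1 & c3 J t = 0] | [/\ c1 J t = 0, c2 J t = 0 & c3 J t = 1]].
Hypothesis creg : forall J t, K J -> ~ reg J t -> [/\ c1 J t = 0, c2 J t = 0 & c3 J t = 0].
Hypothesis cconst : forall I J t t', K I -> K J -> before I J -> reg J t -> reg J t' ->
  [/\ c1 I t = c1 I t', c2 I t = c2 I t' & c3 I t = c3 I t'].

Definition cell3 (a1 a2 a3 : R) : dyadic -> R -> R :=
  fun J t => a1 * c1 J t + a2 * c2 J t + a3 * c3 J t.

Lemma cell3_step a1 a2 a3 J : K J ->
  step (cell3 a1 a2 a3 J) ((a1 * m1 + a2 * m2 + a3 * m3) * dlen R J).
Proof.
move=> KJ; have [s1 s2 s3] := cstep KJ.
apply: step_eq (step_add (step_add (step_scale a1 s1) (step_scale a2 s2)) (step_scale a3 s3)) _.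
by ring.
Qed.

Lemma cell3_const a1 a2 a3 b1 b2 b3 I J : K I -> K J -> before I J ->
  const_on (cell3 a1 a2 a3 I) (cell3 b1 b2 b3 J).
Proof.
move=> KI KJ IJ t t' tJ tJ'.
have inreg u : cell3 b1 b2 b3 J u != 0 -> reg J u.
  move=> h; apply: contrapT => uJ; have [E1 E2 E3] := creg KJ uJ.
  by move: h; rewrite /cell3 E1 E2 E3 !mulr0 !addr0 eqxx.
have [E1 E2 E3] := cconst KI KJ IJ (inreg _ tJ) (inreg _ tJ').
by rewrite /cell3 E1 E2 E3.
Qed.

Lemma three_cells a1 a2 a3 b1 b2 b3 : a1 != 0 -> a2 != 0 ->
  a1 * m1 + a2 * m2 + a3 * m3 = 0 -> b1 * m1 + b2 * m2 + b3 * m3 = 0 ->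
  dominates K (cell3 a1 a2 a3) (cell3 b1 b2 b3).
Proof.
move=> a10 a20 a_mean b_mean.
have m23 : m2 + m3 != 0 by rewrite gt_eqF// addr_gt0.
have m13 : m1 + m3 != 0 by rewrite gt_eqF// addr_gt0.
pose r1 := m1 / (m2 + m3); pose r2 := m2 / (m1 + m3).
have r1m : r1 * (m2 + m3) = m1 by rewrite /r1 divfK.
have r2m : r2 * (m1 + m3) = m2 by rewrite /r2 divfK.
have r10 : 0 < r1 by rewrite divr_gt0// addr_gt0.
have r20 : 0 < r2 by rewrite divr_gt0// addr_gt0.
have z0 (e : R) J : e = 0 -> e * dlen R J = 0 by move=> ->; rewrite mul0r.
(* projection onto functions constant off the first, resp. second, cell *)
have P1 : dominates K (cell3 a1 a2 a3) (cell3 a1 (- (a1 * r1)) (- (a1 * r1))).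
  apply: (dominates_eq (v := fun J t => cell3 a1 (- (a1 * r1)) (- (a1 * r1)) J t +
     cell3 0 (a2 + a1 * r1) (a3 + a1 * r1) J t)
     (w := cell3 a1 (- (a1 * r1)) (- (a1 * r1)))) => //.
    by move=> J _; apply/funext => t; rewrite /cell3; ring.
  apply: dominates_step => [J KJ|I J KI KJ IJ]; last by split; exact: cell3_const.
  split.
  - apply: step_eq (cell3_step _ _ _ KJ) _; apply: z0.
    by rewrite -!addrA -mulrDr mulNr -mulrA r1m subrr.
  - apply: step_eq (cell3_step _ _ _ KJ) _; apply: z0.
    rewrite mul0r add0r !mulrDl addrACA -mulrDr -mulrA r1m.
    by rewrite addrC addrA.
  - move=> t t'; rewrite /cell3 !mul0r !add0r.
    by case: (ccell t KJ) => -[-> -> ->]; case: (ccell t' KJ) => -[-> -> ->];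
      rewrite ?mulr0 ?mulr1 ?addr0 ?add0r ?eqxx.
have P2 : dominates K (cell3 a1 a2 a3) (cell3 (- (a2 * r2)) a2 (- (a2 * r2))).
  apply: (dominates_eq (v := fun J t => cell3 (- (a2 * r2)) a2 (- (a2 * r2)) J t +
     cell3 (a1 + a2 * r2) 0 (a3 + a2 * r2) J t)
     (w := cell3 (- (a2 * r2)) a2 (- (a2 * r2)))) => //.
    by move=> J _; apply/funext => t; rewrite /cell3; ring.
  apply: dominates_step => [J KJ|I J KI KJ IJ]; last by split; exact: cell3_const.
  split.
  - apply: step_eq (cell3_step _ _ _ KJ) _; apply: z0.
    by rewrite addrAC -mulrDr mulNr -mulrA r2m addNr.
  - apply: step_eq (cell3_step _ _ _ KJ) _; apply: z0.
    rewrite mul0r addr0 !mulrDl addrACA -mulrDr -mulrA r2m.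
    by rewrite -addrA [X in _ + X]addrC addrA.
  - move=> t t'; rewrite /cell3 !mul0r !addr0.
    by case: (ccell t KJ) => -[-> -> ->]; case: (ccell t' KJ) => -[-> -> ->];
      rewrite ?mulr0 ?mulr1 ?addr0 ?add0r ?eqxx.
pose u := (b1 - b3) / (a1 * (1 + r1)); pose v := (b2 - b3) / (a2 * (1 + r2)).
have sc a a' a'' J : K J -> exists c, step (cell3 a a' a'' J) c.
  by move=> KJ; eexists; exact: cell3_step.
have := dominates_comb u v (sc _ _ _) (sc _ _ _) P1 P2.
apply: dominates_eq => // J _; apply/funext => t; rewrite /cell3.
have ur : u * a1 * (1 + r1) = b1 - b3.
  by rewrite /u -mulrA divfK// mulf_neq0// gt_eqF// ltr_wpDr// ltW.
have vr : v * a2 * (1 + r2) = b2 - b3.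
  by rewrite /v -mulrA divfK// mulf_neq0// gt_eqF// ltr_wpDr// ltW.
(* both sides have mean zero and the same differences of values *)
have E3 : - (u * a1 * r1) - v * a2 * r2 = b3.
  have M0 : m1 + m2 + m3 != 0 by rewrite gt_eqF// !addr_gt0.
  apply: (mulIf M0).
  have h1 : u * a1 * r1 * (m2 + m3) = u * a1 * m1 by rewrite -mulrA r1m.
  have h2 : v * a2 * r2 * (m1 + m3) = v * a2 * m2 by rewrite -mulrA r2m.
  have h3 : (u * a1 * (1 + r1)) * m1 = (b1 - b3) * m1 by rewrite ur.
  have h4 : (v * a2 * (1 + r2)) * m2 = (b2 - b3) * m2 by rewrite vr.
  by move: h1 h2 h3 h4; rewrite !(mulrDr, mulrDl, mulr1, mul1r, mulrBl, mulNr); lra.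
have E1 : u * a1 - v * a2 * r2 = b1 by move: ur; rewrite mulrDr mulr1; lra.
have E2 : - (u * a1 * r1) + v * a2 = b2 by move: vr; rewrite mulrDr mulr1; lra.
by rewrite -E1 -E2 -E3; ring.
Qed.

End ThreeCells.

End Domination.

(** * Intervals in relative coordinates *)

Section Intervals.
Variable R : realType.
Implicit Types (I J : dyadic) (a b c t : R) (K : set dyadic).

Definition pt J a : R := dinf R J + a * dlen R J.
(** The interval with endpoints [a], [b] in the coordinate that maps [J] to [0, 1[. *)
Definition ivl J a b t : R := \1_(`[pt J a, pt J b[%classic) t.

Lemma ler_pt J a b : (pt J a <= pt J b) = (a <= b).
Proof. by rewrite lerD2l ler_pM2r// dlen_gt0. Qed.

Lemma ltr_pt J a b : (pt J a < pt J b) = (a < b).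
Proof. by rewrite ltrD2l ltr_pM2r// dlen_gt0. Qed.

Lemma ptE J a : pt J a = dlen R J * (J.2%:~R + a).
Proof. by rewrite /pt /dinf mulrDr [a * _]mulrC. Qed.

Lemma step_ivl J a b : a <= b -> step (ivl J a b) ((b - a) * dlen R J).
Proof.
move=> ab; have := @step_itv R (pt J a) (pt J b); rewrite ler_pt => /(_ ab)/step_eq; apply.
by rewrite /pt; ring.
Qed.

Lemma ivlE J a b t : ivl J a b t = ((pt J a <= t) && (t < pt J b))%:R.
Proof. by rewrite /ivl indicE mem_setE in_itv. Qed.

Lemma ivlD J a b c t : a <= b -> b <= c -> ivl J a b t + ivl J b c t = ivl J a c t.
Proof.
rewrite -(ler_pt J a) -(ler_pt J b) !ivlE => ab bc.
have [ta|ta] := leP (pt J a) t; have [tb|tb] := leP (pt J b) t;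
  have [tc|tc] := ltP t (pt J c) => //=; rewrite ?addr0 ?add0r//; exfalso; lra.
Qed.

Lemma indic_dset_ivl J t : \1_(@dset R J) t = ivl J 0 1 t.
Proof. by rewrite /ivl /pt mul0r addr0 mul1r. Qed.

Lemma indic_tau_ivl m J t : \1_(@dset R (tau m J)) t = ivl J m%:R (m%:R + 1) t.
Proof.
have E : dinf R (tau m J) = pt J m%:R.
  by rewrite ptE /dinf /= intrD -pmulrn (dlenE R (J := J)).
rewrite /ivl /dset E (dlenE R (I := tau m J) (J := J))// /pt.
by congr (\1_(`[_, _[%classic) t); rewrite mulrDl mul1r addrA.
Qed.

Lemma haar_ivl J t : haar J t = ivl J 0 2^-1 t - ivl J 2^-1 1 t.
Proof.
rewrite haarE /ivl /dset dinf_left dinf_right dlen_left dlen_right /pt.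
rewrite mul0r addr0 mul1r [2^-1 * _]mulrC.
have -> // : dinf R J + dlen R J / 2 + dlen R J / 2 = dinf R J + dlen R J by field.
Qed.

(** This makes indicators with an endpoint of coordinate [a] constant on the
    region of coordinates [A], [B] of each later interval ([ivl_const]). *)
Definition separated K a A B := forall I J, K I -> K J -> before I J ->
  outside (pt I a) (pt J A) (pt J B).

Lemma ivl_const K a b A B I J t t' : separated K a A B -> separated K b A B ->
  K I -> K J -> before I J -> `[pt J A, pt J B[%classic t -> `[pt J A, pt J B[%classic t' ->
  ivl I a b t = ivl I a b t'.
Proof. by move=> sa sb KI KJ IJ; apply: indic_const; [exact: sa|exact: sb]. Qed.

Lemma separated_sub K a A B A' B' : A <= A' -> B' <= B ->
  separated K a A B -> separated K a A' B'.
Proof.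
move=> AA BB s I J KI KJ IJ; have [sA|sB] := s I J KI KJ IJ; [left|right].
  by apply: le_trans sA _; rewrite ler_pt.
by apply: le_trans sB; rewrite ler_pt.
Qed.

End Intervals.

Section IntervalCells.
Variables (R : realType) (X : completeNormedModType R) (p : R).
Hypothesis p1 : 1 < p.
Hypothesis umd : UMD X.
Implicit Types (I J : dyadic) (K : set dyadic).

(** [three_cells] for three successive intervals; since the cells enter there
    symmetrically, any two nonzero values can be taken as the first two. *)
Lemma interval_cells K (A B a1 b1 a2 b2 a3 b3 x1 x2 x3 y1 y2 y3 : R) :
  A <= a1 -> a1 < b1 -> b1 <= a2 -> a2 < b2 -> b2 <= a3 -> a3 < b3 -> b3 <= B ->
  separated K a1 A B -> separated K b1 A B -> separated K a2 A B ->
  separated K b2 A B -> separated K a3 A B -> separated K b3 A B ->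
  (x1 != 0) || (x2 != 0) || (x3 != 0) ->
  x1 * (b1 - a1) + x2 * (b2 - a2) + x3 * (b3 - a3) = 0 ->
  y1 * (b1 - a1) + y2 * (b2 - a2) + y3 * (b3 - a3) = 0 ->
  dominates X p K
    (fun J t => x1 * ivl J a1 b1 t + x2 * ivl J a2 b2 t + x3 * ivl J a3 b3 t)
    (fun J t => y1 * ivl J a1 b1 t + y2 * ivl J a2 b2 t + y3 * ivl J a3 b3 t).
Proof.
move=> Aa1 ab1 ba1 ab2 ba2 ab3 b3B s1 s1' s2 s2' s3 s3' x0 mx my.
pose reg J := [set t | `[pt J A, pt J B[%classic t].
have m1 : 0 < b1 - a1 by rewrite subr_gt0.
have m2 : 0 < b2 - a2 by rewrite subr_gt0.
have m3 : 0 < b3 - a3 by rewrite subr_gt0.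
have st J : [/\ step (ivl J a1 b1) ((b1 - a1) * dlen R J),
  step (ivl J a2 b2) ((b2 - a2) * dlen R J) & step (ivl J a3 b3) ((b3 - a3) * dlen R J)].
  by split; apply: step_ivl; exact: ltW.
have cell J (t : R) : [\/ [/\ ivl J a1 b1 t = 0, ivl J a2 b2 t = 0 & ivl J a3 b3 t = 0],
   [/\ ivl J a1 b1 t = 1, ivl J a2 b2 t = 0 & ivl J a3 b3 t = 0],
   [/\ ivl J a1 b1 t = 0, ivl J a2 b2 t = 1 & ivl J a3 b3 t = 0] |
   [/\ ivl J a1 b1 t = 0, ivl J a2 b2 t = 0 & ivl J a3 b3 t = 1]].
  rewrite !ivlE; move: ba1 ba2 ab1 ab2 ab3.
  rewrite -(ler_pt J b1) -(ler_pt J b2) -(ltr_pt J a1) -(ltr_pt J a2) -(ltr_pt J a3) => *.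
  have [h1|h1] := ltP t (pt J b1).
    have -> : (pt J a2 <= t) = false by apply/negbTE; rewrite -ltNge; lra.
    have -> : (pt J a3 <= t) = false by apply/negbTE; rewrite -ltNge; lra.
    by rewrite /= andbT; case: (pt J a1 <= t); [constructor 2|constructor 1].
  rewrite andbF; have [h2|h2] := ltP t (pt J b2).
    have -> : (pt J a3 <= t) = false by apply/negbTE; rewrite -ltNge; lra.
    by rewrite /= andbT; case: (pt J a2 <= t); [constructor 3|constructor 1].
  by rewrite andbF; case: andb; [constructor 4|constructor 1].
have out J (t : R) : ~ reg J t -> [/\ ivl J a1 b1 t = 0, ivl J a2 b2 t = 0 & ivl J a3 b3 t = 0].
  have q a b : A <= a -> b <= B -> ~ reg J t -> ivl J a b t = 0.
    rewrite -(ler_pt J) -(ler_pt J b) => Aa bB nr; rewrite ivlE.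
    case: andP => // -[h1 h2]; exfalso; apply: nr; rewrite /reg/= in_itv/=.
    by apply/andP; split; lra.
  by move=> nr; split; apply: q => //; lra.
have cst I J (t t' : R) : K I -> K J -> before I J -> reg J t -> reg J t' ->
   [/\ ivl I a1 b1 t = ivl I a1 b1 t', ivl I a2 b2 t = ivl I a2 b2 t' &
       ivl I a3 b3 t = ivl I a3 b3 t'].
  by move=> KI KJ IJ rt rt'; split; apply: ivl_const rt rt'; eassumption.
(* a nonzero mean zero function of three values has two nonzero values *)
have [x1z|x1n] := eqVneq x1 0; last have [x2z|x2n] := eqVneq x2 0; last first.
- have := @three_cells R X p p1 umd K (fun J => ivl J a1 b1) (fun J => ivl J a2 b2)
    (fun J => ivl J a3 b3) _ _ _ reg m1 m2 m3.
  move=> /(_ (fun J _ => st J) (fun J t _ => cell J t) (fun J t _ => out J t) cst) H.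
  exact: (H x1 x2 x3 y1 y2 y3 x1n x2n mx my).
- have x3n : x3 != 0.
    apply: contraNneq x1n => x3z; move: mx; rewrite x2z x3z !mul0r !addr0 => /eqP.
    by rewrite mulf_eq0 (gt_eqF m1) orbF.
  have := @three_cells R X p p1 umd K (fun J => ivl J a1 b1) (fun J => ivl J a3 b3)
    (fun J => ivl J a2 b2) _ _ _ reg m1 m3 m2.
  move=> /(_ _ _ _ _ x1 x3 x2 y1 y3 y2 x1n x3n) H.
  apply: (dominates_eq _ _ (H _ _ _ _ _ _)).
  + by move=> J _; apply/funext => t; rewrite /cell3 addrAC.
  + by move=> J _; apply/funext => t; rewrite /cell3 addrAC.
  + by move=> J _; have [] := st J.
  + by move=> J t _; have [] := cell J t => -[? ? ?];
      [constructor 1|constructor 2|constructor 4|constructor 3].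
  + by move=> J t _ /out[].
  + by move=> I J t t' KI KJ IJ rt rt'; have [] := cst I J t t' KI KJ IJ rt rt'.
  + by rewrite addrAC.
  + by rewrite addrAC.
- have x23 : (x2 != 0) /\ (x3 != 0).
    move: x0 mx; rewrite x1z eqxx/= mul0r add0r => x0 mx; split.
      apply: contraTneq x0 => x2z; move: mx; rewrite x2z mul0r add0r => /eqP.
      by rewrite mulf_eq0 (gt_eqF m3) orbF eqxx/= => ->.
    apply: contraTneq x0 => x3z; move: mx; rewrite x3z mul0r addr0 => /eqP.
    by rewrite mulf_eq0 (gt_eqF m2) orbF eqxx/= orbF => ->.
  have := @three_cells R X p p1 umd K (fun J => ivl J a2 b2) (fun J => ivl J a3 b3)
    (fun J => ivl J a1 b1) _ _ _ reg m2 m3 m1.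
  move=> /(_ _ _ _ _ x2 x3 x1 y2 y3 y1 x23.1 x23.2) H.
  apply: (dominates_eq _ _ (H _ _ _ _ _ _)).
  + by move=> J _; apply/funext => t; rewrite /cell3 addrC addrA.
  + by move=> J _; apply/funext => t; rewrite /cell3 addrC addrA.
  + by move=> J _; have [] := st J.
  + by move=> J t _; have [] := cell J t => -[? ? ?];
      [constructor 1|constructor 4|constructor 2|constructor 3].
  + by move=> J t _ /out[].
  + by move=> I J t t' KI KJ IJ rt rt'; have [] := cst I J t t' KI KJ IJ rt rt'.
  + by rewrite addrC addrA.
  + by rewrite addrC addrA.
Qed.

End IntervalCells.

(** * The dyadic grid and the shifted grid *)

Section Grids.
Variable R : realType.
Implicit Types (I J : dyadic) (a : R) (N : int) (l : nat).

(** Points of the dyadic grid, and of the grid shifted by one third, that are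
    [2^l] times coarser than [J]. The two grids stay at distance at least
    [2^l |J| / 3]. *)
Definition coarse_dyadic l J x := exists N, x = dlen R J * (2 ^+ l * N)%:~R.
Definition coarse_shifted l J x :=
  exists N, ~~ (3 %| N)%Z /\ x = dlen R J * (2 ^+ l * N)%:~R / 3.

(** No coarse dyadic point lies strictly between the start of [J] and the end of
    [tau m J]. *)
Definition inside l m J : Prop :=
  forall N, ~ (J.2 < 2 ^+ l * N < J.2 + m%:Z + 1).

Lemma dvd3_pow2 d N : (3 %| (2 ^+ d * N)%R)%Z = (3 %| N)%Z.
Proof.
elim: d => [|d IH]; first by rewrite mul1r.
by rewrite exprS -mulrA Gauss_dvdzr.
Qed.

Lemma pt_int J N : pt J (N%:~R : R) = dlen R J * (J.2 + N)%:~R.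
Proof. by rewrite ptE intrD. Qed.

Lemma coarse_dyadic_unit l J x N : coarse_dyadic l J x ->
  outside x (pt J (N%:~R : R)) (pt J (N%:~R + 1)).
Proof.
move=> [M ->]; rewrite (_ : N%:~R + 1 = (N + 1)%:~R :> R); last by rewrite intrD.
by rewrite !pt_int addrA; apply: grid_outside; exact: dlen_gt0.
Qed.

Lemma coarse_dyadic_inside l m J x : inside l m J -> coarse_dyadic l J x ->
  outside x (pt J 0) (pt J (m%:R + 1)).
Proof.
move=> iJ [M ->].
have -> : 0 = 0%:~R :> R by [].
have -> : m%:R + 1 = (m%:Z + 1)%:~R :> R by rewrite intrD -pmulrn.
rewrite !pt_int addr0 /outside !ler_pM2l ?dlen_gt0// !ler_int addrA.
have := iJ M; set z := 2 ^+ l * M; set y := J.2 + m%:Z + 1 => H.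
have [h|h] := leP z J.2; first by left.
right; rewrite leNgt; apply/negP => h'; by apply: H; rewrite h h'.
Qed.

(** A coarse dyadic point strictly between the start of [J] and the end of
    [tau m J] is at distance at most [(m + 1) |J|] from the coordinates [-1] and
    [m + 2], and at least [2^l |J| / 3] from each coarse shifted point. *)
Lemma coarse_shifted_crossing l m J x : 3 * (m%:Z + 1) <= 2 ^+ l -> ~ inside l m J ->
  coarse_shifted l J x -> outside x (pt J (-1)) (pt J (m%:R + 2)).
Proof.
move=> lm /existsNP[N0 /notP/andP[k1 k2]] [N [N3 ->]].
have -> : -1 = (-1)%:~R :> R by [].
have -> : m%:R + 2 = (m%:Z + 2)%:~R :> R by rewrite intrD -pmulrn.
rewrite !pt_int /outside !ler_pdivrMr// !ler_pdivlMr// -!mulrA !ler_pM2l ?dlen_gt0//.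
have -> : 3 = 3%:Z%:~R :> R by [].
rewrite -!intrM !ler_int addrA.
have NN : N <> 3 * N0 by move=> E; move: N3; rewrite E dvdz_mulr.
have [h|h] : N <= 3 * N0 - 1 \/ 3 * N0 + 1 <= N by lia.
  left; have := ler_wpM2l (exprn_ge0 l (isT : 0 <= 2 :> int)) h.
  by rewrite mulrBr mulr1; move: (2 ^+ l) lm k1 k2 => M lm k1 k2 H; nia.
right; have := ler_wpM2l (exprn_ge0 l (isT : 0 <= 2 :> int)) h.
by rewrite mulrDr mulr1; move: (2 ^+ l) lm k1 k2 => M lm k1 k2 H; nia.
Qed.

Lemma pt_coarse_dyadic q l I J a N : I.1 + (q + l)%N%:Z <= J.1 -> 2 ^+ q * a = N%:~R ->
  coarse_dyadic l J (pt I a).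
Proof.
move=> IJ aN; have IJ' : I.1 <= J.1 by lia.
have [d [dE lE]] := dlen_coarse R IJ'.
have [e ed] : exists e, d = (q + l + e)%N by exists (d - (q + l))%N; lia.
exists (2 ^+ e * (2 ^+ q * I.2 + N)).
rewrite ptE dE ed !(intrM, intrD, rmorphXn)/= -aN !exprD.
by set u := 2 ^+ l; set v := 2 ^+ e; set w := 2 ^+ q; ring.
Qed.

Lemma pt_coarse_shifted q l I J a N : I.1 + (q + l)%N%:Z <= J.1 ->
  3 * (2 ^+ q * a) = N%:~R -> ~~ (3 %| N)%Z -> coarse_shifted l J (pt I a).
Proof.
move=> IJ aN N3; have IJ' : I.1 <= J.1 by lia.
have [d [dE lE]] := dlen_coarse R IJ'.
have [e ed] : exists e, d = (q + l + e)%N by exists (d - (q + l))%N; lia.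
exists (2 ^+ e * (3 * (2 ^+ q * I.2) + N)); split.
  rewrite dvd3_pow2; apply: contra N3 => /dvdzP[r E]; apply/dvdzP.
  exists (r - 2 ^+ q * I.2); rewrite mulrBl -E; ring.
rewrite ptE dE ed !(intrM, intrD, rmorphXn)/= -aN !exprD.
by set u := 2 ^+ l; set v := 2 ^+ e; set w := 2 ^+ q; field.
Qed.

Lemma coarse_dyadic_two l J x (z : int) : (forall N, 2 ^+ l * N <> J.2 + z) ->
  coarse_dyadic l J x -> outside x (pt J (z%:~R - 1)) (pt J (z%:~R + 1)).
Proof.
move=> nz [M ->].
have -> : z%:~R - 1 = (z - 1)%:~R :> R by rewrite intrB.
have -> : z%:~R + 1 = (z + 1)%:~R :> R by rewrite intrD.
rewrite !pt_int /outside !ler_pM2l ?dlen_gt0// !ler_int.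
by have := nz M; move: (2 ^+ l * M) => k nk; lia.
Qed.

End Grids.

(** A scale at which one third of a coarse interval exceeds [m + 1] intervals. *)
Definition class_scale (m : nat) : nat := (3 * (m + 1))%N.

Lemma class_scaleP m : 3 * (m%:Z + 1) <= 2 ^+ class_scale m.
Proof.
have : (class_scale m < 2 ^ class_scale m)%N by exact: ltn_expl.
by rewrite /class_scale -(ler_nat int) natrX => H; apply: le_trans H; lia.
Qed.

Section Classes.
Variables (R : realType) (m : nat).
Implicit Types (I J : dyadic) (K : set dyadic).

Local Notation l := (class_scale m).

(** Two intervals of the same class have disjoint regions when their lengths
    agree, and lengths differing by a factor [2^(l+2)] at least otherwise
    ([cls_before]). The exponent [2] allows for jumps at halves and quarters. *)
Definition cls J : 'I_l.+2 * 'I_m.+1 * bool :=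
  (inord (absz (J.1 %% l.+2%:Z)%Z), inord (absz (J.2 %% m.+1%:Z)%Z), `[< inside l m J >]).

Lemma cls_before I J : cls I = cls J -> before I J ->
  (I.1 = J.1 /\ (I.2 + m%:Z + 1 <= J.2 \/ J.2 + m%:Z + 1 <= I.2)) \/ I.1 + l.+2%:Z <= J.1.
Proof.
move=> [/(congr1 val) e1 /(congr1 val) e2 _] /andP[IJ neq]; move: e1 e2.
have q (n : nat) (z : int) : (absz (z %% n.+1%:Z)%Z < n.+1)%N.
  have := ltz_pmod z (isT : 0 < n.+1%:Z :> int); have := modz_ge0 z (isT : n.+1%:Z != 0 :> int).
  lia.
rewrite /= !inordK ?q// => e1 e2.
have pos (n : nat) (z : int) : (0 <= (z %% n.+1%:Z)%Z) := modz_ge0 z (isT : n.+1%:Z != 0).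
have {}e1 : (I.1 %% l.+2%:Z)%Z = (J.1 %% l.+2%:Z)%Z.
  by have := pos l.+1 I.1; have := pos l.+1 J.1; lia.
have {}e2 : (I.2 %% m.+1%:Z)%Z = (J.2 %% m.+1%:Z)%Z.
  by have := pos m I.2; have := pos m J.2; lia.
move/eqP: e1; rewrite eqz_mod_dvd => /dvdzP[u u1].
move/eqP: e2; rewrite eqz_mod_dvd => /dvdzP[v v1].
have [E|E] := eqVneq I.1 J.1.
  left; split => //; have v0 : v != 0.
    apply: contraNneq neq => v0; move: v1; rewrite v0 mul0r => /eqP; rewrite subr_eq0 => /eqP e2.
    by apply/eqP; case: I J E e2 {IJ u1} => [? ?] [? ?] /= -> ->.
  have [?|?] : v <= -1 \/ 1 <= v by move: v0; lia.
    by left; nia.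
  by right; nia.
by right; have : u <= -1 by [move: u1 E IJ; nia]; move: u1; nia.
Qed.

Definition class (c : 'I_l.+2 * 'I_m.+1 * bool) : set dyadic := [set J | cls J = c].

Lemma separated_class (c : 'I_l.+2 * 'I_m.+1 * bool) a (A B : R) : 0 <= a <= m%:R + 1 -> 0 <= A -> B <= m%:R + 1 ->
  (forall I J, class c I -> class c J -> I.1 + l.+2%:Z <= J.1 -> outside (pt I a) (pt J A) (pt J B)) ->
  separated (class c) a A B.
Proof.
move=> /andP[a0 am] A0 Bm H I J cI cJ IJ.
have [[E hor]|] := cls_before (etrans cI (esym cJ)) IJ; last exact: H.
have -> : pt I a = dlen R J * (I.2%:~R + a) by rewrite ptE (dlenE R (J := J)).
rewrite /outside !ptE !ler_pM2l ?dlen_gt0//.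
have mE : (m%:Z)%:~R = m%:R :> R by rewrite -pmulrn.
case: hor => h; [left|right].
  have : (I.2 + m%:Z + 1)%:~R <= J.2%:~R :> R by rewrite ler_int.
  by rewrite !intrD mE => ?; lra.
have : (J.2 + m%:Z + 1)%:~R <= I.2%:~R :> R by rewrite ler_int.
by rewrite !intrD mE => ?; lra.
Qed.

Lemma class_inside c J : class c J -> c.2 = `[< inside l m J >].
Proof. by move=> <-. Qed.

Lemma sep_inside (c : 'I_l.+2 * 'I_m.+1 * bool) (a : R) (N : int) : c.2 = true -> 0 <= a <= m%:R + 1 -> 2 * a = N%:~R ->
  separated (class c) a 0 (m%:R + 1).
Proof.
move=> ct a01 aN; apply: separated_class => // I J cI cJ IJ.
have aN' : 2 ^+ 2 * a = (2 * N)%:~R by rewrite intrM -aN; ring.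
apply: coarse_dyadic_inside (pt_coarse_dyadic (q := 2) IJ aN').
by apply/asboolP; rewrite -(class_inside cJ) ct.
Qed.

Lemma sep_crossing (c : 'I_l.+2 * 'I_m.+1 * bool) (a : R) (N : int) : c.2 = false -> 0 <= a <= m%:R + 1 -> 12 * a = N%:~R ->
  ~~ (3 %| N)%Z -> separated (class c) a 0 (m%:R + 1).
Proof.
move=> cf a01 aN N3; apply: separated_class => // I J cI cJ IJ.
have nJ : ~ inside (class_scale m) m J by apply/asboolPn; rewrite -(class_inside cJ) cf.
have aN' : 3 * (2 ^+ 2 * a) = N%:~R by rewrite -aN; ring.
have [h|h] := coarse_shifted_crossing (class_scaleP m) nJ (pt_coarse_shifted (q := 2) IJ aN' N3).
  by left; apply: le_trans h _; rewrite ler_pt lerN10.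
by right; apply: le_trans h; rewrite ler_pt lerD2l ler1n.
Qed.

Lemma sep_unit (c : 'I_l.+2 * 'I_m.+1 * bool) (a : R) (N : int) (k : nat) : (k <= m)%N -> 0 <= a <= m%:R + 1 -> 2 * a = N%:~R ->
  separated (class c) a k%:R (k%:R + 1).
Proof.
move=> km a01 aN; apply: separated_class => //; first by rewrite lerD2r ler_nat.
move=> I J cI cJ IJ.
have aN' : 2 ^+ 2 * a = (2 * N)%:~R by rewrite intrM -aN; ring.
have := coarse_dyadic_unit k (pt_coarse_dyadic (q := 2) IJ aN').
by rewrite (_ : (k%:Z)%:~R = k%:R :> R)// -pmulrn.
Qed.

Definition shift_difference J : R -> R := fun t => \1_(@dset R (tau m J)) t - \1_(@dset R J) t.

End Classes.

(** * Boundedness of the shift differences *)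

Section ShiftBound.
Variables (R : realType) (X : completeNormedModType R) (p : R).
Hypothesis p1 : 1 < p.
Hypothesis umd : UMD X.
Variables (m : nat).
Hypothesis m0 : (1 <= m)%N.
Implicit Types (I J : dyadic) (K : set dyadic).
Local Notation class := (@class m).
Local Notation shift_difference := (@shift_difference R m).

Let mR : 1 <= m%:R :> R. Proof. by rewrite ler1n. Qed.

(** Without a coarse dyadic point in the region, the two halves of [J] and
    [tau m J] can serve as cells: all jumps are dyadic. *)
Lemma bound_inside c : c.2 = true -> dominates X p (class c) (@haar R) shift_difference.
Proof.
move=> ct; have mR1 : 1 <= m%:R :> R by exact: mR.
have H := @interval_cells R X p p1 umd (class c) 0 (m%:R + 1) 0 2^-1 2^-1 1 m%:R (m%:R + 1)
  1 (-1) 0 (-1) (-1) 1.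
apply: (dominates_eq _ _ (H _ _ _ _ _ _ _ _ _ _ _ _ _ _ _ _)) => //; try lra.
- by move=> J _; apply/funext => t; rewrite haar_ivl; ring.
- move=> J _; apply/funext => t; rewrite /shift_difference indic_tau_ivl indic_dset_ivl.
  by rewrite -(@ivlD _ J 0 2^-1 1); [ring|lra|lra].
- by apply: (sep_inside (N := 0) ct); [apply/andP; split; lra|rewrite mulr0].
- by apply: (sep_inside (N := 1) ct); [apply/andP; split; lra|rewrite mulfV].
- by apply: (sep_inside (N := 1) ct); [apply/andP; split; lra|rewrite mulfV].
- by apply: (sep_inside (N := 2) ct); [apply/andP; split; lra|rewrite mulr1].
- by apply: (sep_inside (N := 2 * m%:Z) ct); [apply/andP; split; lra|rewrite intrM -pmulrn].
- by apply: (sep_inside (N := 2 * m%:Z + 2) ct); [apply/andP; split; lra|rewrite intrD intrM -pmulrn mulrDr mulr1].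
Qed.

End ShiftBound.

(** A coarse dyadic point [c] may separate [J] from [tau m J], and earlier dyadic
    jumps may occur at [c]. So dyadic endpoints are used for cells within [J] or
    within [tau m J] only, and the passage from one to the other uses cells
    [k + 1/12, k + 1/3[ and [k + 1/3, k + 7/12[ with [k] equal to [0] or [m].
    Their endpoints are of the form [N / 12] with [N] prime to [3], so as jumps of
    earlier functions they are coarse shifted points, hence far from [c].
    The chain of dominations is [h -> F1 -> F2 0 -> G 0 -> E -> G m -> F2 m -> Q m],
    and [F1 -> Q 0]; then [1_(tau m J) - 1_J = Q 0 + 4 E - Q m]. *)
Lemma bound_crossing (R : realType) (X : completeNormedModType R) (p : R) (p1 : 1 < p)
    (umd : UMD X) (m : nat) (m0 : (1 <= m)%N) c : c.2 = false ->
  dominates X p (@class m c) (@haar R) (@shift_difference R m).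
Proof.
move=> cf; have mR1 : 1 <= m%:R :> R by rewrite ler1n.
pose M : R := m%:R.
have M1 : 1 <= M by [].
have S (a : R) (N : int) : 0 <= a <= M + 1 -> 12 * a = N%:~R -> ~~ (3 %| N)%Z ->
  @separated R (@class m c) a 0 (M + 1) by exact: sep_crossing.
have mM : (m%:Z)%:~R = M by rewrite -pmulrn.
have n3 (k : int) (r : int) : (r == 1) || (r == 2) -> ~~ (3 %| 3 * k + r)%Z.
  by move=> hr; apply/negP => /dvdzP[q]; move: hr; lia.
have a1 : @separated R (@class m c) 12^-1 0 (M + 1).
  by apply: (S _ (3 * 0 + 1)); [apply/andP; split; lra|rewrite mulfV|exact: n3].
have a2 : @separated R (@class m c) 3^-1 0 (M + 1).
  by apply: (S _ (3 * 1 + 1)); [apply/andP; split; lra|rewrite intrD intrM; lra|exact: n3].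
have a3 : @separated R (@class m c) (7 / 12) 0 (M + 1).
  by apply: (S _ (3 * 2 + 1)); [apply/andP; split; lra|rewrite intrD intrM; lra|exact: n3].
have b1 : @separated R (@class m c) (M + 12^-1) 0 (M + 1).
  apply: (S _ (3 * (4 * m%:Z) + 1)); [apply/andP; split; lra| |exact: n3].
  by rewrite !(intrD, intrM) mM; lra.
have b2 : @separated R (@class m c) (M + 3^-1) 0 (M + 1).
  apply: (S _ (3 * (4 * m%:Z + 1) + 1)); [apply/andP; split; lra| |exact: n3].
  by rewrite !(intrD, intrM) mM; lra.
have b3 : @separated R (@class m c) (M + 7 / 12) 0 (M + 1).
  apply: (S _ (3 * (4 * m%:Z + 2) + 1)); [apply/andP; split; lra| |exact: n3].
  by rewrite !(intrD, intrM) mM; lra.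
have D0 (a : R) (N : int) : 0 <= a <= M + 1 -> 2 * a = N%:~R -> @separated R (@class m c) a 0 1.
  by move=> h1 h2; have := sep_unit (k := 0) (c := c) isT h1 h2; rewrite add0r.
have Dm (a : R) (N : int) : 0 <= a <= M + 1 -> 2 * a = N%:~R -> @separated R (@class m c) a M (M + 1).
  by move=> h1 h2; exact: (sep_unit (k := m) (c := c) (leqnn m) h1 h2).
have sub01 a : @separated R (@class m c) a 0 (M + 1) -> @separated R (@class m c) a 0 1.
  by apply: separated_sub => //; lra.
have submm a : @separated R (@class m c) a 0 (M + 1) -> @separated R (@class m c) a M (M + 1).
  by apply: separated_sub => //; lra.
have d0 : @separated R (@class m c) 0 0 1 by refine (D0 0 0 _ _); [apply/andP; split; lra|rewrite mulr0].
have d1 : @separated R (@class m c) 2^-1 0 1 by refine (D0 _ 1 _ _); [apply/andP; split; lra|rewrite mulfV].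
have d2 : @separated R (@class m c) 1 0 1 by refine (D0 _ 2 _ _); [apply/andP; split; lra|rewrite mulr1].
have e0 : @separated R (@class m c) M M (M + 1).
  by refine (Dm _ (2 * m%:Z) _ _); [apply/andP; split; lra|rewrite intrM mM].
have e1 : @separated R (@class m c) (M + 1) M (M + 1).
  by refine (Dm _ (2 * m%:Z + 2) _ _); [apply/andP; split; lra|rewrite intrD intrM mM; lra].
have [a1' a2' a3'] := And3 (sub01 _ a1) (sub01 _ a2) (sub01 _ a3).
have [b1' b2' b3'] := And3 (submm _ b1) (submm _ b2) (submm _ b3).
pose F1 J t : R := 11 * ivl J 0 12^-1 t - ivl J 12^-1 1 t.
pose Q k J t : R := 4 * ivl J (k + 12^-1) (k + 3^-1) t - ivl J k (k + 1) t.
pose F2 k J t : R := 8 * ivl J (k + 12^-1) (k + 3^-1) t - 3 * ivl J (k + 3^-1) (k + 1) t.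
pose G k J t : R := ivl J (k + 12^-1) (k + 3^-1) t - ivl J (k + 3^-1) (k + 7 / 12) t.
pose E J t : R := ivl J (M + 12^-1) (M + 3^-1) t - ivl J 12^-1 3^-1 t.
have C := @interval_cells R X p p1 umd (@class m c).
(* inside J, in the dyadic grid *)
have T1 : dominates X p (@class m c) (@haar R) F1.
  have H := C 0 1 0 12^-1 12^-1 2^-1 2^-1 1 1 1 (-1) 11 (-1) (-1).
  apply: (dominates_eq _ _ (H _ _ _ _ _ _ _ _ _ _ _ _ _ _ _ _)) => //; try by clear -M1; lra.
  - move=> J _; apply/funext => t; rewrite haar_ivl.
    by rewrite -(@ivlD _ J 0 12^-1 2^-1); [by clear; ring|by clear -M1; lra|by clear -M1; lra].
  - move=> J _; apply/funext => t; rewrite /F1.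
    by rewrite -(@ivlD _ J 12^-1 2^-1 1); [by clear; ring|by clear -M1; lra|by clear -M1; lra].
have T2 : dominates X p (@class m c) F1 (Q 0).
  have H := C 0 1 0 12^-1 12^-1 3^-1 3^-1 1 11 (-1) (-1) (-1) 3 (-1).
  apply: (dominates_eq _ _ (H _ _ _ _ _ _ _ _ _ _ _ _ _ _ _ _)) => //; try by clear -M1; lra.
  - move=> J _; apply/funext => t; rewrite /F1.
    by rewrite -(@ivlD _ J 12^-1 3^-1 1); [by clear; ring|by clear -M1; lra|by clear -M1; lra].
  - move=> J _; apply/funext => t; rewrite /Q !add0r.
    rewrite -(@ivlD _ J 0 12^-1 1); [|by clear -M1; lra|by clear -M1; lra].
    by rewrite -(@ivlD _ J 12^-1 3^-1 1); [by clear; ring|by clear -M1; lra|by clear -M1; lra].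
have T3 : dominates X p (@class m c) F1 (F2 0).
  have H := C 0 1 0 12^-1 12^-1 3^-1 3^-1 1 11 (-1) (-1) 0 8 (-3).
  apply: (dominates_eq _ _ (H _ _ _ _ _ _ _ _ _ _ _ _ _ _ _ _)) => //; try by clear -M1; lra.
  - move=> J _; apply/funext => t; rewrite /F1.
    by rewrite -(@ivlD _ J 12^-1 3^-1 1); [by clear; ring|by clear -M1; lra|by clear -M1; lra].
  - by move=> J _; apply/funext => t; rewrite /F2 !add0r; clear; ring.
have T4 : dominates X p (@class m c) (F2 0) (G 0).
  have H := C 0 1 12^-1 3^-1 3^-1 (7 / 12) (7 / 12) 1 8 (-3) (-3) 1 (-1) 0.
  apply: (dominates_eq _ _ (H _ _ _ _ _ _ _ _ _ _ _ _ _ _ _ _)) => //; try by clear -M1; lra.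
  - move=> J _; apply/funext => t; rewrite /F2 !add0r.
    by rewrite -(@ivlD _ J 3^-1 (7 / 12) 1); [by clear; ring|by clear -M1; lra|by clear -M1; lra].
  - by move=> J _; apply/funext => t; rewrite /G !add0r; clear; ring.
(* across the dyadic boundary, in the shifted grid *)
have T5 : dominates X p (@class m c) (G 0) E.
  have H := C 0 (M + 1) 12^-1 3^-1 3^-1 (7 / 12) (M + 12^-1) (M + 3^-1) 1 (-1) 0 (-1) 0 1.
  apply: (dominates_eq _ _ (H _ _ _ _ _ _ _ _ _ _ _ _ _ _ _ _)) => //; try by clear -M1; lra.
  - by move=> J _; apply/funext => t; rewrite /G !add0r; clear; ring.
  - by move=> J _; apply/funext => t; rewrite /E; clear; ring.
have T6 : dominates X p (@class m c) E (G M).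
  have H := C 0 (M + 1) 12^-1 3^-1 (M + 12^-1) (M + 3^-1) (M + 3^-1) (M + 7 / 12) (-1) 1 0 0 1 (-1).
  apply: (dominates_eq _ _ (H _ _ _ _ _ _ _ _ _ _ _ _ _ _ _ _)) => //; try by clear -M1; lra.
  - by move=> J _; apply/funext => t; rewrite /E; clear; ring.
  - by move=> J _; apply/funext => t; rewrite /G; clear; ring.
(* inside tau m J, in the dyadic grid *)
have T7 : dominates X p (@class m c) (G M) (F2 M).
  have H := C M (M + 1) (M + 12^-1) (M + 3^-1) (M + 3^-1) (M + 7 / 12) (M + 7 / 12) (M + 1)
    1 (-1) 0 8 (-3) (-3).
  apply: (dominates_eq _ _ (H _ _ _ _ _ _ _ _ _ _ _ _ _ _ _ _)) => //; try by clear -M1; lra.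
  - by move=> J _; apply/funext => t; rewrite /G; clear; ring.
  - move=> J _; apply/funext => t; rewrite /F2.
    by rewrite -(@ivlD _ J (M + 3^-1) (M + 7 / 12) (M + 1)); [by clear; ring|by clear -M1; lra|by clear -M1; lra].
have T8 : dominates X p (@class m c) (F2 M) (Q M).
  have H := C M (M + 1) M (M + 12^-1) (M + 12^-1) (M + 3^-1) (M + 3^-1) (M + 1)
    0 8 (-3) (-1) 3 (-1).
  apply: (dominates_eq _ _ (H _ _ _ _ _ _ _ _ _ _ _ _ _ _ _ _)) => //; try by clear -M1; lra.
  - by move=> J _; apply/funext => t; rewrite /F2; clear; ring.
  - move=> J _; apply/funext => t; rewrite /Q.
    rewrite -(@ivlD _ J M (M + 12^-1) (M + 1)); [|by clear -M1; lra|by clear -M1; lra].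
    by rewrite -(@ivlD _ J (M + 12^-1) (M + 3^-1) (M + 1)); [by clear; ring|by clear -M1; lra|by clear -M1; lra].
have hE : dominates X p (@class m c) (@haar R) E.
  by apply: dominates_trans T5; apply: dominates_trans T4; exact: dominates_trans T3.
have hQ : dominates X p (@class m c) (@haar R) (Q 0) by exact: dominates_trans T2.
have hQm : dominates X p (@class m c) (@haar R) (Q M).
  by apply: dominates_trans T8; apply: dominates_trans T7; exact: dominates_trans T6.
have sQ k J : class c J -> exists d, step (Q k J) d.
  move=> _; eexists; apply: step_sub; first apply: step_scale; apply: step_ivl; lra.
have sE J : class c J -> exists d, step (E J) d.
  move=> _; eexists; apply: step_sub; apply: step_ivl; lra.
have sQE J : class c J -> exists d, step (fun t => 1 * Q 0 J t + 4 * E J t) d.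
  move=> cJ; have [d1' h1] := sQ 0 J cJ; have [d2' h2] := sE J cJ.
  by eexists; apply: step_add; apply: step_scale; eassumption.
have h1 := dominates_comb p1 1 4 (sQ 0) sE hQ hE.
have := dominates_comb p1 1 (-1) sQE (sQ M) h1 hQm.
apply: dominates_eq => // J _; apply/funext => t.
rewrite /shift_difference indic_tau_ivl indic_dset_ivl -/M /Q /E !add0r; clear; ring.
Qed.

Section ShiftBound.
Variables (R : realType) (X : completeNormedModType R) (p : R).
Hypothesis p1 : 1 < p.
Hypothesis umd : UMD X.
Variables (m : nat).
Hypothesis m0 : (1 <= m)%N.
Implicit Types (I J : dyadic) (K : set dyadic).
Local Notation class := (@class m).
Local Notation cls := (@cls m).
Local Notation shift_difference := (@shift_difference R m).

(** There are finitely many classes, and restricting a Haar polynomial to one of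
    them is bounded by unconditionality. *)
Lemma shift_difference_bound : dominates X p setT (@haar R) shift_difference.
Proof.
have [C C0 HC] := haar_unconditional p1 umd.
have /choice[D HD] : forall c, exists D : R, 0 <= D /\ forall s x, uniq s ->
    (forall I, I \in s -> class c I) ->
    nrm (@lebesgue_measure R) p (fsum shift_difference s (x : dyadic -> X)) <=
    D * nrm (@lebesgue_measure R) p (fsum (@haar R) s x).
  move=> c; case E : c.2; [have [D D0 H] := bound_inside p1 umd m0 E|have [D D0 H] := bound_crossing p1 umd m0 E];
  by exists D; split.
exists (\sum_c D c * C); first by apply: sumr_ge0 => c _; rewrite mulr_ge0// (HD c).1.
move=> s x us _.
pose part c := [seq I <- s | cls I == c].
have partK c I : I \in part c -> class c I by rewrite mem_filter => /andP[/eqP].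
have upart c : uniq (part c) by exact: filter_uniq.
have Lsd c : in_LpX (@lebesgue_measure R) p (fsum shift_difference (part c) x).
  apply: LpX_sum => // I; have [d1 h1] : exists d, step (shift_difference I) d.
    by eexists; apply: step_sub; exact: step_dset.
  exact: Lp_step h1.
rewrite (_ : fsum shift_difference s x =
    fun t => \sum_c fsum shift_difference (part c) x t); last first.
  apply/funext => t; rewrite /fsum /part.
  under [RHS]eq_bigr => c _ do rewrite big_filter.
  rewrite (exchange_big_dep xpredT)//=; apply: eq_bigr => I _.
  by rewrite (big_pred1 (cls I)).
apply: le_trans (nrm_sum p1 _ Lsd) _; rewrite mulr_suml; apply: ler_sum => c _.
apply: le_trans ((HD c).2 (part c) x (upart c) (partK c)) _; rewrite -mulrA.
apply: ler_wpM2l; first exact: (HD c).1.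
have := HC s x (fun I => cls I == c) us.
by rewrite (_ : (fun t => _) = fsum (@haar R) (part c) x)//;
  apply/funext => t; rewrite /fsum /part big_filter.
Qed.

End ShiftBound.

(** * The one-third shift *)

Section OneThird.
Variable R : realType.
Implicit Types (I J : dyadic) (e : bool) (t a b : R).

Lemma dlen_inj I J : dlen R I = dlen R J -> I.1 = J.1.
Proof.
rewrite /dlen => /(@ieexprIz R 2 (ltr0n _ 2)) H; apply: oppr_inj; apply: H.
by rewrite pnatr_eq1.
Qed.

(** The endpoint of the shifted grid inside an interval of level [j], in the
    coordinate of that interval. *)
Definition theta (j : int) : R := if (-1) ^ j == 1 :> R then 3^-1 else 2 / 3.

Lemma sign_exprz (j : int) : (-1) ^ j = 1 :> R \/ (-1) ^ j = -1 :> R.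
Proof.
by case: j => n; rewrite ?NegzE -?exprnN -?exprnP; rewrite -signr_odd; case: odd;
  rewrite ?expr0 ?expr1 ?invr1 ?invrN1; [right|left|right|left].
Qed.

Lemma theta_cases (j : int) :
  (theta j = 3^-1 /\ (-1) ^ j = 1 :> R) \/ (theta j = 2 / 3 /\ (-1) ^ j = -1 :> R).
Proof.
rewrite /theta; have [->|->] := sign_exprz j; first by left; rewrite eqxx.
by right; rewrite ifF// -subr_eq0; apply/negbTE; rewrite -opprD oppr_eq0 -mulr2n pnatr_eq0.
Qed.

Lemma theta_bound j : 0 < theta j < 1.
Proof. by have [[-> _]|[-> _]] := theta_cases j; apply/andP; split; lra. Qed.

Lemma theta_shifted j : exists N : int, 3 * theta j = N%:~R /\ ~~ (3 %| N)%Z.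
Proof.
have [[-> _]|[-> _]] := theta_cases j; first by exists 1; split => //; rewrite mulfV.
by exists 2; split => //; rewrite mulrC divfK.
Qed.

Lemma dset_ptP I a : dset I (pt I a) <-> 0 <= a < 1.
Proof.
rewrite /dset/= in_itv/= {1}(_ : dinf R I = pt I 0); last by rewrite /pt mul0r addr0.
by rewrite ler_pt (_ : dinf R I + dlen R I = pt I 1) ?ltr_pt// /pt mul1r.
Qed.

Lemma pt_level I J a : I.1 = J.1 -> pt J a = pt I ((J.2 - I.2)%:~R + a).
Proof.
by move=> IJ; rewrite !ptE (dlenE R IJ) intrD rmorphN/=; congr (_ * _); ring.
Qed.

Lemma sinfE I : sinf R I = pt I ((-1) ^ I.1 / 3).
Proof. by rewrite /sinf /pt mulrAC. Qed.

Lemma ssupE I : ssup R I = pt I ((-1) ^ I.1 / 3 + 1).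
Proof. by rewrite /ssup sinfE /pt mulrDl mul1r addrA. Qed.

Lemma frac_unique (z : int) a : 0 <= a < 1 -> 0 <= z%:~R + a < 1 -> z = 0.
Proof.
move=> /andP[a0 a1] /andP[h1 h2].
have h3 : z%:~R < 1 :> R by lra.
have h4 : -1 < z%:~R :> R by lra.
have h5 : z < 1 by rewrite -(ltr_int R).
have h6 : -1 < z by rewrite -(ltr_int R).
by lia.
Qed.

(** The endpoints of the shifted intervals as long as [I] have the coordinates
    [theta + k] for integers [k], exactly one of which lies in [0, 1[. *)
Lemma alphaE e I : alpha e I =
  `[pt I (theta I.1 + e%:R - 1), pt I (theta I.1 + e%:R)[%classic :> set R.
Proof.
have key (J : dyadic) : J.1 = I.1 ->
    (if e then sinf R J else ssup R J) = pt I (theta I.1) ->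
    alpha e I = sset J :> set R.
  move=> JI E; rewrite /alpha (_ : xget I _ = J)//.
  apply: xget_unique.
    split; first exact: dlenE.
    by rewrite E; apply/dset_ptP; have /andP[/ltW -> ->] := theta_bound I.1.
  move=> K [/dlen_inj KI] KE.
  have KJ : K.1 = J.1 by rewrite KI JI.
  have {}KE : dset I (pt I ((K.2 - J.2)%:~R + theta I.1)).
    move: KE E; case: (e); rewrite ?sinfE ?ssupE KJ (pt_level _ (esym KJ)) => KE E;
    move: KE; rewrite ptE (dlenE R JI) in E; move: E;
    rewrite !ptE (dlenE R JI) => /(mulfI (lt0r_neq0 (dlen_gt0 R I))) E;
    by rewrite [X in dset I (_ * X)](_ : _ = I.2%:~R + ((K.2 - J.2)%:~R + theta I.1)) //; lra.
  have t01 : 0 <= theta I.1 < 1 by have /andP[/ltW -> ->] := theta_bound I.1.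
  move/dset_ptP: KE => /(frac_unique t01) E2; case: K J KJ E2 {KI JI E} => [? k] [? k'] /= -> E2.
  by congr pair; lia.
have z (k : int) (a b : R) : k%:~R + a = b -> pt (I.1, I.2 + k) a = pt I b.
  move=> <-; rewrite (pt_level _ (_ : I.1 = (I.1, I.2 + k).1))//=.
  by rewrite addrAC subrr add0r.
have sz (k : int) (x y : R) : k%:~R + (-1) ^ I.1 / 3 = x -> x + 1 = y ->
    sset (I.1, I.2 + k) = `[pt I x, pt I y[%classic.
  move=> <- <-; rewrite /sset sinfE ssupE -addrA.
  by rewrite (z _ _ _ erefl) (z _ _ _ erefl).
have [[tE sE]|[tE sE]] := theta_cases I.1; case: e key => key.
- transitivity (@sset R (I.1, I.2 + 0)); first apply: key => //.
    by rewrite sinfE; apply: z; rewrite /= sE tE; lra.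
  by apply: sz; rewrite ?sE tE/=; lra.
- transitivity (@sset R (I.1, I.2 + (-1))); first apply: key => //.
    by rewrite ssupE; apply: z; rewrite /= sE tE; lra.
  by apply: sz; rewrite ?sE tE/=; lra.
- transitivity (@sset R (I.1, I.2 + 1)); first apply: key => //.
    by rewrite sinfE; apply: z; rewrite /= sE tE; lra.
  by apply: sz; rewrite ?sE tE/=; lra.
- transitivity (@sset R (I.1, I.2 + 0)); first apply: key => //.
    by rewrite ssupE; apply: z; rewrite /= sE tE; lra.
  by apply: sz; rewrite ?sE tE/=; lra.
Qed.

Lemma pt_tau m I a : pt (tau m I) a = pt I (m%:R + a).
Proof.
by rewrite (pt_level a (_ : I.1 = (tau m I).1))//= addrAC subrr add0r -pmulrn.
Qed.

Lemma ivl_tau m I a b t : ivl (tau m I) a b t = ivl I (m%:R + a) (m%:R + b) t.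
Proof. by rewrite /ivl !pt_tau. Qed.

Lemma afun_ivl m e I t : let o := theta I.1 + e%:R in
  afun m e I t = ivl I (m%:R + (o - 1)) (m%:R + o) t - ivl I (o - 1) o t.
Proof. by rewrite /= /afun !alphaE /= -!/(ivl _ _ _ _) ivl_tau. Qed.

Lemma bfun_true I t : bfun true I t = ivl I 1 (theta I.1 + 1) t - ivl I 0 (theta I.1) t.
Proof.
have /andP[t0 t1] := theta_bound I.1.
have D : @dset R I = `[pt I 0, pt I 1[%classic by rewrite /dset /pt mul0r mul1r addr0.
rewrite /bfun /beta !alphaE D /= !addr0 addrK -[in RHS](addr0 (theta I.1)).
move: (ltr_pt I 0 (theta I.1)) (ltr_pt I (theta I.1) 1) => p1 p2.
rewrite t0 in p1; rewrite t1 in p2.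
have p3 : pt I 1 < pt I (theta I.1 + 1) by rewrite ltr_pt; lra.
have p4 : pt I (theta I.1 - 1) < pt I 0 by rewrite ltr_pt; lra.
rewrite !addr0 /ivl; congr (_ - _); rewrite !indicE; congr (_%:R); congr nat_of_bool;
  rewrite !(in_setD, in_setI) !mem_setE !in_itv/=.
  have [?|?] := leP (pt I 1) t; have [?|?] := leP (pt I (theta I.1)) t;
    have [?|?] := leP (pt I 0) t; have [?|?] := ltP t (pt I (theta I.1 + 1)) => //=; exfalso; lra.
have [?|?] := leP (pt I 1) t; have [?|?] := leP (pt I (theta I.1)) t;
  have [?|?] := leP (pt I 0) t; have [?|?] := leP (pt I (theta I.1 - 1)) t => //=; exfalso; lra.
Qed.

Lemma bfun_false I t : bfun false I t = ivl I (theta I.1 - 1) 0 t - ivl I (theta I.1) 1 t.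
Proof.
have /andP[t0 t1] := theta_bound I.1.
have D : @dset R I = `[pt I 0, pt I 1[%classic by rewrite /dset /pt mul0r mul1r addr0.
rewrite /bfun /beta !alphaE D /= !addr0 addrK.
move: (ltr_pt I 0 (theta I.1)) (ltr_pt I (theta I.1) 1) => p1 p2.
rewrite t0 in p1; rewrite t1 in p2.
have p3 : pt I 1 < pt I (theta I.1 + 1) by rewrite ltr_pt; lra.
have p4 : pt I (theta I.1 - 1) < pt I 0 by rewrite ltr_pt; lra.
rewrite /ivl; congr (_ - _); rewrite !indicE; congr (_%:R); congr nat_of_bool;
  rewrite !(in_setD, in_setI) !mem_setE !in_itv/=.
  have [?|?] := leP (pt I 1) t; have [?|?] := leP (pt I (theta I.1)) t;
    have [?|?] := leP (pt I 0) t; have [?|?] := leP (pt I (theta I.1 - 1)) t => //=; exfalso; lra.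
have [?|?] := leP (pt I 1) t; have [?|?] := leP (pt I (theta I.1)) t;
  have [?|?] := leP (pt I 0) t; have [?|?] := ltP t (pt I (theta I.1 + 1)) => //=; exfalso; lra.
Qed.

(** [bfun e I] is the indicator of the part of [alpha e I] outside [I] minus that
    of the part of [I] outside [alpha e I], so adding it to the indicator of [I]
    gives the indicator of [alpha e I]; likewise for [tau m I]. *)
Lemma afun_bfun m e I t :
  afun m e I t + (bfun e I t - bfun e (tau m I) t) = shift_difference m I t.
Proof.
have /andP[t0 t1] := theta_bound I.1.
rewrite afun_ivl /shift_difference indic_tau_ivl indic_dset_ivl.
case: e; rewrite ?bfun_true ?bfun_false !ivl_tau/= ?addr0 ?addrK.
  rewrite -(@ivlD _ I 0 (theta I.1) 1); [|lra|lra].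
  rewrite -(@ivlD _ I m%:R (m%:R + theta I.1) (m%:R + 1)); [|lra|lra].
  rewrite -(@ivlD _ I (theta I.1) 1 (theta I.1 + 1)); [|lra|lra].
  rewrite -(@ivlD _ I (m%:R + theta I.1) (m%:R + 1) (m%:R + (theta I.1 + 1))); [|lra|lra].
  ring.
rewrite -(@ivlD _ I 0 (theta I.1) 1); [|lra|lra].
rewrite -(@ivlD _ I m%:R (m%:R + theta I.1) (m%:R + 1)); [|lra|lra].
rewrite -(@ivlD _ I (theta I.1 - 1) 0 (theta I.1)); [|lra|lra].
rewrite -(@ivlD _ I (m%:R + (theta I.1 - 1)) m%:R (m%:R + theta I.1)); [|lra|lra].
ring.
Qed.

End OneThird.

(** * The collections *)

Section Collections.
Variables (R : realType) (m : nat).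
Hypothesis m0 : (1 <= m)%N.
Implicit Types (I J : dyadic) (i : nat) (e : bool).
Local Notation l := (lam m).

Lemma lam_gt0 : (0 < l)%N.
Proof. by rewrite /lam; case: ifP. Qed.

(** The reason for the choice of [lam]: one third of an interval [2^lam] times as
    long as [J] is at least as long as the hull of [J] and [tau m J]. *)
Lemma lam_large : 3 * (m%:Z + 1) <= 2 ^+ l.
Proof.
suff : (3 * (m + 1) <= 2 ^ l)%N by rewrite -(ler_nat int) natrX => H; apply: le_trans H; lia.
rewrite /lam; case: eqP => [->//|/eqP m1].
have : (m < 2 ^ (trunc_log 2 m).+1)%N by apply: trunc_log_ltn.
by rewrite !expnS; lia.
Qed.

Lemma pow_lam_gt : m%:Z + 1 < 2 ^+ l :> int.
Proof. by have := lam_large; lia. Qed.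

Lemma Km_lam : (Km m).+1 = l.*2.
Proof. by rewrite /Km /Lm; have := lam_gt0; lia. Qed.

Lemma Lm_lam : (Lm m).+1 = l.
Proof. by rewrite /Lm prednK// lam_gt0. Qed.

Lemma dlenP (j : int) I : dlen R I = 2 ^ (- j) <-> I.1 = j.
Proof. by split=> [/(@dlen_inj R I (j, 0))|<-]. Qed.

Lemma AcolP i I : Acol R m i I <-> exists j, I.1 = l%:Z * j + i%:Z.
Proof. by split=> -[j] /dlenP H; exists j => //; apply/dlenP. Qed.

Lemma Acol_levels i I J : Acol R m i I -> Acol R m i J -> I.1 < J.1 -> I.1 + l%:Z <= J.1.
Proof.
move=> /AcolP[a ->] /AcolP[b ->] ab; have l0 := lam_gt0.
have : a < b by move: ab; rewrite ltrD2r ltr_pM2l// ltz_nat.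
by move: (l) l0 => L L0 h; nia.
Qed.

Lemma dset_subP I J : @dset R J `<=` dset I -> J.1 >= I.1 -> exists d : nat,
  [/\ J.1 = I.1 + d%:Z, 2 ^+ d * I.2 <= J.2 & J.2 + 1 <= 2 ^+ d * (I.2 + 1)].
Proof.
move=> JI IJ; have [d [dE lE]] := dlen_coarse R IJ; exists d.
have l0 := dlen_gt0 R J.
have t1 : dset J (dinf R J) by rewrite /dset/= in_itv/= lexx ltrDl.
have := JI _ t1; rewrite /dset/= in_itv/= -/(dsup R I) dsupE /dinf dE -!mulrA.
rewrite ler_pM2l// ltr_pM2l//.
have e2 : 2 ^+ d = (2 ^+ d : int)%:~R :> R by rewrite rmorphXn.
by rewrite e2 -!intrM ler_int ltr_int => /andP[h1 h2]; split; rewrite ?lezD1.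
Qed.

Lemma dset_sub I J (d : nat) : J.1 = I.1 + d%:Z -> 2 ^+ d * I.2 <= J.2 ->
  J.2 + 1 <= 2 ^+ d * (I.2 + 1) -> @dset R J `<=` dset I.
Proof.
move=> E h1 h2 t; have l0 := dlen_gt0 R J.
have IJ : I.1 <= J.1 by lia.
have [d' [dE lE]] := dlen_coarse R IJ.
have dd : d' = d by lia.
rewrite dd in dE.
rewrite /dset/= !in_itv/= -!/(dsup R _) !dsupE /dinf dE => /andP[t1 t2].
have e2 : 2 ^+ d = (2 ^+ d : int)%:~R :> R by rewrite rmorphXn.
apply/andP; split.
  by apply: le_trans t1; rewrite -mulrA ler_pM2l// e2 -intrM ler_int.
by apply: lt_le_trans t2 _; rewrite -mulrA ler_pM2l// e2 -intrM ler_int.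
Qed.

Lemma pow2_split k d : exists q, 2 ^+ d * q <= k :> int /\ k + 1 <= 2 ^+ d * (q + 1).
Proof.
have : 0 < 2 ^+ d :> int by rewrite exprn_gt0.
move: (2 ^+ d : int) => M M0; exists (k %/ M)%Z.
have := divz_eq k M; have := ltz_pmod k M0; have := modz_ge0 k (lt0r_neq0 M0).
move: (k %% M)%Z (k %/ M)%Z => r q r0 rM ->; split; nia.
Qed.

(** An interval [2^lam] times as long as [J] has coarse dyadic points as its
    endpoints and none inside. *)
Lemma Acol0P i J : Acol0 R m i J <-> Acol R m i J /\ inside l m J.
Proof.
split=> [[AJ [I [AI lJ JI tJI]]]|[AJ iJ]].
  split => // N /andP[N1 N2].
  have lvl : J.1 = I.1 + l%:Z.
    by move: lJ; rewrite [dlen R I]/dlen -expfzDr// -opprD => /dlenP ->; rewrite addrC.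
  have IJ : I.1 <= J.1 by lia.
  have [d [d1 h1 h2]] := dset_subP JI IJ.
  have [d' [d1' h1' h2']] := dset_subP tJI (IJ : (tau m J).1 >= I.1).
  have ? : d = l by lia.
  have ? : d' = l by move: d1' => /=; lia.
  subst d d'; move: h2' => /= h2'.
  have pz : 0 < 2 ^+ l :> int by rewrite exprn_gt0.
  move: (2 ^+ l : int) pz N1 N2 h1 h2 h2' => M pz N1 N2 h1 h2 h2'.
  have q1 : I.2 < N by nia.
  have q2 : N < I.2 + 1 by nia.
  by lia.
split => //; have [q [q1 q2]] := pow2_split J.2 l.
have q3 : J.2 + m%:Z + 1 <= 2 ^+ l * (q + 1).
  rewrite leNgt; apply/negP => h; apply: (iJ (q + 1)); rewrite h andbT.
  by move: q2; rewrite lezD1.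
exists (J.1 - l%:Z, q); split.
- move/AcolP: AJ => [j ->]; apply/AcolP; exists (j - 1) => /=; lia.
- by rewrite /dlen -expfzDr//=; congr (_ ^ _); lia.
- by apply: (@dset_sub _ _ l) => //=; lia.
- by apply: (@dset_sub _ _ l) => //=; lia.
Qed.

Lemma ancestorP d I : exists q, [/\ ancestor R d I = (I.1 - d%:Z, q),
  2 ^+ d * q <= I.2 & I.2 + 1 <= 2 ^+ d * (q + 1)].
Proof.
have [q [q1 q2]] := pow2_split I.2 d; exists q; split => //.
apply: xget_unique.
  split; first by rewrite /dlen exprnP -expfzDr//=; congr (_ ^ _); lia.
  by apply: (@dset_sub _ _ d) => //=; lia.
move=> Q [lQ IQ]; have Q1 : Q.1 = I.1 - d%:Z.
  move: lQ; rewrite [dlen R I]/dlen exprnP -expfzDr// => E.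
  by have /dlenP -> : dlen R Q = 2 ^ (- (I.1 - d%:Z)) by rewrite E opprB.
have QI : Q.1 <= I.1 by lia.
have [d' [d1 h1 h2]] := dset_subP IQ QI.
have ? : d' = d by move: d1; rewrite Q1; clear; lia.
subst d'; case: Q Q1 {lQ IQ d1 QI} h1 h2 => a b /= -> h1 h2; congr pair.
have pz : 0 < 2 ^+ d :> int by rewrite exprn_gt0.
move: (2 ^+ d : int) pz q1 q2 h1 h2 => M pz q1 q2 h1 h2.
have : b < q + 1 by nia.
have : q < b + 1 by nia.
lia.
Qed.

Lemma dinf_ancestor d I :
  dinf R I = dinf R (ancestor R d I) <-> exists N, 2 ^+ d * N = I.2.
Proof.
have [q [-> q1 q2]] := ancestorP d I.
have l0 := dlen_gt0 R I.
have E : dinf R (I.1 - d%:Z, q) = dlen R I * (2 ^+ d * q)%:~R.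
  rewrite /dinf intrM mulrA; congr (_ * _).
  rewrite rmorphXn/= /dlen /= exprnP -expfzDr//; congr (_ ^ _); lia.
rewrite E /dinf; split=> [/(mulfI (lt0r_neq0 l0)) /eqP|[N NE]].
  by rewrite eqr_int => /eqP ->; exists q.
suff -> : q = N by rewrite NE.
have pz : 0 < 2 ^+ d :> int by rewrite exprn_gt0.
move: (2 ^+ d : int) pz q1 q2 NE => M pz q1 q2 NE.
have : N < q + 1 by nia.
have : q < N + 1 by nia.
lia.
Qed.

Lemma Bcol_Acol i e J : Bcol R m i e J ->
  exists i', Acol R m i' J /\ (e = false <-> inside l m J) /\
    (forall I e', Bcol R m i e' I -> Acol R m i' I).
Proof.
have H : forall I e', Acold R m (if (i <= Lm m)%N then i else (i - (Lm m).+1)%N) e' I ->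
    Acol R m (if (i <= Lm m)%N then i else (i - (Lm m).+1)%N) I.
  by move=> I [[]|[]].
move=> BJ; exists (if (i <= Lm m)%N then i else (i - (Lm m).+1)%N).
have H' I e' : Bcol R m i e' I -> Acold R m (if (i <= Lm m)%N then i else (i - (Lm m).+1)%N) e' I.
  by rewrite /Bcol; case: ifP => _ [].
split; first exact: H (H' _ _ BJ).
split; last by move=> I e' /H'; exact: H.
have := H' _ _ BJ; case: e {BJ} => /= [[AJ nAJ]|/Acol0P[AJ iJ]].
  by split => // iJ; exfalso; apply: nAJ; apply/Acol0P.
by split.
Qed.

Lemma Bcol1P i e J : Bcol1 R m i e J ->
  [/\ Bcol R m i true J, ~ inside l m J & (e = true <-> exists N, 2 ^+ l * N = J.2 + m%:Z)].
Proof.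
move=> [BJ eJ]; have [i' [_ [nJ _]]] := Bcol_Acol BJ.
split => //; first by move=> /nJ.
have D := dinf_ancestor l (tau m J).
by case: e eJ => eJ; [split => // _; apply/D|split => // /D].
Qed.

Definition in0 i J : bool := J \in Bcol R m i false.
Definition in1 i e J : bool := J \in Bcol1 R m i e.

(** The index [i0] is read off from the level of [J] modulo [lam] and the parity
    of [J.2 %/ m]. Whether [J] is [inside], and whether [2^lam] divides
    [J.2 + m], then decides between the three collections with this index. *)
Lemma in_collections J : exists2 i0 : nat, (i0 <= Km m)%N &
  forall i, (i <= Km m)%N -> (in0 i J + in1 i false J + in1 i true J)%N = (i == i0).
Proof.
have l0 := lam_gt0; have lz : l%:Z != 0 by rewrite -lt0n in l0 *; lia.
pose r := absz (J.1 %% l%:Z)%Z.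
have rE : (r%:Z = J.1 %% l%:Z)%Z by rewrite /r gez0_abs// modz_ge0.
have rl : (r < l)%N by rewrite -ltz_nat rE ltz_pmod.
have A i : (i < l)%N -> Acol R m i J <-> i = r.
  move=> il; split=> [/AcolP[j E]|->].
    have : (J.1 %% l%:Z)%Z = i%:Z.
      by rewrite E mulrC modzMDl modz_small//; apply/andP; split; lia.
    by rewrite -rE => -[].
  apply/AcolP; exists (J.1 %/ l%:Z)%Z; rewrite rE mulrC; exact: divz_eq.
pose ev := (2 %| J.2 %/ m)%Z.
pose i0 := if ev then r else (r + l)%N.
exists i0; first by have := Km_lam; rewrite /i0; case: (ev); lia.
move=> i iK; have {}iK : (i < l.*2)%N by rewrite -Km_lam.
have B e : Bcol R m i e J <-> (if (i < l)%N then ev else ~~ ev) /\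
    Acold R m (if (i < l)%N then i else (i - l)%N) e J.
  by rewrite /Bcol -ltnS Lm_lam; case: ifP => il; split=> [[? ?]|[? ?]]; split.
have [il|il] := eqVneq i i0; last first.
  have nB e : ~ Bcol R m i e J.
    move=> /B[ev' Ad]; move/eqP: il; apply.
    have {}Ad : Acol R m (if (i < l)%N then i else (i - l)%N) J.
      by move: Ad; case: e => -[].
    move: ev' Ad; rewrite /i0; case: ifP => il; first by move=> -> /(A _ il).
    move=> /negbTE -> h; have : (i - l)%N = r by apply/A => //; lia.
    lia.
  have n0 : in0 i J = false by apply: memNset; exact: nB.
  have n1 e : in1 i e J = false by apply: memNset => -[/nB].
  by rewrite n0 !n1.
have Aj : Acol R m (if (i < l)%N then i else (i - l)%N) J /\
   (if (i < l)%N then ev else ~~ ev).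
  rewrite il /i0; case: (ev); first by rewrite rl; split => //; apply/A.
  by rewrite ltnNge leq_addl/=; split => //; rewrite addnK; apply/A.
have [iJ|niJ] := pselect (inside l m J).
  have BJ : Bcol R m i false J by apply/B; split; [exact: Aj.2|apply/Acol0P; split => //; exact: Aj.1].
  have n0 : in0 i J = true by exact: mem_set.
  have n1 e : in1 i e J = false by apply: memNset => /Bcol1P[].
  by rewrite n0 !n1.
have BJ : Bcol R m i true J.
  by apply/B; split; [exact: Aj.2|split; [exact: Aj.1|move=> /Acol0P[]]].
have nB : ~ Bcol R m i false J by move=> /Bcol_Acol[? [_ [/iffLR/(_ erefl)]]].
have n0 : in0 i J = false by exact: memNset.
have [D|D] := pselect (dinf R (tau m J) = dinf R (ancestor R l (tau m J))).
  have n1 : in1 i false J = false by apply: memNset => -[].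
  have n2 : in1 i true J = true by apply: mem_set; split.
  by rewrite n0 n1 n2.
have n1 : in1 i false J = true by apply: mem_set; split.
have n2 : in1 i true J = false by apply: memNset => -[].
by rewrite n0 n1 n2.
Qed.

Lemma Km_log : (Km m)%:R <= 7 + 2 * (ln m%:R / ln 2) :> R.
Proof.
rewrite /Km /Lm /lam; case: eqP => [->|/eqP m1].
  by rewrite ln1 mul0r mulr0 addr0.
have ln2 : 0 < ln 2 :> R by rewrite ln_gt0// ltr1n.
have H : (trunc_log 2 m)%:R <= ln m%:R / ln 2 :> R.
  rewrite ler_pdivlMr// mulr_natl -lnXn// ler_ln ?posrE ?exprn_gt0 ?ltr0n//.
  by rewrite -natrX ler_nat trunc_logP.
have -> : ((trunc_log 2 m).+3.-1.*2.+1 = 2 * trunc_log 2 m + 5)%N by lia.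
by rewrite natrD natrM; lra.
Qed.

End Collections.

(** * The identity *)

Section Identity.
Variables (R : realType) (X : completeNormedModType R) (p : R).
Hypothesis p1 : 1 < p.
Hypothesis umd : UMD X.
Variable m : nat.
Hypothesis m0 : (1 <= m)%N.
Local Notation mu := (@lebesgue_measure R).
Local Notation nrm := (@nrm _ _ _ (@lebesgue_measure R) X p).
Implicit Types (I J : dyadic) (s : seq dyadic) (x : dyadic -> X) (k : dyadic -> R) (e : bool).
Local Notation shift_difference := (@shift_difference R m).

(** Such a [T] is a Haar multiplier with values [0] and [1], which is bounded by
    unconditionality, followed by the shift difference. *)
Lemma multiplier_extension k (T : (R -> X) -> R -> X) :
  (forall J, k J = 0 \/ k J = 1) ->
  (forall s x, uniq s -> T (hp s x) = fsum shift_difference s (fun J => k J *: x J)) ->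
  exists S, Lp_extension p T S.
Proof.
move=> k01 TE; have [C C0 HC] := shift_difference_bound p1 umd m0.
have [D D0 HD] := haar_unconditional p1 umd.
pose f J t : R := k J * shift_difference J t.
have st J : step (f J) (k J * 0).
  apply: step_scale; apply: step_eq (step_sub (step_dset _ _) (step_dset _ _)) _.
  by rewrite (dlenE _ (J := J)) ?subrr.
have fE s x : fsum f s x = fsum shift_difference s (fun J => k J *: x J).
  apply/funext => t; apply: eq_bigr => J _; rewrite /f scalerA; congr (_ *: _); exact: mulrC.
apply: (@Lp_extension_exists R X p p1 f T (C * D)).
- by move=> J x; exact: (isint_step x (st J)).1.1.
- by move=> J x; exact: Lp_step p1 (st J).
- by move=> s x us; rewrite TE// fE.
- exact: mulr_ge0.
move=> s x us; rewrite fE; apply: le_trans (HC s _ us (fun _ _ => I)) _.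
rewrite -mulrA; apply: ler_wpM2l => //.
have := HD s x (fun J => k J == 1) us.
rewrite (_ : (fun t => _) = fsum (@haar R) s (fun J => k J *: x J))//.
apply/funext => t; rewrite big_mkcond; apply: eq_bigr => J _.
have [->|->] := k01 J; first by rewrite eq_sym oner_eq0 scale0r scaler0.
by rewrite eqxx scale1r.
Qed.

Lemma hsum_setT f s x : uniq s -> hsum setT f (hp s x) = fsum f s x.
Proof.
move=> us; apply/funext => t; rewrite hsum_hp//.
by apply: eq_bigr => J _; rewrite in_setT mul1r.
Qed.

Lemma hsum_projection n (S : nat -> set dyadic) s x : uniq s ->
  (fun t => \sum_(i < n) hsum (S i) (@haar R) (hp s x) t) =
  hp s (fun J => (\sum_(i < n) (J \in S i)%:R) *: x J).
Proof.
move=> us; apply/funext => t.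
under eq_bigr => i _ do rewrite hsum_hp//.
rewrite exchange_big; apply: eq_bigr => J _; rewrite scaler_suml scaler_sumr.
by apply: eq_bigr => i _; rewrite scalerA mulrC.
Qed.

Lemma Lp_extension_eq (T T' S : (R -> X) -> R -> X) :
  (forall s x, uniq s -> T (hp s x) = T' (hp s x)) ->
  Lp_extension p T S -> Lp_extension p T' S.
Proof.
move=> TT [S1 S2 S3 S4]; split => // u hu.
have [s [x [us uE]]] := (hpol_haar_polynomial u).1 hu.
by have := S4 u hu; rewrite (_ : u = hp s x)// TT.
Qed.

Definition weight0 J : R := \sum_(i < (Km m).+1) (J \in Bcol R m i false)%:R.
Definition weight1 e J : R := \sum_(i < (Km m).+1) (J \in Bcol1 R m i e)%:R.

(** The three projections of the identity form a partition of unity. *)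
Lemma weights J : [/\ weight0 J = 0 \/ weight0 J = 1,
  (forall e, weight1 e J = 0 \/ weight1 e J = 1) &
  weight0 J + weight1 false J + weight1 true J = 1].
Proof.
have [i0 i0K H] := @in_collections R m m0 J.
pose i1 : 'I_(Km m).+1 := Ordinal (i0K : i0 < (Km m).+1)%N.
have S (b : nat -> bool) : (forall i, (i <= Km m)%N -> i != i0 -> b i = false) ->
    \sum_(i < (Km m).+1) (b i)%:R = (b i0)%:R :> R.
  move=> bi; rewrite (bigD1 i1)//= big1 ?addr0// => i ii.
  by rewrite bi// -ltnS ltn_ord.
have h i : (i <= Km m)%N -> i != i0 ->
    (in0 R m i J = false) * (forall e, in1 R m i e J = false).
  move=> iK /negbTE ii; have := H i iK; rewrite ii.
  by case: (in0 _ _ _ _); case E: (in1 _ _ _ false _); case E': (in1 _ _ _ true _) => //= _;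
    split => // -[].
have E0 : weight0 J = (in0 R m i0 J)%:R.
  by rewrite /weight0 (S (fun i => in0 R m i J))// => i iK ii; rewrite h.
have E1 e : weight1 e J = (in1 R m i0 e J)%:R.
  by rewrite /weight1 (S (fun i => in1 R m i e J))// => i iK ii; rewrite h.
rewrite E0 !E1; split.
- by case: in0; [right|left].
- by move=> e; rewrite E1; case: in1; [right|left].
by rewrite -!natrD H// eqxx.
Qed.

(** On Haar polynomials all the operators are shift differences of multipliers,
    and the multipliers add up to [1]; so the sum of the extensions of the
    operators on the right is an extension of the operator on the left. *)
Lemma shift_identity :
  exists (U UP0 : (R -> X) -> R -> X) (ABP1 : bool -> (R -> X) -> R -> X),
    [/\ Lp_extension p (Uop m) U,
        Lp_extension p (Uop m \o P0 m) UP0,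
        forall e : bool,
          Lp_extension p ((fun u t => Aop m e u t + Bop m e u t) \o P1 m e) (ABP1 e) &
        forall u : R -> X, in_LpX mu p u ->
          {ae mu, forall t, U u t = UP0 u t + \sum_(e : bool) ABP1 e u t}].
Proof.
have UE s x : uniq s -> Uop m (hp s x) = fsum shift_difference s x by exact: hsum_setT.
have P0E s x : uniq s -> P0 m (hp s x) = hp s (fun J => weight0 J *: x J).
  by move=> us; have := hsum_projection (Km m).+1 (fun i => Bcol R m i false) x us.
have P1E e s x : uniq s -> P1 m e (hp s x) = hp s (fun J => weight1 e J *: x J).
  by move=> us; have := hsum_projection (Km m).+1 (fun i => Bcol1 R m i e) x us.
have ABE e s x : uniq s ->
    (fun t => Aop m e (hp s x) t + Bop m e (hp s x) t) = fsum shift_difference s x.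
  move=> us; rewrite /Aop /Bop !hsum_setT//; apply/funext => t.
  rewrite /fsum -big_split/=; apply: eq_bigr => J _.
  by rewrite -scalerDl afun_bfun.
have [UP0 HU] : exists S : (R -> X) -> R -> X, Lp_extension p (Uop m \o P0 m) S.
  apply: (@multiplier_extension weight0); first by move=> J; have [] := weights J.
  by move=> s x us; rewrite /= P0E// UE.
have /choice[AB HAB] : forall e, exists S : (R -> X) -> R -> X,
    Lp_extension p ((fun u t => Aop m e u t + Bop m e u t) \o P1 m e) S.
  move=> e; apply: (@multiplier_extension (weight1 e)).
    by move=> J; have [_ + _] := weights J; apply.
  by move=> s x us; rewrite /= P1E// ABE.
exists (fun u t => UP0 u t + AB false u t + AB true u t), UP0, AB.
split; [|exact: HU|exact: HAB|]; last first.
  by move=> u _; apply: aeW => t; rewrite big_bool/= addrAC addrA.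
apply: Lp_extension_eq (Lp_extensionD p1 (Lp_extensionD p1 HU (HAB false)) (HAB true)).
move=> s x us; apply/funext => t.
pose part k t := fsum shift_difference s (fun J => k J *: x J) t.
have W0 : (Uop m \o P0 m) (hp s x) t = part weight0 t by rewrite /= P0E// UE.
have W1 e : ((fun u t => Aop m e u t + Bop m e u t) \o P1 m e) (hp s x) t =
    part (weight1 e) t.
  by rewrite /part -(ABE e s _ us) -P1E.
rewrite (UE s x us) W0 (W1 false) (W1 true) /part /fsum -!big_split/=.
apply: eq_bigr => J _; have [_ _ W] := weights J.
by rewrite -!scalerDr -!scalerDl W scale1r.
Qed.

End Identity.

(** * The martingale differences *)

Section Families.
Variables (R : realType) (X : completeNormedModType R).
Local Notation mu := (@lebesgue_measure R).
Implicit Types (I J : dyadic) (x : dyadic -> X) (b c e : bool) (t a : R).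

Lemma composite_haar (f : dyadic -> R -> R) (S : set dyadic) I t :
  hsum setT f (hsum S (@haar R) (haar I : R -> R^o)) t = (I \in S)%:R * f I t.
Proof.
have E (k : R) : hp [:: I] (fun=> k : R^o) = (fun t => haar I t * k).
  by apply/funext => t'; rewrite /hp big_seq1.
have -> : (haar I : R -> R^o) = hp [:: I] (fun=> 1 : R^o).
  by rewrite E; apply/funext => t'; rewrite mulr1.
have -> : hsum S (@haar R) (hp [:: I] (fun=> 1 : R^o)) = hp [:: I] (fun=> (I \in S)%:R : R^o).
  rewrite [RHS]E; apply/funext => t'; rewrite hsum_hp// big_seq1 [LHS]mulr1; exact: mulrC.
by rewrite hsum_hp// big_seq1 in_setT mul1r [LHS]mulrC.
Qed.

(** Each [f I] with [I] in [B] is a sum of two mean zero pieces. The pieces are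
    what has to be compared with the past: each of them lives on a region where
    all coarser pieces are constant, although these may differ between its two
    regions. *)
Lemma mds_family_pieces (B : set dyadic) (f : dyadic -> R -> R)
    (g : bool -> dyadic -> R -> R) (reg : bool -> dyadic -> set R) :
  (forall I t, f I t = (I \in B)%:R * (g false I t + g true I t)) ->
  (forall b I, step (g b I) 0) ->
  (forall b I t, g b I t != 0 -> reg b I t) ->
  (forall b c I J t t', B I -> B J -> I.1 < J.1 -> reg b J t -> reg b J t' ->
     g c I t = g c I t') ->
  mds_family X f.
Proof.
move=> fE gstep greg gconst x fx.
pose s : seq dyadic := fset_set [set I | x I != 0].
pose phi (j : int) (i : dyadic * bool) t : R :=
  if (i.1.1 == j) && (i.1 \in B) then g i.2 i.1 t else 0.
have fs (j : int) t : \sum_(I \in level j) f I t *: x I =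
    \sum_(i <- [seq (J, b) | J <- s, b <- [:: false; true]]) phi j i t *: x i.1.
  rewrite big_allpairs_dep fsbig_mkcond (fsbigE s)/=; [| exact: fset_uniq | by [] |]; last first.
    move=> I _; rewrite in_fset_set// notin_setE/= => /negP; rewrite negbK => /eqP x0.
    by rewrite /patch x0 scaler0 if_same.
  rewrite (eq_bigl xpredT); last by move=> I; rewrite in_setT.
  apply: eq_bigr => I _; rewrite !big_cons big_nil addr0 /phi/= /patch.
  have -> : (I \in level j) = (I.1 == j) by apply/idP/eqP; rewrite inE.
  case: eqP => _ /=; last by rewrite scale0r addr0.
  by rewrite fE; case: (I \in B) => /=; rewrite ?mul1r ?scalerDl// mul0r scale0r addr0.
apply: (@mds_criterion _ _ _ mu X _ int _ (fun=> (dyadic * bool)%type) (fun=> _) phi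
  (fun _ i => x i.1) fs).
- move=> j [I b]; rewrite /phi /=; case: (_ && _).
    by apply: isint_eq (isint_step (x I) (gstep b I)) _; rewrite scale0r.
  rewrite (_ : (fun t => _) = fun=> 0); first exact: isint0.
  by apply/funext => t; rewrite scale0r.
- move=> j k [J b] t t' kj; rewrite {1 2}/phi/=.
  case: ifP; last by rewrite eqxx.
  move=> /andP[/eqP Jj /set_mem BJ] /greg tr /greg tr'.
  rewrite !fs; apply: eq_bigr => -[I c] _; congr (_ *: _); rewrite /phi/=.
  case: ifP => // /andP[/eqP Ik /set_mem BI].
  by apply: gconst tr tr' => //; rewrite Ik Jj.
Qed.

End Families.

Section ThreeFamilies.
Variables (R : realType) (X : completeNormedModType R) (m : nat).
Hypothesis m0 : (1 <= m)%N.
Implicit Types (I J : dyadic) (i : nat) (b c e : bool) (t a : R).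
Local Notation l := (lam m).

Definition region J (A B : R) : set R := `[pt J A, pt J B[%classic.

Lemma ivl_region I A B a a' t : A <= a -> a' <= B -> ivl I a a' t != 0 -> region I A B t.
Proof.
move=> Aa aB; rewrite ivlE /region/= in_itv/= -(ler_pt I) -(ler_pt I a') in Aa aB *.
case: andP => [[h1 h2] _|_]; last by rewrite eqxx.
by apply/andP; split; [exact: le_trans h1|exact: lt_le_trans aB].
Qed.

Lemma sub_region I A B (f g : R -> R) t :
  (f t != 0 -> region I A B t) -> (g t != 0 -> region I A B t) ->
  f t - g t != 0 -> region I A B t.
Proof.
move=> hf hg; have [->|/hf//] := eqVneq (f t) 0.
by have [->|/hg//] := eqVneq (g t) 0; rewrite subrr eqxx.
Qed.

Lemma step_ivl_sub I a a' d d' : a <= a' -> d <= d' -> a' - a = d' - d ->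
  step (fun t => ivl I a a' t - ivl I d d' t) 0.
Proof.
move=> aa dd E; apply: step_eq (step_sub (step_ivl I aa) (step_ivl I dd)) _.
by rewrite E subrr.
Qed.

Lemma Bcol_levels i e I J : Bcol R m i e I -> Bcol R m i e J -> I.1 < J.1 ->
  I.1 + l%:Z <= J.1.
Proof.
move=> BI BJ; have [i' [AJ [_ /(_ _ _ BI) AI]]] := Bcol_Acol m0 BJ.
move=> IJ; exact (Acol_levels m0 AI AJ IJ).
Qed.

Definition integer a := exists N : int, 1 * a = N%:~R.
Definition shifted a := exists N : int, 3 * a = N%:~R /\ ~~ (3 %| N)%Z.

Lemma integer_coarse I J a : I.1 + l%:Z <= J.1 -> integer a -> coarse_dyadic l J (pt I a).
Proof. by move=> IJ [N E]; apply: (@pt_coarse_dyadic _ 0 _ _ _ _ N) => //; rewrite expr0. Qed.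

Lemma shifted_coarse I J a : I.1 + l%:Z <= J.1 -> shifted a -> coarse_shifted l J (pt I a).
Proof.
by move=> IJ [N [E N3]]; apply: (@pt_coarse_shifted _ 0 _ _ _ _ N) => //; rewrite expr0 mul1r.
Qed.

Lemma integer_int (z : int) : integer z%:~R.
Proof. by exists z; rewrite mul1r. Qed.

Lemma integer0 : integer 0. Proof. exact: (integer_int 0). Qed.
Lemma integer1 : integer 1. Proof. exact: (integer_int 1). Qed.
Lemma integer_m : integer m%:R. Proof. exact: (integer_int m). Qed.
Lemma integer_mS : integer (m%:R + 1).
Proof. by have := integer_int (m%:Z + 1); rewrite intrD -pmulrn. Qed.

Lemma shifted_theta j (z : int) a : a = z%:~R + theta R j -> shifted a.
Proof.
move=> ->; have [N [E N3]] := theta_shifted R j; exists (3 * z + N); split.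
  by rewrite mulrDr E intrD intrM.
by apply: contra N3 => /dvdzP[q qE]; apply/dvdzP; exists (q - z); lia.
Qed.

(** All jumps have integer coordinates, and no coarse dyadic point lies in the
    region of an interval of this collection. *)
Lemma U_family i : mds_family X (fun I t => (I \in Bcol R m i false)%:R * @shift_difference R m I t).
Proof.
have m1 : 1 <= m%:R :> R by rewrite ler1n.
have sdE I t : @shift_difference R m I t = ivl I m%:R (m%:R + 1) t - ivl I 0 1 t.
  by rewrite /shift_difference indic_tau_ivl indic_dset_ivl.
pose g b I t : R := if b then 0 else ivl I m%:R (m%:R + 1) t - ivl I 0 1 t.
apply: (@mds_family_pieces _ X _ _ g (fun _ J => region J 0 (m%:R + 1))).
- by move=> I t; rewrite /g addr0 sdE.
- move=> [] I; first exact: step0.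
  by apply: step_ivl_sub; lra.
- move=> [] I t; first by rewrite eqxx.
  by apply: sub_region; apply: ivl_region; lra.
- move=> b [] I J t t' BI BJ IJ // rt rt'.
  have lvl := Bcol_levels BI BJ IJ.
  have iJ : inside l m J by have [_ [_ [H _]]] := Bcol_Acol m0 BJ; exact: H.1.
  have out a : integer a -> outside (pt I a) (pt J 0) (pt J (m%:R + 1)).
    by move=> /(integer_coarse lvl); exact: coarse_dyadic_inside.
  rewrite /g; congr (_ - _); apply: indic_const rt rt'; apply: out;
  [exact: integer_m|exact: integer_mS|exact: integer0|exact: integer1].
Qed.

(** All jumps are points of the shifted grid, and a coarse dyadic point in the
    region of [J] keeps the coarse ones away. *)
Lemma A_family i e : mds_family X (fun I t => (I \in Bcol1 R m i e)%:R * @afun R m e I t).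
Proof.
have m1 : 1 <= m%:R :> R by rewrite ler1n.
have e01 : 0 <= e%:R :> R /\ e%:R <= 1 :> R by case: (e) => /=; split; lra.
pose o I : R := theta R I.1 + e%:R.
pose g b I t : R := if b then 0 else
  ivl I (m%:R + (o I - 1)) (m%:R + o I) t - ivl I (o I - 1) (o I) t.
apply: (@mds_family_pieces _ X _ _ g (fun _ J => region J (-1) (m%:R + 2))).
- by move=> I t; rewrite /g addr0 afun_ivl.
- move=> [] I; first exact: step0.
  by apply: step_ivl_sub; lra.
- move=> [] I t; first by rewrite eqxx.
  have /andP[t0 t1] := theta_bound R I.1; rewrite /g /o.
  by apply: sub_region; apply: ivl_region; lra.
- move=> b [] I J t t' BI BJ IJ // rt rt'.
  have [BI1 _ _] := Bcol1P m0 BI; have [BJ1 nJ _] := Bcol1P m0 BJ.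
  have lvl := Bcol_levels BI1 BJ1 IJ.
  have out (z : int) a : a = z%:~R + theta R I.1 -> outside (pt I a) (pt J (-1)) (pt J (m%:R + 2)).
    move=> /shifted_theta/(shifted_coarse lvl).
    by apply: coarse_shifted_crossing => //; exact: lam_large.
  have eZ : e%:R = (e : nat)%:~R :> R by rewrite -pmulrn.
  have mZ : m%:R = (m%:Z)%:~R :> R by rewrite -pmulrn.
  rewrite /g /o; congr (_ - _); apply: indic_const rt rt'.
  + by apply: (out (m%:Z + e%:Z - 1)); rewrite intrB intrD -eZ -mZ; ring.
  + by apply: (out (m%:Z + e%:Z)); rewrite intrD -eZ -mZ; ring.
  + by apply: (out (e%:Z - 1)); rewrite intrB -eZ; ring.
  + by apply: (out e%:Z); rewrite -eZ; ring.
Qed.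

(** The function [bfun e I] lives around the point of coordinate [z], and has its
    jumps at the coordinates [a1], ..., [a4]; the other piece lives around the
    point of coordinate [m + z]. Coarse shifted points are outside the whole region
    of [J]; coarse dyadic ones are outside the regions of the two pieces unless
    they are one of these two points. *)
Lemma B_family_pieces i e (z : int) (a1 a2 a3 a4 : int -> R) :
  (forall I t, bfun e I t = ivl I (a1 I.1) (a2 I.1) t - ivl I (a3 I.1) (a4 I.1) t) ->
  (forall j, [/\ z%:~R - 1 <= a1 j, a1 j <= a2 j & a2 j <= z%:~R + 1]) ->
  (forall j, [/\ z%:~R - 1 <= a3 j, a3 j <= a4 j & a4 j <= z%:~R + 1]) ->
  (forall j, a2 j - a1 j = a4 j - a3 j) ->
  (forall j a, a \in [:: a1 j; a2 j; a3 j; a4 j] -> integer a \/ exists k : int, a = k%:~R + theta R j) ->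
  (0 <= z <= 1) ->
  (forall J N, Bcol1 R m i e J -> 2 ^+ l * N <> J.2 + z) ->
  (forall J N, Bcol1 R m i e J -> 2 ^+ l * N <> J.2 + (m%:Z + z)) ->
  mds_family X (fun I t => (I \in Bcol1 R m i e)%:R * (bfun e I t - bfun e (tau m I) t)).
Proof.
move=> bE h12 h34 hm grid z01 nz nmz.
pose sh b : R := if b then m%:R else 0.
pose sg b : R := if b then -1 else 1.
pose g b I t : R := sg b * (ivl I (sh b + a1 I.1) (sh b + a2 I.1) t -
  ivl I (sh b + a3 I.1) (sh b + a4 I.1) t).
pose ctr b : R := sh b + z%:~R.
apply: (@mds_family_pieces _ X _ _ g (fun b J => region J (ctr b - 1) (ctr b + 1))).
- by move=> I t; rewrite /g /sg/= mul1r mulN1r !add0r !bE !ivl_tau.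
- move=> b I; apply: step_eq (step_scale _ (step_ivl_sub _ _ _ _)) (mulr0 _).
  + by have [_ ? _] := h12 I.1; lra.
  + by have [_ ? _] := h34 I.1; lra.
  + by have := hm I.1; lra.
- move=> b I t; rewrite mulf_eq0 negb_or => /andP[_].
  have [? ? ?] := h12 I.1; have [? ? ?] := h34 I.1.
  by apply: sub_region; apply: ivl_region; rewrite /ctr; lra.
- move=> b c I J t t' BI BJ IJ rt rt'.
  have [BI1 _ _] := Bcol1P m0 BI; have [BJ1 nJ _] := Bcol1P m0 BJ.
  have lvl := Bcol_levels BI1 BJ1 IJ.
  have m1 : 1 <= m%:R :> R by rewrite ler1n.
  have shZ d : exists k : int, sh d = k%:~R.
    by case: d; [exists m%:Z; rewrite -pmulrn|exists 0].
  have out a : a \in [:: a1 I.1; a2 I.1; a3 I.1; a4 I.1] ->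
      outside (pt I (sh c + a)) (pt J (ctr b - 1)) (pt J (ctr b + 1)).
    have [k kE] := shZ c.
    move=> /grid[[N aN]|[k' ->]].
      have /(integer_coarse lvl) H : integer (sh c + a).
        by exists (k + N); rewrite mulrDr aN mul1r kE intrD.
      rewrite /ctr /sh; case: (b).
        have := coarse_dyadic_two (fun N => @nmz J N BJ) H.
        by rewrite intrD -pmulrn.
      have := coarse_dyadic_two (fun N => @nz J N BJ) H.
      by rewrite add0r.
    have /shifted_theta/(shifted_coarse lvl) H : sh c + (k'%:~R + theta R I.1) = (k + k')%:~R + theta R I.1.
      by rewrite intrD kE addrA.
    have [h|h] := coarse_shifted_crossing (lam_large m0) nJ H.
      left; apply: le_trans h _; rewrite ler_pt /ctr /sh.
      by move: z01 => /andP[z0 _]; have : 0 <= z%:~R :> R by [rewrite ler0z]; case: (b); lra.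
    right; apply: le_trans h; rewrite ler_pt /ctr /sh.
    by move: z01 => /andP[_ z1]; have : z%:~R <= 1 :> R by [rewrite lerz1]; case: (b); lra.
  rewrite /g; congr (_ * (_ - _)); apply: indic_const rt rt'; apply: out;
    by rewrite !inE eqxx ?orbT.
Qed.

Lemma no_multiple (M k q : int) : 0 < k < M -> M * q <> k.
Proof.
move=> /andP[k0 kM] E; have M0 : 0 < M by lia.
have q0 : 0 < q by rewrite -(pmulr_rgt0 _ M0) E.
by have := ler_pM2l M0 1 q; rewrite -[1 <= q]/(0 < q) q0 E mulr1 => H; lia.
Qed.

(** For [e = true] the point of coordinate [m] is coarse, so those of coordinates
    [1] and [m + 1] are not, the former because [1 < m]. For [e = false] the point
    of coordinate [m] is not coarse, and the one of coordinate [0] is not because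
    a coarse point follows it at distance at most [m |J|]. *)
Lemma B_family i e : (e = true -> (2 <= m)%N) ->
  mds_family X (fun I t => (I \in Bcol1 R m i e)%:R * (bfun e I t - bfun e (tau m I) t)).
Proof.
have lp := pow_lam_gt m0.
case: e => [/(_ erefl) m2|_].
- apply: (@B_family_pieces i true 1 (fun=> 1) (fun j => theta R j + 1) (fun=> 0) (theta R)).
  + exact: bfun_true.
  + by move=> j; have /andP[? ?] := theta_bound R j; split; lra.
  + by move=> j; have /andP[? ?] := theta_bound R j; split; lra.
  + by move=> j; rewrite subr0 addrK.
  + move=> j a; rewrite !inE => /or4P[] /eqP ->.
    * by left; exact: integer1.
    * by right; exists 1; rewrite addrC.
    * by left; exact: integer0.
    * by right; exists 0; rewrite add0r.
  + by [].
  + move=> J N /(Bcol1P m0)[_ _ [/(_ erefl)[N0 N0E] _]] NE.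
    by apply: (@no_multiple (2 ^+ l) (m%:Z - 1) (N0 - N)); [apply/andP; split|]; lia.
  + move=> J N /(Bcol1P m0)[_ _ [/(_ erefl)[N0 N0E] _]] NE.
    by apply: (@no_multiple (2 ^+ l) 1 (N - N0)); [apply/andP; split|]; lia.
- apply: (@B_family_pieces i false 0 (fun j => theta R j - 1) (fun=> 0) (theta R) (fun=> 1)).
  + exact: bfun_false.
  + by move=> j; have /andP[? ?] := theta_bound R j; split; lra.
  + by move=> j; have /andP[? ?] := theta_bound R j; split; lra.
  + by move=> j; lra.
  + move=> j a; rewrite !inE => /or4P[] /eqP ->.
    * by right; exists (-1); rewrite addrC.
    * by left; exact: integer0.
    * by right; exists 0; rewrite add0r.
    * by left; exact: integer1.
  + by [].
  + move=> J N /(Bcol1P m0)[_ /existsNP[N0 /notP/andP[k1 k2]] _] NE.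
    by apply: (@no_multiple (2 ^+ l) (2 ^+ l * N0 - J.2) (N0 - N)); [apply/andP; split|]; lia.
  + move=> J N /(Bcol1P m0)[_ _ [_ H]]; rewrite addr0 => NE.
    by have /H : exists N, 2 ^+ l * N = J.2 + m%:Z by exists N.
Qed.

End ThreeFamilies.

Theorem theorem5p1 (R : realType) (X : completeNormedModType R) (p : R)
    (m : nat) (hp : 1 < p) (hX : UMD X) (hm : (1 <= m)%N) :
  [/\ exists (U UP0 : (R -> X) -> R -> X) (ABP1 : bool -> (R -> X) -> R -> X),
        [/\ Lp_extension p (Uop m) U,
            Lp_extension p (Uop m \o P0 m) UP0,
            forall e : bool,
              Lp_extension p ((fun u t => Aop m e u t + Bop m e u t) \o P1 m e)
                (ABP1 e) &
            forall u : R -> X, in_LpX (@lebesgue_measure R) p u ->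
              {ae @lebesgue_measure R, forall t,
                U u t = UP0 u t + \sum_(e : bool) ABP1 e u t}],
      forall i : nat, (i <= Km m)%N ->
        mds_family X (fun I => Uop m (P0i m i (@haar R I : R -> R^o)) : R -> R),
      forall (i : nat) (e : bool), (i <= Km m)%N ->
        mds_family X
          (fun I => Aop m e (P1i m i e (@haar R I : R -> R^o)) : R -> R),
      forall (i : nat) (e : bool), (i <= Km m)%N -> (e = true -> (2 <= m)%N) ->
        mds_family X
          (fun I => Bop m e (P1i m i e (@haar R I : R -> R^o)) : R -> R) &
      (Km m)%:R <= 7 + 2 * (ln m%:R / ln 2) :> R].
Proof.
have E (f : dyadic -> R -> R) (S : set dyadic) :
    (fun I => hsum setT f (hsum S (@haar R) (@haar R I : R -> R^o)) : R -> R) =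
    fun I t => (I \in S)%:R * f I t.
  by apply/funext => I; apply/funext => t; exact: composite_haar.
split.
- exact: shift_identity.
- move=> i _; rewrite /Uop /P0i E; exact: U_family.
- move=> i e _; rewrite /Aop /P1i E; exact: A_family.
- move=> i e _ he; rewrite /Bop /P1i E; exact: B_family.
- exact: Km_log.
Qed.
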